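(* In the setting described in the context, the centralizer $A=C_{M_1}(N)$, with its algebra structure and with the comultiplication, counit and antipode $S_A$ defined in the context by duality with $B=C_{M_2}(M)$, is a semisimple weak Hopf algebra isomorphic to the dual weak Hopf algebra of $B$.
   Context: Conventions. $k$ is a field; algebras are unital associative $k$-algebras; summation over repeated indices (finite sums) is understood; $C_X(Y)$ is the centralizer of $Y$ in $X$; Sweedler notation $\Delta(h)=h_{(1)}\otimes h_{(2)}$ is used. Extensions. An algebra extension $M/N$ is Frobenius if there are an $N$-$N$-bimodule map $E:M\to N$ (Frobenius homomorphism) and finite families $\{x_i\},\{y_i\}$ in $M$ (dual bases for $E$) with $E(mx_i)y_i=m=x_iE(y_im)$ for all $m\in M$. It is strongly separable of index $\lambda^{-1}$ if also $E(1)=1$ and $x_iy_i=\lambda^{-1}1$ with $0\neq\lambda\in k$. It is a Markov extension if moreover there is a trace $T:N\to k$ (Markov trace) with $T(1)=1$ such that $T_0:=T\circ E$ is a trace on $M$. It is a symmetric Markov extension if moreover $E(ux)=E(xu)$ for all $x\in M$, $u\in U:=C_M(N)$. A $k$-algebra is Kanzaki separable if it has a separability element that is symmetric (invariant under the flip). Jones tower. $M_1=M\otimes_N M$, $e_1=1\otimes 1$, elements written $me_1m'=m\otimes m'$, product $(me_1m')(ne_1n')=mE(m'n)e_1n'$, unit $x_ie_1y_i$, $M\subset M_1$ via $m\mapsto mx_ie_1y_i$, and $E_M:M_1\to M$, $E_M(me_1m')=\lambda mm'$. $M_1/M$ is again a symmetric Markov extension of index $\lambda^{-1}$ with Frobenius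 homomorphism $E_M$ and Markov trace $T_0$. Iterating for $M_1/M$ gives $M_2=M_1e_2M_1$ and $E_{M_1}:M_2\to M_1$, $E_{M_1}(xe_2y)=\lambda xy$. Put $T_1=T_0\circ E_M$, $T_2=T_1\circ E_{M_1}$ (traces on $M_1$, $M_2$). Centralizers: $U=C_M(N)$, $V=C_{M_1}(M)$, $W=C_{M_2}(M_1)$, $A=C_{M_1}(N)$, $B=C_{M_2}(M)$, $C=C_{M_2}(N)$. $T$ also denotes the restriction of $T_2$ to $C$. Let $\phi:U\to V$, $\phi(u)=x_iue_1y_i$ (an algebra anti-isomorphism). Standing assumptions. (i) $M/N$ is a symmetric Markov extension. (ii) Symmetric product: $x_iy_i=y_ix_i=\lambda^{-1}1$ (alternatively, instead of $y_ix_i=\lambda^{-1}1$ one may assume $T_0|_U=T_1\circ\phi$). (iii) Weak irreducibility: $U$ is a Kanzaki separable $k$-algebra and $T_0|_U$ is a non-degenerate trace. (iv) Depth $2$: $E_M$ has dual bases lying in $A$, and $E_{M_1}$ has dual bases $\{u_j\},\{v_j\}$ lying in $B$. Structure on $B$. $f=f^{(1)}\otimes f^{(2)}$ is the unique symmetric separability element of $V$ and $w=[f^{(1)}T(f^{(2)})]^{-1}\in Z(V)$ (an invertible element of the center of $V$). The bilinear forms $\langle a,b\rangle=\lambda^{-2}T(ae_2e_1wb)$ and $\langle a,b\rangle'=\lambda^{-2}T(be_1e_2wa)$ on $A\times B$ are non-degenerate. Define $\Delta(b)=b_{(1)}\otimes b_{(2)}$ by $\langle a_1,b_{(1)}\rangle\langle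 a_2,b_{(2)}\rangle=\langle a_1a_2,b\rangle$ for all $a_1,a_2\in A$; $\varepsilon(b)=\langle 1,b\rangle$; and the linear bijection $S:B\to B$ by $\langle a,b\rangle=\langle a,S(b)\rangle'$ for all $a\in A$. With these, $B$ is a weak Hopf algebra. Structure on $A$. The comultiplication $a\mapsto a_{(1)}\otimes a_{(2)}$ of $A$ is defined by $\langle a_{(1)},b\rangle\langle a_{(2)},b'\rangle=\langle a,bb'\rangle$ for all $b,b'\in B$; the counit by $\varepsilon_A(a)=\langle a,1\rangle$; the antipode by $\langle S_A(a),b\rangle=\langle a,S(b)\rangle$ for all $b\in B$. Weak Hopf algebra. A weak Hopf algebra is a $k$-vector space $H$ with an algebra structure $(H,m,1)$ and a coalgebra structure $(H,\Delta,\varepsilon)$ such that: (1) $\Delta(hg)=\Delta(h)\Delta(g)$; (2) $\varepsilon(hgf)=\varepsilon(hg_{(1)})\varepsilon(g_{(2)}f)=\varepsilon(hg_{(2)})\varepsilon(g_{(1)}f)$ and $(\Delta\otimes\mathrm{id})\Delta(1)=(\Delta(1)\otimes1)(1\otimes\Delta(1))=(1\otimes\Delta(1))(\Delta(1)\otimes1)$; (3) there is a linear map $S:H\to H$ (antipode) with $h_{(1)}S(h_{(2)})=(\varepsilon\otimes\mathrm{id})(\Delta(1)(h\otimes1))$, $S(h_{(1)})h_{(2)}=(\mathrm{id}\otimes\varepsilon)((1\otimes h)\Delta(1))$, $S(h_{(1)})h_{(2)}S(h_{(3)})=S(h)$, for all $h,g,f\in H$. For $H$ finite-dimensional the dual $H^*=\mathrm{Hom}_k(H,k)$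 is a weak Hopf algebra with the transposed structure maps: $\langle\varphi\psi,h\rangle=\langle\varphi\otimes\psi,\Delta(h)\rangle$, $\langle\Delta(\varphi),h\otimes g\rangle=\langle\varphi,hg\rangle$, $\langle S(\varphi),h\rangle=\langle\varphi,S(h)\rangle$, unit $\varepsilon$, counit $\varphi\mapsto\langle\varphi,1\rangle$. Morphisms of weak Hopf algebras are algebra and coalgebra maps commuting with the antipodes. *)

(* Defs.v *)
From HB Require Import structures.
From mathcomp Require Import all_boot all_order all_algebra.
From mathcomp Require Import boolp classical_sets functions.

Set Implicit Arguments.
Unset Strict Implicit.
Unset Printing Implicit Defensive.

Import GRing.Theory.
Local Open Scope ring_scope.
Local Open Scope quotient_scope.

Section Tensor.
Variables (k : fieldType) (X Y : lmodType k) (N : Type).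
Variables (ra : N -> {linear X -> X}) (la : N -> {linear Y -> Y}).

(* The sequence [:: (x1, y1); ...; (xn, yn)] stands for the finite sum
   x1 (x) y1 + ... + xn (x) yn in X (x)_N Y, where N acts on X (on the right)
   by ra and on Y (on the left) by la.  The opposite of x (x) y is (- x) (x) y
   and c *: (x (x) y) is (c *: x) (x) y. *)
Inductive tens_eq : seq (X * Y) -> seq (X * Y) -> Prop :=
| tens_refl s : tens_eq s s
| tens_sym s t : tens_eq s t -> tens_eq t s
| tens_trans s t u : tens_eq s t -> tens_eq t u -> tens_eq s u
| tens_cat s t s' t' :
    tens_eq s t -> tens_eq s' t' -> tens_eq (s ++ s') (t ++ t')
| tens_catC s t : tens_eq (s ++ t) (t ++ s)
| tens_zero y : tens_eq [:: (0, y)] [::]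
| tens_addl x x' y : tens_eq [:: (x + x', y)] [:: (x, y); (x', y)]
| tens_addr x y y' : tens_eq [:: (x, y + y')] [:: (x, y); (x, y')]
| tens_bal n x y : tens_eq [:: (ra n x, y)] [:: (x, la n y)].

Definition tens_eqb (s t : seq (X * Y)) : bool := `[< tens_eq s t >].

Lemma tens_eqb_equiv : equiv_class_of tens_eqb.
Proof.
split=> [s|s t|t s u].
- exact/asboolP/tens_refl.
- by apply/asboolP/asboolP; exact: tens_sym.
- by move=> /asboolP st /asboolP tu; apply/asboolP; exact: tens_trans st tu.
Qed.

Canonical tens_equiv := EquivRelPack tens_eqb_equiv.

Definition tensor := {eq_quot tens_eqb}.
HB.instance Definition _ := Choice.on tensor.

Definition tsum (s : seq (X * Y)) : tensor := \pi_tensor s.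

Definition tens (x : X) (y : Y) : tensor := tsum [:: (x, y)].

Lemma tsumP s t : tens_eq s t -> tsum s = tsum t.
Proof. by move=> st; apply/eqmodP/asboolP. Qed.

Lemma tsum_repr t : tsum (repr t) = t.
Proof. exact: reprK. Qed.

Lemma tsum_inj s t : tsum s = tsum t -> tens_eq s t.
Proof. by move=> /eqmodP/asboolP. Qed.

Lemma repr_tsum s : tens_eq (repr (tsum s)) s.
Proof. by apply: tsum_inj; rewrite tsum_repr. Qed.

Let smapP (c : k) s t : tens_eq s t ->
  tens_eq [seq (c *: p.1, p.2) | p <- s] [seq (c *: p.1, p.2) | p <- t].
Proof.
elim=> {s t}.
- by move=> s; exact: tens_refl.
- by move=> s t _; exact: tens_sym.
- by move=> s t u _ st _; exact: tens_trans.
- by move=> s t s' t' _ st _ st'; rewrite !map_cat; exact: tens_cat.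
- by move=> s t; rewrite !map_cat; exact: tens_catC.
- by move=> y /=; rewrite scaler0; exact: tens_zero.
- by move=> x x' y /=; rewrite scalerDr; exact: tens_addl.
- by move=> x y y' /=; exact: tens_addr.
- by move=> n x y /=; rewrite -linearZ; exact: tens_bal.
Qed.

Definition tens_add (s t : tensor) : tensor := tsum (repr s ++ repr t).
Definition tens_scale (c : k) (s : tensor) : tensor :=
  tsum [seq (c *: p.1, p.2) | p <- repr s].
Definition tens_opp (s : tensor) : tensor := tens_scale (-1) s.

Let addE s t : tens_add (tsum s) (tsum t) = tsum (s ++ t).
Proof. by apply/tsumP/tens_cat; exact: repr_tsum. Qed.

Let scaleE c s : tens_scale c (tsum s) = tsum [seq (c *: p.1, p.2) | p <- s].
Proof. by apply/tsumP/smapP; exact: repr_tsum. Qed.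

Let tindex (P : tensor -> Prop) : (forall s, P (tsum s)) -> forall t, P t.
Proof. by move=> Ps t; rewrite -(tsum_repr t). Qed.

Let addA : associative tens_add.
Proof.
by elim/tindex=> s; elim/tindex=> t; elim/tindex=> u; rewrite !addE catA.
Qed.

Let addC : commutative tens_add.
Proof.
by elim/tindex=> s; elim/tindex=> t; rewrite !addE; exact/tsumP/tens_catC.
Qed.

Let add0 : left_id (tsum [::]) tens_add.
Proof. by elim/tindex=> s; rewrite addE. Qed.

Let scaleDl s c d : tens_scale (c + d) s = tens_add (tens_scale c s) (tens_scale d s).
Proof.
elim/tindex: s => s; rewrite !scaleE addE; apply/tsumP.
elim: s => [|[x y] s IH] /=; first exact: tens_refl.
rewrite -cat1s scalerDl; apply: (tens_trans (tens_cat (tens_addl _ _ _) IH)).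
rewrite /= -[X in tens_eq X _]/([:: _] ++ ([:: _] ++ _ ++ _)).
rewrite -[X in tens_eq _ X]/([:: _] ++ (_ ++ ([:: _] ++ _))).
apply: (tens_cat (tens_refl _)).
rewrite !catA; apply: (tens_cat _ (tens_refl _)); exact: tens_catC.
Qed.

Let scale0 s : tens_scale 0 s = tsum [::].
Proof.
elim/tindex: s => s; rewrite scaleE; apply/tsumP.
elim: s => [|[x y] s IH] /=; first exact: tens_refl.
by rewrite -cat1s scale0r; exact: (tens_cat (tens_zero y) IH).
Qed.

Let scale1 : left_id 1 tens_scale.
Proof.
elim/tindex=> s; rewrite scaleE; congr tsum.
by rewrite -[RHS]map_id; apply: eq_map => -[x y]; rewrite /= scale1r.
Qed.

Let addN : left_inverse (tsum [::]) tens_opp tens_add.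
Proof.
by move=> s; rewrite -[X in tens_add _ X]scale1 -scaleDl addNr scale0.
Qed.

HB.instance Definition _ := GRing.isZmodule.Build tensor addA addC add0 addN.

Let scaleA c d s : tens_scale c (tens_scale d s) = tens_scale (c * d) s.
Proof.
elim/tindex: s => s; rewrite !scaleE -map_comp; congr tsum.
by apply: eq_map => -[x y]; rewrite /= scalerA.
Qed.

Let scaleDr : right_distributive tens_scale +%R.
Proof.
move=> c; elim/tindex=> s; elim/tindex=> t.
by rewrite -![_ + _]/(tens_add _ _) addE !scaleE addE map_cat.
Qed.

HB.instance Definition _ :=
  GRing.Zmodule_isLmodule.Build k tensor scaleA scale1 scaleDr scaleDl.

Lemma tsum0 : tsum [::] = 0.
Proof. by []. Qed.

Lemma tsum_cat s t : tsum (s ++ t) = tsum s + tsum t.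
Proof. by rewrite -[RHS]/(tens_add _ _) addE. Qed.

Lemma tsumE s : tsum s = \sum_(p <- s) tens p.1 p.2.
Proof.
elim: s => [|[x y] s IH]; first by rewrite big_nil.
by rewrite big_cons -IH -cat1s tsum_cat.
Qed.

Lemma tensE t : t = \sum_(p <- repr t) tens p.1 p.2.
Proof. by rewrite -tsumE tsum_repr. Qed.

Lemma tensDl x x' y : tens (x + x') y = tens x y + tens x' y.
Proof. by rewrite /tens -tsum_cat; exact/tsumP/tens_addl. Qed.

Lemma tensDr x y y' : tens x (y + y') = tens x y + tens x y'.
Proof. by rewrite /tens -tsum_cat; exact/tsumP/tens_addr. Qed.

Lemma tensZl c x y : tens (c *: x) y = c *: tens x y.
Proof. by rewrite -[RHS]/(tens_scale _ _) scaleE. Qed.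

Lemma tens_balanced n x y : tens (ra n x) y = tens x (la n y).
Proof. exact/tsumP/tens_bal. Qed.

Lemma tens_ind (P : tensor -> Prop) :
    P 0 -> (forall s t, P s -> P t -> P (s + t)) -> (forall x y, P (tens x y)) ->
  forall t, P t.
Proof. by move=> P0 PD Pt t; rewrite (tensE t); apply: big_ind. Qed.

(* The map x (x) y |-> b x y, meaningful when b is balanced. *)
Definition tlift (P : zmodType) (b : X -> Y -> P) (t : tensor) : P :=
  \sum_(p <- repr t) b p.1 p.2.

Definition balanced (P : zmodType) (b : X -> Y -> P) :=
  [/\ forall y, {morph (b^~ y) : x x' / x + x'},
      forall x, {morph b x : y y' / y + y'}
    & forall n x y, b (ra n x) y = b x (la n y)].

Section Lift.
Variables (P : zmodType) (b : X -> Y -> P).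
Hypothesis bP : balanced b.

Lemma tlift_tsum s : tlift b (tsum s) = \sum_(p <- s) b p.1 p.2.
Proof.
have [bDl bDr bN] := bP; rewrite /tlift.
suff E u t : tens_eq u t -> \sum_(p <- u) b p.1 p.2 = \sum_(p <- t) b p.1 p.2.
  exact/E/repr_tsum.
elim=> {u t} [//|u t _ -> //|u t v _ -> _ -> //| | | | | |] /=.
- by move=> s1 t1 s2 t2 _ e1 _ e2; rewrite !big_cat /= e1 e2.
- by move=> s1 t1; rewrite !big_cat /= addrC.
- move=> y; rewrite big_seq1 big_nil /=.
  by apply: (addrI (b 0 y)); rewrite -bDl !addr0.
- by move=> *; rewrite !big_cons !big_nil !addr0 bDl.
- by move=> *; rewrite !big_cons !big_nil !addr0 bDr.
- by move=> *; rewrite !big_seq1 bN.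
Qed.

Lemma tlift_tens x y : tlift b (tens x y) = b x y.
Proof. by rewrite tlift_tsum big_seq1. Qed.

Lemma tliftD : {morph tlift b : s t / s + t}.
Proof.
elim/tindex=> s; elim/tindex=> t.
by rewrite -tsum_cat !tlift_tsum big_cat.
Qed.

Lemma tlift0 : tlift b 0 = 0.
Proof. by rewrite -tsum0 tlift_tsum big_nil. Qed.

Lemma tlift_sum I (r : seq I) (Q : pred I) (F : I -> tensor) :
  tlift b (\sum_(i <- r | Q i) F i) = \sum_(i <- r | Q i) tlift b (F i).
Proof. exact: (big_morph _ tliftD tlift0). Qed.
End Lift.

Lemma tliftZ (P : lmodType k) (b : X -> Y -> P) : balanced b ->
  (forall c x y, b (c *: x) y = c *: b x y) -> forall c t, tlift b (c *: t) = c *: tlift b t.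
Proof.
move=> bP bZ c; elim/tindex=> s; rewrite -[c *: _]/(tens_scale _ _) scaleE.
rewrite !tlift_tsum // big_map scaler_sumr; apply: eq_bigr => p _; exact: bZ.
Qed.

End Tensor.

Arguments tens {k X Y N ra la} x y.

Definition tensk (k : fieldType) (X Y : lmodType k) :=
  tensor (fun c : k => ( *:%R c : {linear X -> X}))
         (fun c : k => ( *:%R c : {linear Y -> Y})).
HB.instance Definition _ k X Y := GRing.Lmodule.on (@tensk k X Y).

Definition pure (k : fieldType) (X Y : lmodType k) (x : X) (y : Y) : tensk X Y :=
  tens x y.

Notation "X ⊗ Y" := (tensk X%type Y%type) (at level 40, left associativity) : type_scope.
Notation "x ⊗ y" := (pure x y) : ring_scope.

(* Sweedler-style evaluation: if t = sum x_(1) (x) x_(2), then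
   sweedler b t = sum b x_(1) x_(2), for b a k-bilinear map. *)
Definition sweedler (k : fieldType) (X Y : lmodType k) (P : zmodType)
  (b : X -> Y -> P) (t : X ⊗ Y) : P := tlift b t.

Definition dual_bases (k : fieldType) (N M : algType k)
    (i : N -> M) (E : M -> N) (n : nat) (x y : 'I_n -> M) :=
  forall m, \sum_j i (E (m * x j)) * y j = m /\ \sum_j x j * i (E (y j * m)) = m.

Record strongly_separable (k : fieldType) := StronglySeparable {
  base : algType k;
  total : algType k;
  (* the inclusion N -> M, injective because cexp (incl n) = n *)
  incl : {lrmorphism base -> total};
  cexp : {linear total -> base};
  dbsize : nat;
  dbl : 'I_dbsize -> total;
  dbr : 'I_dbsize -> total;
  lam : k;
  cexpM : forall n m n', cexp (incl n * m * incl n') = n * cexp m * n';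
  dbP : dual_bases incl cexp dbl dbr;
  cexp1 : cexp 1 = 1;
  lam_neq0 : lam != 0;
  dbl_dbr : \sum_j dbl j * dbr j = lam^-1 *: 1
}.

Arguments dbl {k} _ _.
Arguments dbr {k} _ _.

Section BasicConstruction.
Variables (k : fieldType) (F : strongly_separable k).
Local Notation N := (base F).
Local Notation M := (total F).
Local Notation i := (incl F).
Local Notation E := (cexp F).
Local Notation x := (dbl F).
Local Notation y := (dbr F).

(* M_1 = M (x)_N M, where m e_1 m' is m (x) m' *)
Definition jones_type :=
  tensor (fun n : N => (i n \o* idfun : {linear M -> M}))
         (fun n : N => (i n \*o idfun : {linear M -> M})).
HB.instance Definition _ := GRing.Lmodule.on jones_type.

Local Notation jbalanced :=
  (balanced (fun n : N => (i n \o* idfun : {linear M -> M}))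
            (fun n : N => (i n \*o idfun : {linear M -> M}))).

Definition jlift (P : zmodType) (b : M -> M -> P) (t : jones_type) : P := tlift b t.

Definition jtens (m m' : M) : jones_type := tens m m'.

Definition jones_mul (s t : jones_type) : jones_type :=
  jlift (fun m m' => jlift (fun n n' => jtens (m * i (E (m' * n))) n') t) s.

Definition jones_one : jones_type := \sum_j jtens (x j) (y j).

Definition jones_cexp (t : jones_type) : M := jlift (fun m m' => lam F *: (m * m')) t.

Definition jones_incl (m : M) : jones_type := \sum_j jtens (m * x j) (y j).

Lemma cexpl n m : E (i n * m) = n * E m.
Proof. by rewrite -[in LHS](mulr1 (i n * m)) -(rmorph1 i) cexpM mulr1. Qed.

Lemma cexpr n m : E (m * i n) = E m * n.
Proof. by rewrite -[in LHS](mul1r m) -[in LHS](rmorph1 i) cexpM mul1r. Qed.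

Lemma dbPl m : \sum_j i (E (m * x j)) * y j = m.
Proof. by have [] := dbP m. Qed.

Lemma dbPr m : \sum_j x j * i (E (y j * m)) = m.
Proof. by have [] := dbP m. Qed.

Lemma jtensDl a b c : jtens (a + b) c = jtens a c + jtens b c.
Proof. exact: tensDl. Qed.

Lemma jtensDr a b c : jtens a (b + c) = jtens a b + jtens a c.
Proof. exact: tensDr. Qed.

Lemma jtensZl c a b : jtens (c *: a) b = c *: jtens a b.
Proof. exact: tensZl. Qed.

Lemma jtens_bal a n b : jtens (a * i n) b = jtens a (i n * b).
Proof. exact: (@tens_balanced _ _ _ _ (fun n : N => (i n \o* idfun : {linear M -> M}))). Qed.

Lemma jtens0l b : jtens 0 b = 0.
Proof. by rewrite -(scale0r (0 : M)) jtensZl scale0r. Qed.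

Lemma jtens0r a : jtens a 0 = 0.
Proof. by apply: (addrI (jtens a 0)); rewrite -jtensDr !addr0. Qed.

Lemma jtens_suml I (r : seq I) (Q : pred I) f b :
  jtens (\sum_(j <- r | Q j) f j) b = \sum_(j <- r | Q j) jtens (f j) b.
Proof. exact: (big_morph (jtens^~ b) (fun a a' => jtensDl a a' b) (jtens0l b)). Qed.

Lemma jtens_sumr I (r : seq I) (Q : pred I) f a :
  jtens a (\sum_(j <- r | Q j) f j) = \sum_(j <- r | Q j) jtens a (f j).
Proof. exact: (big_morph (jtens a) (jtensDr a) (jtens0r a)). Qed.

Lemma incl_scale c : i (c *: 1) = c *: 1.
Proof. by rewrite linearZ /= rmorph1. Qed.

Lemma jtensZr c a b : jtens a (c *: b) = c *: jtens a b.
Proof.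
by rewrite -[b in LHS]mul1r scalerAl -incl_scale -jtens_bal incl_scale -scalerAr
   mulr1 jtensZl.
Qed.

Lemma jones_ind (P : jones_type -> Prop) :
    P 0 -> (forall s t, P s -> P t -> P (s + t)) -> (forall a b, P (jtens a b)) ->
  forall t, P t.
Proof. exact: tens_ind. Qed.

Section JLift.
Variables (P : zmodType) (b : M -> M -> P).
Hypothesis bP : jbalanced b.

Lemma jlift_tens m m' : jlift b (jtens m m') = b m m'.
Proof. exact: tlift_tens. Qed.

Lemma jliftD : {morph jlift b : s t / s + t}.
Proof. exact: tliftD. Qed.

Lemma jlift0 : jlift b 0 = 0.
Proof. exact: tlift0. Qed.
End JLift.

Let mulr_balanced (m m' : M) :
  jbalanced (fun n n' => jtens (m * i (E (m' * n))) n').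
Proof.
split=> [b a a'|a b b'|n a b] /=.
- by rewrite mulrDr linearD rmorphD mulrDr jtensDl.
- by rewrite jtensDr.
- by rewrite [m' * _]mulrA cexpr rmorphM mulrA -jtens_bal.
Qed.

Let mull_balanced t :
  jbalanced (fun m m' => jlift (fun n n' => jtens (m * i (E (m' * n))) n') t).
Proof.
split=> [b a a'|a b b'|n a b] /=.
- elim/jones_ind: t => [|s t IHs IHt|c d].
  + by rewrite !jlift0 // addr0.
  + by rewrite !jliftD // IHs IHt addrACA.
  + by rewrite !jlift_tens // mulrDl jtensDl.
- elim/jones_ind: t => [|s t IHs IHt|c d].
  + by rewrite !jlift0 // addr0.
  + by rewrite !jliftD // IHs IHt addrACA.
  + by rewrite !jlift_tens // mulrDl linearD rmorphD mulrDr jtensDl.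
- congr jlift; apply/funext => c; apply/funext => d.
  by rewrite -!mulrA cexpl rmorphM.
Qed.

Lemma jones_mulE a b c d :
  jones_mul (jtens a b) (jtens c d) = jtens (a * i (E (b * c))) d.
Proof. by rewrite /jones_mul jlift_tens // jlift_tens. Qed.

Let jmulDl : left_distributive jones_mul +%R.
Proof. by move=> s t u; rewrite /jones_mul jliftD. Qed.

Let jmulDr : right_distributive jones_mul +%R.
Proof.
move=> u s t; rewrite /jones_mul.
elim/jones_ind: u => [|u v IHu IHv|c d].
- by rewrite !jlift0 // addr0.
- by rewrite !jliftD // IHu IHv addrACA.
- by rewrite !jlift_tens // jliftD.
Qed.

Let jmul0l t : jones_mul 0 t = 0.
Proof. by rewrite /jones_mul jlift0. Qed.

Let jmul0r t : jones_mul t 0 = 0.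
Proof. by apply: (addrI (jones_mul t 0)); rewrite -jmulDr !addr0. Qed.

Let jmul_suml I (r : seq I) f t :
  jones_mul (\sum_(j <- r) f j) t = \sum_(j <- r) jones_mul (f j) t.
Proof. exact: (big_morph (jones_mul^~ t) (fun a b => jmulDl a b t) (jmul0l t)). Qed.

Let jmul_sumr I (r : seq I) f t :
  jones_mul t (\sum_(j <- r) f j) = \sum_(j <- r) jones_mul t (f j).
Proof. exact: (big_morph (jones_mul t) (jmulDr t) (jmul0r t)). Qed.

Let jmulA : associative jones_mul.
Proof.
move=> s t u; elim/jones_ind: s => [|s s' IH IH'|a b].
- by rewrite !jmul0l.
- by rewrite !jmulDl IH IH'.
elim/jones_ind: t => [|t t' IH IH'|c d].
- by rewrite jmul0l jmul0r jmul0l.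
- by rewrite jmulDl !jmulDr jmulDl IH IH'.
elim/jones_ind: u => [|u u' IH IH'|e f].
- by rewrite !jmul0r.
- by rewrite !jmulDr IH IH'.
by rewrite !jones_mulE mulrA cexpr rmorphM !mulrA.
Qed.

Lemma jones_incl_mull m a b : jones_mul (jones_incl m) (jtens a b) = jtens (m * a) b.
Proof.
rewrite /jones_incl jmul_suml -[a in RHS]dbPr mulr_sumr jtens_suml.
by apply: eq_bigr => j _; rewrite jones_mulE mulrA.
Qed.

Lemma jones_inclE m : jones_incl m = \sum_j jtens (x j) (y j * m).
Proof.
under [RHS]eq_bigr do rewrite -[_ * m]dbPl jtens_sumr.
under [RHS]eq_bigr do under eq_bigr do rewrite -jtens_bal.
rewrite exchange_big /=; apply: eq_bigr => l _.
by rewrite -jtens_suml; under eq_bigr do rewrite -mulrA; rewrite dbPr.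
Qed.

Lemma jones_incl_mulr m a b : jones_mul (jtens a b) (jones_incl m) = jtens a (b * m).
Proof.
rewrite jones_inclE jmul_sumr -[b in RHS]dbPl mulr_suml jtens_sumr.
by apply: eq_bigr => j _; rewrite jones_mulE jtens_bal mulrA.
Qed.

Lemma jones_incl1 : jones_incl 1 = jones_one.
Proof. by rewrite /jones_incl; under eq_bigr do rewrite mul1r. Qed.

Let jmul1 : left_id jones_one jones_mul.
Proof.
elim/jones_ind=> [|s t IHs IHt|a b]; first by rewrite jmul0r.
- by rewrite jmulDr IHs IHt.
- by rewrite -jones_incl1 jones_incl_mull mul1r.
Qed.

Let jmulr1 : right_id jones_one jones_mul.
Proof.
elim/jones_ind=> [|s t IHs IHt|a b]; first by rewrite jmul0l.
- by rewrite jmulDl IHs IHt.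
- by rewrite -jones_incl1 jones_incl_mulr mulr1.
Qed.

Let cexp_balanced :
  jbalanced (fun m m' => lam F *: (m * m')).
Proof.
split=> [b a a'|a b b'|n a b] /=.
- by rewrite mulrDl scalerDr.
- by rewrite mulrDr scalerDr.
- by rewrite mulrA.
Qed.

Lemma jones_cexpE a b : jones_cexp (jtens a b) = lam F *: (a * b).
Proof. exact: jlift_tens. Qed.

Lemma jones_cexp_linear : linear jones_cexp.
Proof.
move=> c s t; rewrite /jones_cexp jliftD // /jlift tliftZ // => d a b.
by rewrite -scalerAl !scalerA [lam F * d]mulrC.
Qed.

HB.instance Definition _ :=
  GRing.isLinear.Build k jones_type M *:%R jones_cexp jones_cexp_linear.

Lemma jones_cexp1 : jones_cexp jones_one = 1.
Proof.
rewrite /jones_one linear_sum; under eq_bigr do rewrite /= jones_cexpE.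
by rewrite -scaler_sumr dbl_dbr scalerA mulfV ?scale1r // lam_neq0.
Qed.

Let one_neq0 : jones_one != 0.
Proof.
apply/eqP => /(congr1 jones_cexp); rewrite jones_cexp1 linear0.
by apply/eqP; rewrite oner_neq0.
Qed.

HB.instance Definition _ := GRing.Zmodule_isNzRing.Build jones_type
  jmulA jmul1 jmulr1 jmulDl jmulDr one_neq0.

Let scaleAl (c : k) (s t : jones_type) : c *: (s * t) = (c *: s) * t.
Proof.
elim/jones_ind: s => [|s s' IH IH'|a b].
- by rewrite scaler0 !mul0r scaler0.
- by rewrite scalerDr !mulrDl scalerDr IH IH'.
elim/jones_ind: t => [|t t' IH IH'|d e].
- by rewrite !mulr0 scaler0.
- by rewrite !mulrDr scalerDr IH IH'.
by rewrite -jtensZl -![_ * _]/(jones_mul _ _) !jones_mulE -jtensZl scalerAl.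
Qed.

HB.instance Definition _ := GRing.Lmodule_isLalgebra.Build k jones_type scaleAl.

Let scaleAr (c : k) (s t : jones_type) : c *: (s * t) = s * (c *: t).
Proof.
elim/jones_ind: s => [|s s' IH IH'|a b].
- by rewrite !mul0r scaler0.
- by rewrite !mulrDl scalerDr IH IH'.
elim/jones_ind: t => [|t t' IH IH'|d e].
- by rewrite scaler0 !mulr0 scaler0.
- by rewrite scalerDr !mulrDr scalerDr IH IH'.
by rewrite -jtensZr -![_ * _]/(jones_mul _ _) !jones_mulE -jtensZr.
Qed.

HB.instance Definition _ := GRing.Lalgebra_isAlgebra.Build k jones_type scaleAr.

Lemma jtensM a b c d : jtens a b * jtens c d = jtens (a * i (E (b * c))) d.
Proof. exact: jones_mulE. Qed.

Lemma jones_incl_linear : linear jones_incl.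
Proof.
move=> c m m'; rewrite /jones_incl scaler_sumr -big_split; apply: eq_bigr => j _.
by rewrite mulrDl -scalerAl jtensDl jtensZl.
Qed.

Lemma jones_incl_monoid : monoid_morphism jones_incl.
Proof.
split=> [|m m']; first exact: jones_incl1.
rewrite [in RHS]/jones_incl mulr_sumr [in LHS]/jones_incl.
by apply: eq_bigr => j _; rewrite -[RHS]/(jones_mul _ _) jones_incl_mull mulrA.
Qed.

HB.instance Definition _ :=
  GRing.isLinear.Build k M jones_type *:%R jones_incl jones_incl_linear.
HB.instance Definition _ :=
  GRing.isMonoidMorphism.Build M jones_type jones_incl jones_incl_monoid.

Lemma jones_incl_tens m a b : jones_incl m * jtens a b = jtens (m * a) b.
Proof. exact: jones_incl_mull. Qed.

Lemma jones_tens_incl m a b : jtens a b * jones_incl m = jtens a (b * m).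
Proof. exact: jones_incl_mulr. Qed.

Lemma jones_cexpM m (t : jones_type) m' :
  jones_cexp (jones_incl m * t * jones_incl m') = m * jones_cexp t * m'.
Proof.
elim/jones_ind: t => [|s t IHs IHt|a b].
- by rewrite mulr0 mul0r linear0 mulr0 mul0r.
- by rewrite mulrDr mulrDl !linearD /= mulrDr mulrDl IHs IHt.
rewrite jones_incl_tens jones_tens_incl !jones_cexpE.
by rewrite -scalerAr -scalerAl !mulrA.
Qed.

Definition jones_dbl j : jones_type := (lam F)^-1 *: jtens (x j) 1.
Definition jones_dbr j : jones_type := jtens 1 (y j).

Lemma jones_dbP : dual_bases jones_incl jones_cexp jones_dbl jones_dbr.
Proof.
move=> t; rewrite /jones_dbl /jones_dbr; split.
  elim/jones_ind: t => [|s t IHs IHt|a b].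
  - by apply: big1 => j _; rewrite mul0r linear0 linear0 mul0r.
  - rewrite -[in RHS]IHs -[in RHS]IHt -big_split; apply: eq_bigr => j _.
    by rewrite mulrDl !linearD /= mulrDl.
  rewrite -[b in RHS]dbPl jtens_sumr; apply: eq_bigr => j _.
  rewrite -scalerAr jtensM linearZ /= jones_cexpE scalerA mulVf ?lam_neq0 //.
  by rewrite scale1r !mulr1 jones_incl_tens mulr1 jtens_bal.
elim/jones_ind: t => [|s t IHs IHt|a b].
- by apply: big1 => j _; rewrite mulr0 linear0 linear0 mulr0.
- rewrite -[in RHS]IHs -[in RHS]IHt -big_split; apply: eq_bigr => j _.
  by rewrite mulrDr !linearD /= mulrDr.
rewrite -[a in RHS]dbPr jtens_suml; apply: eq_bigr => j _.
rewrite jtensM jones_cexpE linearZ /= -scalerAl -scalerAr scalerA mulVf ?lam_neq0 //.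
by rewrite scale1r !mul1r jones_tens_incl mul1r jtens_bal.
Qed.

Lemma jones_index : \sum_j jones_dbl j * jones_dbr j = (lam F)^-1 *: 1.
Proof.
rewrite -[1]/jones_one /jones_one scaler_sumr; apply: eq_bigr => j _.
by rewrite /jones_dbl /jones_dbr -scalerAl jtensM mulr1 cexp1 rmorph1 mulr1.
Qed.

Definition jones : strongly_separable k :=
  @StronglySeparable k M jones_type jones_incl jones_cexp (dbsize F) jones_dbl jones_dbr (lam F)
    jones_cexpM jones_dbP jones_cexp1 (lam_neq0 F) jones_index.

End BasicConstruction.

Section Centralizer.
Variables (k : fieldType) (X : algType k) (Y : Type) (i : Y -> X).

Definition centr_pred : {pred X} := fun x => `[< forall y, x * i y = i y * x >].

Lemma centrP x : reflect (forall y, x * i y = i y * x) (x \in centr_pred).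
Proof. exact: asboolP. Qed.

Lemma centr_subalg : subalg_closed centr_pred.
Proof.
split=> [|c x y /centrP xP /centrP yP|x y /centrP xP /centrP yP]; apply/centrP => z.
- by rewrite mulr1 mul1r.
- by rewrite mulrDl mulrDr -scalerAl -scalerAr xP yP.
- by rewrite -mulrA yP !mulrA xP.
Qed.

HB.instance Definition _ := GRing.isSubalgClosed.Build k X centr_pred centr_subalg.

Definition centr := {x : X | x \in centr_pred}.
HB.instance Definition _ := SubChoice.on centr.
HB.instance Definition _ := [SubChoice_isSubAlgebra of centr by <:].

End Centralizer.

Section Algebras.
Variables (k : fieldType) (H : algType k).

(* A separability element invariant under the flip. *)
Definition symmetric_separability (f : H ⊗ H) : Prop :=
  [/\ forall h, sweedler (fun a b => (h * a) ⊗ b) f = sweedler (fun a b => a ⊗ (b * h)) f,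
      sweedler (fun a b => a * b) f = 1
    & sweedler (fun a b => b ⊗ a) f = f].

Definition kanzaki_separable : Prop := exists f : H ⊗ H, symmetric_separability f.

Definition is_trace (t : H -> k) : Prop := forall g h, t (g * h) = t (h * g).

Definition nondegenerate_trace (t : H -> k) : Prop :=
  is_trace t /\ forall g, (forall h, t (g * h) = 0) -> g = 0.

Definition left_ideal (I : set H) : Prop :=
  [/\ I 0, forall g h, I g -> I h -> I (g + h) & forall a h, I h -> I (a * h)].

(* The left regular module is completely reducible. *)
Definition semisimple : Prop :=
  forall I, left_ideal I -> exists2 J, left_ideal J &
    (forall h, I h -> J h -> h = 0) /\
    (forall h, exists g g', [/\ I g, J g' & h = g + g']).

End Algebras.

Definition tmap (k : fieldType) (X Y X' Y' : lmodType k) (f : X -> X') (g : Y -> Y')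
  (t : X ⊗ Y) : X' ⊗ Y' := sweedler (fun x y => f x ⊗ g y) t.

Definition tmul (k : fieldType) (X Y : lmodType k) (mX : X -> X -> X) (mY : Y -> Y -> Y)
  (s t : X ⊗ Y) : X ⊗ Y :=
  sweedler (fun x y => sweedler (fun x' y' => mX x x' ⊗ mY y y') t) s.

Definition finite_dim (k : fieldType) (H : lmodType k) : Prop :=
  exists n (b : 'I_n -> H), forall h, exists c : 'I_n -> k, h = \sum_j c j *: b j.

Record hopf_data (k : fieldType) (H : lmodType k) := HopfData {
  hmul : H -> H -> H;
  hone : H;
  comul : H -> H ⊗ H;
  counit : H -> k;
  antipode : H -> H
}.

Section WeakHopf.
Variables (k : fieldType) (H : lmodType k) (D : hopf_data H).
Local Notation mul := (hmul D).
Local Notation one := (hone D).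
Local Notation Δ := (comul D).
Local Notation ε := (counit D).
Local Notation S := (antipode D).

Definition is_algebra : Prop :=
  [/\ forall g, linear (mul g), forall g, linear (mul^~ g),
      associative mul, left_id one mul & right_id one mul].

Definition is_coalgebra : Prop :=
  [/\ linear Δ, scalar ε,
      forall h, tmap Δ id (Δ h) =
        sweedler (fun h1 h2 => sweedler (fun h3 h4 => (h1 ⊗ h3) ⊗ h4) (Δ h2)) (Δ h),
      forall h, sweedler (fun h1 h2 => ε h1 *: h2) (Δ h) = h
    & forall h, sweedler (fun h1 h2 => ε h2 *: h1) (Δ h) = h].

(* Delta(1) (x) 1 and 1 (x) Delta(1), in (H (x) H) (x) H *)
Definition comul1_one : (H ⊗ H) ⊗ H := Δ one ⊗ one.
Definition one_comul1 : (H ⊗ H) ⊗ H := tmap (fun h => one ⊗ h) id (Δ one).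
Definition hmul3 : (H ⊗ H) ⊗ H -> (H ⊗ H) ⊗ H -> (H ⊗ H) ⊗ H :=
  tmul (tmul mul mul) mul.

Record is_weak_hopf : Prop := {
  weak_hopf_algebra : is_algebra;
  weak_hopf_coalgebra : is_coalgebra;
  weak_hopf_comulM : forall h g, Δ (mul h g) = tmul mul mul (Δ h) (Δ g);
  weak_hopf_counitM : forall h g f,
    ε (mul (mul h g) f) = sweedler (fun g1 g2 => ε (mul h g1) * ε (mul g2 f)) (Δ g);
  weak_hopf_counitM' : forall h g f,
    ε (mul (mul h g) f) = sweedler (fun g1 g2 => ε (mul h g2) * ε (mul g1 f)) (Δ g);
  weak_hopf_comul1 : tmap Δ id (Δ one) = hmul3 comul1_one one_comul1;
  weak_hopf_comul1' : tmap Δ id (Δ one) = hmul3 one_comul1 comul1_one;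
  weak_hopf_antipode_linear : linear S;
  weak_hopf_antipode_l : forall h,
    sweedler (fun h1 h2 => mul h1 (S h2)) (Δ h) =
    sweedler (fun a b => ε a *: b) (tmul mul mul (Δ one) (h ⊗ one));
  weak_hopf_antipode_r : forall h,
    sweedler (fun h1 h2 => mul (S h1) h2) (Δ h) =
    sweedler (fun a b => ε b *: a) (tmul mul mul (one ⊗ h) (Δ one));
  weak_hopf_antipode : forall h,
    sweedler (fun h12 h3 => sweedler (fun h1 h2 => mul (mul (S h1) h2) (S h3)) h12)
             (tmap Δ id (Δ h)) = S h
}.
End WeakHopf.

Definition weak_hopf_isomorphic (k : fieldType) (H H' : lmodType k)
    (D : hopf_data H) (D' : hopf_data H') : Prop :=
  exists f : H -> H', [/\ linear f, bijective f,
    (forall g h, f (hmul D g h) = hmul D' (f g) (f h)) /\ f (hone D) = hone D',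
    forall h, comul D' (f h) = tmap f f (comul D h) /\ counit D' (f h) = counit D h
  & forall h, f (antipode D h) = antipode D' (f h)].

Section Dual.
Variables (k : fieldType) (H : lmodType k).

Definition dual_pred : {pred (H -> k^o)} := fun f => `[< scalar f >].

Lemma dual_predP (f : H -> k^o) : reflect (scalar f) (f \in dual_pred).
Proof. exact: asboolP. Qed.

Lemma dual_submod : submod_closed dual_pred.
Proof.
split=> [|c f g /dual_predP fP /dual_predP gP]; apply/dual_predP => d x y.
  by rewrite -[LHS]/(0 : k) -[RHS]/(d * 0 + 0 : k) mulr0 addr0.
rewrite -[LHS]/(c * f (d *: x + y) + g (d *: x + y) : k).
rewrite -[RHS]/(d * (c * f x + g x) + (c * f y + g y) : k) fP gP.
by rewrite !mulrDr addrACA !mulrA [c * d]mulrC.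
Qed.

HB.instance Definition _ := GRing.isSubmodClosed.Build k (H -> k^o) dual_pred dual_submod.

Definition dual := {f : H -> k^o | f \in dual_pred}.
HB.instance Definition _ := SubChoice.on dual.
HB.instance Definition _ := [SubChoice_isSubLmodule of dual by <:].

Definition ev (f : dual) (h : H) : k := val f h.

(* The linear form g (0 if g is not linear). *)
Definition dual_form (g : H -> k) : dual := insubd 0 (g : H -> k^o).

(* The transposed structure, for H a finite-dimensional weak Hopf algebra; then
   Delta(f) is the unique element of the set given to xget. *)
Definition dual_hopf (D : hopf_data H) : hopf_data dual := {|
  hmul := fun f g => dual_form (fun h => sweedler (fun h1 h2 => ev f h1 * ev g h2) (comul D h));
  hone := dual_form (counit D);
  comul := fun f => xget 0 [set t : dual ⊗ dual |
    forall h g, sweedler (fun f1 f2 => ev f1 h * ev f2 g) t = ev f (hmul D h g)];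
  counit := fun f => ev f (hone D);
  antipode := fun f => dual_form (fun h => ev f (antipode D h))
|}.
End Dual.

Section Tower.
Variables (k : fieldType) (F : strongly_separable k) (T : {scalar base F}).

Definition F1 := jones F.
Definition F2 := jones F1.

Definition T0 (m : total F) : k := T (cexp F m).
Definition T1 (m : total F1) : k := T0 (cexp F1 m).
Definition T2 (m : total F2) : k := T1 (cexp F2 m).

Definition U := centr (incl F).
Definition V := centr (incl F1).
Definition A := centr (fun n : base F => incl F1 (incl F n)).
Definition B := centr (fun m : total F => incl F2 (incl F1 m)).
HB.instance Definition _ := GRing.Algebra.on U.
HB.instance Definition _ := GRing.Algebra.on V.
HB.instance Definition _ := GRing.Algebra.on A.
HB.instance Definition _ := GRing.Algebra.on B.

Record symmetric_markov : Prop := {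
  markov_T : is_trace T;
  markov_T1 : T 1 = 1;
  markov_T0 : is_trace T0;
  markov_sym : forall (u : U) (m : total F), cexp F (val u * m) = cexp F (m * val u)
}.

Definition e1 : total F1 := jtens 1 1.
Definition e2 : total F2 := @jtens k F1 1 1.

Definition phi (u : U) : total F1 := \sum_j jtens (dbl F j * val u) (dbr F j).

Definition depth_two : Prop :=
  (exists n (x y : 'I_n -> A),
      dual_bases (incl F1) (cexp F1) (fun j => val (x j)) (fun j => val (y j))) /\
  (exists n (u v : 'I_n -> B),
      dual_bases (incl F2) (cexp F2) (fun j => val (u j)) (fun j => val (v j))).

Definition V_trace (f : V ⊗ V) : V :=
  sweedler (fun a b => T2 (incl F2 (val b)) *: a) f.

Section Pairing.
Variable w : V.

Definition pairing (a : A) (b : B) : k :=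
  (lam F)^-2 * T2 (incl F2 (val a) * e2 * incl F2 e1 * incl F2 (val w) * val b).

Definition pairing' (a : A) (b : B) : k :=
  (lam F)^-2 * T2 (val b * incl F2 e1 * e2 * incl F2 (val w) * incl F2 (val a)).

Definition B_hopf (DB : B -> B ⊗ B) (SB : B -> B) : hopf_data B :=
  HopfData *%R 1 DB (pairing 1) SB.

Definition A_hopf (DA : A -> A ⊗ A) (SA : A -> A) : hopf_data A :=
  HopfData *%R 1 DA (fun a => pairing a 1) SA.
End Pairing.

Record duality_structure (f : V ⊗ V) (w : V) (DB : {linear B -> (B ⊗ B)%type})
    (SB : {linear B -> B}) (DA : {linear A -> (A ⊗ A)%type}) (SA : {linear A -> A}) : Prop := {
  duality_sep : symmetric_separability f;
  duality_w : w * V_trace f = 1 /\ V_trace f * w = 1;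
  duality_comulB : forall a1 a2 b,
    sweedler (fun b1 b2 => pairing w a1 b1 * pairing w a2 b2) (DB b) = pairing w (a1 * a2) b;
  duality_antipodeB_bij : bijective SB;
  duality_antipodeB : forall a b, pairing w a b = pairing' w a (SB b);
  duality_comulA : forall a b1 b2,
    sweedler (fun a1 a2 => pairing w a1 b1 * pairing w a2 b2) (DA a) = pairing w a (b1 * b2);
  duality_antipodeA : forall a b, pairing w (SA a) b = pairing w a (SB b)
}.
End Tower.

Arguments duality_structure {k F} T f w DB SB DA SA.

(* Main.v *)
Require Import Defs.
From HB Require Import structures.
From mathcomp Require Import all_boot all_order all_algebra.
From mathcomp Require Import boolp classical_sets functions.
Import GRing.Theory.
Local Open Scope ring_scope.

Set Implicit Arguments.
Unset Strict Implicit.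
Unset Printing Implicit Defensive.

(** Let U, V, A, B be the centralizers of the tower N < M < M1 < M2 named in the
statement, lam the inverse of the index, E1 : M1 -> M and E2 : M2 -> M1 the
conditional expectations, T the trace of M2.

M2 acts on M1 by b |> x = lam^-1 E2(b x e2); this is the left regular action for
b in M1, and e2 acts as E1.  Elements of B act by endomorphisms of the M-M-bimodule
M1, and every such endomorphism is the action of exactly one element of B
([bimodule_act], [actB_inj]).  With eps(a) = lam^-1 T(a e1 w) the pairing becomes
<a, b> = eps(b |> a), so that <a, b b'> = <b' |> a, b>.

The trace is nondegenerate on A and on B: dual bases for it are products of the
depth two dual bases with the separability elements of U and V, corrected by
f1 T(f2), which is invertible ([sep_trace_inv]).  Moving e1 and e2 through the
expectations turns dual bases for the trace on A into dual bases for the pairing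
([pair_perfect]).  From these all the structure maps are obtained by transposition,
and the coalgebra laws of B are the algebra laws of A.

The heart of the proof is a formula for the comultiplication of B.  If s, t run
through dual bases of B for the trace, then b_(1) |> x = E2(b x s) w^-1 and
b_(2) = t ([comul_formula]).  Up to w the same elements are dual bases for E2, and
therefore M1 is a module algebra, b |> (x y) = (b_(1) |> x) (b_(2) |> y)
([act_comul]).  The remaining axioms follow from these facts.
- The comultiplication is multiplicative because b |> (a a') and <a, b b'> can both
  be expanded by the action.
- Let phi1(v) be the element of B that acts by x |-> x v, for v in V.  The identity
  eps(x f1) eps(f2 y) = eps(x y) ([epsA_sep]) gives comul(1) = phi1(f1) (x) f2, and
  the axioms on comul(1) and on the counit reduce to it.
- The antipode acts by S(b) |> x = lam^-1 E2(e2 x w b) w^-1 ([act_SB]).  So up to w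
  it is the adjoint of the action for the trace ([tau_SB]); with the module algebra
  property this computes S(b_(1)) b_(2) and S(b_(1)) b_(2) S(b_(3)).  For
  b_(1) S(b_(2)) one uses the formula for the comultiplication, and that dual bases
  of a trace are invariant under the flip.

The axioms of a weak Hopf algebra are self-dual, so they pass from B to A along the
pairing ([dual_weak_hopf]), and the pairing identifies A with the dual of B
([dual_iso]).  Finally the depth two dual bases and the separability element of U
combine to a separability element of A, which makes A semisimple by averaging
([separable_semisimple]). *)

(** * Linear maps and sums over tensors *)

(** Biadditivity and balance over k: exactly what a map needs to factor through the
tensor product over k, with values in any abelian group. *)
Local Notation bilin g := (balanced (fun c => *:%R c) (fun c => *:%R c) g).

Section LinearFun.
Variables (k : fieldType) (X : lmodType k).

Section Vector.
Variables (P : lmodType k) (h : X -> P).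
Hypothesis hL : linear h.

Lemma lin0 : h 0 = 0.
Proof. by have := hL (-1) 0 0; rewrite scaler0 addr0 scaleN1r addNr. Qed.

Lemma linD : {morph h : x y / x + y}.
Proof. by move=> x y; have := hL 1 x y; rewrite !scale1r. Qed.

Lemma linZ c x : h (c *: x) = c *: h x.
Proof. by have := hL c x 0; rewrite lin0 !addr0. Qed.

Lemma lin_sum I (r : seq I) (f : I -> X) : h (\sum_(i <- r) f i) = \sum_(i <- r) h (f i).
Proof. exact: (big_morph h linD lin0). Qed.
End Vector.

Section Scalar.
Variable h : X -> k.
Hypothesis hL : scalar h.

Lemma scal0 : h 0 = 0.
Proof. exact: (@lin0 k^o h hL). Qed.

Lemma scalD : {morph h : x y / x + y}.
Proof. exact: (@linD k^o h hL). Qed.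

Lemma scalZ c x : h (c *: x) = c * h x.
Proof. exact: (@linZ k^o h hL). Qed.

Lemma scal_sum I (r : seq I) (f : I -> X) : h (\sum_(i <- r) f i) = \sum_(i <- r) h (f i).
Proof. exact: (@lin_sum k^o h hL). Qed.
End Scalar.
End LinearFun.

Section Sweedler.
Variables (k : fieldType) (X Y : lmodType k).
Implicit Types (P : zmodType) (s t : X ⊗ Y).

Lemma sweedlerE P (g : X -> Y -> P) t : sweedler g t = \sum_(q <- repr t) g q.1 q.2.
Proof. by []. Qed.

Lemma tensor_sum t : t = \sum_(q <- repr t) q.1 ⊗ q.2.
Proof. exact: tensE. Qed.

Lemma sweedler_sum P (g : X -> Y -> P) (gP : bilin g) I (r : seq I) (f : I -> X ⊗ Y) :
  sweedler g (\sum_(i <- r) f i) = \sum_(i <- r) sweedler g (f i).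
Proof. exact: (tlift_sum gP). Qed.

Lemma sweedler_pure P (g : X -> Y -> P) (gP : bilin g) x y : sweedler g (x ⊗ y) = g x y.
Proof. exact: (tlift_tens gP). Qed.

Lemma sweedler_sum_pure P (g : X -> Y -> P) (gP : bilin g) I (r : seq I) (u : I -> X) (v : I -> Y) :
  sweedler g (\sum_(i <- r) u i ⊗ v i) = \sum_(i <- r) g (u i) (v i).
Proof. by rewrite sweedler_sum //; apply: eq_bigr => i _; rewrite sweedler_pure. Qed.

Lemma eq_sweedler P (g g' : X -> Y -> P) t : (forall x y, g x y = g' x y) -> sweedler g t = sweedler g' t.
Proof. by move=> E; apply: eq_bigr. Qed.

Lemma bilin_pure : bilin (fun (x : X) (y : Y) => x ⊗ y).
Proof.
split=> [y x x'|x y y'|c x y]; first exact: tensDl; first exact: tensDr.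
exact: (@tens_balanced _ _ _ _ (fun c : k => *:%R c : {linear X -> X})
          (fun c : k => *:%R c : {linear Y -> Y})).
Qed.

Lemma pureDl x x' (y : Y) : (x + x' : X) ⊗ y = x ⊗ y + x' ⊗ y.
Proof. by have [/(_ y x x')] := bilin_pure. Qed.
Lemma pureDr (x : X) (y y' : Y) : x ⊗ (y + y') = x ⊗ y + x ⊗ y'.
Proof. by have [_ /(_ x y y')] := bilin_pure. Qed.
Lemma pureZl c (x : X) (y : Y) : (c *: x) ⊗ y = c *: (x ⊗ y).
Proof. exact: tensZl. Qed.
Lemma pureZr c (x : X) (y : Y) : x ⊗ (c *: y) = c *: (x ⊗ y).
Proof. by rewrite -pureZl; have [_ _ /(_ c x y)] := bilin_pure. Qed.
Lemma pure_linl (y : Y) : linear (fun x : X => x ⊗ y).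
Proof. by move=> c x x'; rewrite pureDl pureZl. Qed.
Lemma pure_linr (x : X) : linear (fun y : Y => x ⊗ y).
Proof. by move=> c y y'; rewrite pureDr pureZr. Qed.
Lemma pure_suml I (r : seq I) (f : I -> X) (y : Y) :
  (\sum_(i <- r) f i) ⊗ y = \sum_(i <- r) f i ⊗ y.
Proof.
apply: (big_morph (fun x : X => x ⊗ y)) => [x x'|]; first exact: pureDl.
by rewrite -[X in X ⊗ y](scale0r 0) pureZl scale0r.
Qed.
Lemma pure_sumr I (r : seq I) (f : I -> Y) (x : X) :
  x ⊗ (\sum_(i <- r) f i) = \sum_(i <- r) x ⊗ f i.
Proof.
apply: (big_morph (fun y : Y => x ⊗ y)) => [y y'|]; first exact: pureDr.
by rewrite -[X in x ⊗ X](scale0r 0) pureZr scale0r.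
Qed.

End Sweedler.

Section SweedlerOps.
Variables (k : fieldType).

Lemma sweedler_tmap (X Y X' Y' : lmodType k) (P : zmodType) (g : X' -> Y' -> P)
    (f : X -> X') (f' : Y -> Y') (t : X ⊗ Y) : bilin g ->
  sweedler g (tmap f f' t) = sweedler (fun x y => g (f x) (f' y)) t.
Proof. by move=> gP; rewrite /tmap (sweedlerE (fun x y => f x ⊗ f' y)) sweedler_sum_pure. Qed.

Lemma sweedler_tmul (X Y : lmodType k) (P : zmodType) (g : X -> Y -> P) mX mY (s t : X ⊗ Y) :
  bilin g -> sweedler g (tmul mX mY s t) =
  sweedler (fun x y => sweedler (fun x' y' => g (mX x x') (mY y y')) t) s.
Proof.
move=> gP; rewrite /tmul (sweedlerE (fun x y => sweedler _ t)) sweedler_sum //; apply: eq_bigr => q _.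
by rewrite (sweedlerE (fun x y => mX _ x ⊗ mY _ y)) sweedler_sum_pure.
Qed.

Lemma exchange_sweedler (X Y X' Y' : lmodType k) (P : zmodType)
    (g : X -> Y -> X' -> Y' -> P) (s : X ⊗ Y) (t : X' ⊗ Y') :
  sweedler (fun x y => sweedler (fun x' y' => g x y x' y') t) s =
  sweedler (fun x' y' => sweedler (fun x y => g x y x' y') s) t.
Proof. exact: exchange_big. Qed.

Lemma sweedler_morph (X Y : lmodType k) (P Q : zmodType) (h : P -> Q) (g : X -> Y -> P) (t : X ⊗ Y) :
  h 0 = 0 -> {morph h : x y / x + y} ->
  h (sweedler g t) = sweedler (fun x y => h (g x y)) t.
Proof. by move=> h0 hD; exact: (big_morph h hD h0). Qed.

Lemma mulr_sweedler (X Y : lmodType k) (R : nzRingType) (c : R) (g : X -> Y -> R) (t : X ⊗ Y) :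
  c * sweedler g t = sweedler (fun x y => c * g x y) t.
Proof. exact: mulr_sumr. Qed.

Lemma mull_sweedler (X Y : lmodType k) (R : nzRingType) (c : R) (g : X -> Y -> R) (t : X ⊗ Y) :
  sweedler g t * c = sweedler (fun x y => g x y * c) t.
Proof. exact: mulr_suml. Qed.

Lemma sweedler_lin (X Y : lmodType k) (P Q : lmodType k) (h : P -> Q) (g : X -> Y -> P) (t : X ⊗ Y) :
  linear h -> h (sweedler g t) = sweedler (fun x y => h (g x y)) t.
Proof.
by move=> hL; apply: sweedler_morph; [exact: lin0|exact: linD].
Qed.

Lemma sweedler_scal (X Y : lmodType k) (P : lmodType k) (h : P -> k) (g : X -> Y -> P) (t : X ⊗ Y) :
  scalar h -> h (sweedler g t) = sweedler (fun x y => h (g x y)) t.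
Proof. exact: (@sweedler_lin X Y P k^o h g t). Qed.

Lemma bilin_of_linear (X Y P : lmodType k) (g : X -> Y -> P) :
  (forall y, linear (g^~ y)) -> (forall x, linear (g x)) -> bilin g.
Proof.
move=> gl gr; split=> [y|x|c x y]; [exact: linD (gl y)|exact: linD (gr x)|].
by rewrite /= (linZ (gl y)) (linZ (gr x)).
Qed.

Lemma bilin_mul (X Y : lmodType k) (f : X -> k) (g : Y -> k) :
  scalar f -> scalar g -> bilin (fun x y => f x * g y).
Proof.
move=> fL gL; apply: (@bilin_of_linear X Y k^o) => [y c x x'|x c y y'].
  by rewrite fL mulrDl -[_ * _ * _]mulrA.
by rewrite gL mulrDr mulrCA.
Qed.

Lemma sweedler_linear (X Y P : lmodType k) (g : X -> Y -> P) :
  (forall y, linear (g^~ y)) -> (forall x, linear (g x)) -> linear (sweedler g : X ⊗ Y -> P).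
Proof.
move=> gl gr c s t; have gP := bilin_of_linear gl gr.
rewrite -[RHS]/(c *: tlift g s + tlift g t) -(tliftZ gP) -?(tliftD gP) // => d x y.
exact: (linZ (gl y)).
Qed.

Lemma sweedler_sweedler_pure (X Y U V : lmodType k) (P : zmodType) (g : X -> Y -> P)
    (u : U -> V -> X) (v : U -> V -> Y) (t : U ⊗ V) :
  bilin g -> sweedler g (sweedler (fun a b => u a b ⊗ v a b) t) =
  sweedler (fun a b => g (u a b) (v a b)) t.
Proof. by move=> gP; rewrite (sweedlerE (fun a b => u a b ⊗ v a b)) sweedler_sum_pure. Qed.

End SweedlerOps.

Section Bilinear.
Variables (k : fieldType).

Lemma bilin_comp (X Y X' Y' : lmodType k) (P : zmodType) (g : X' -> Y' -> P)
    (f : X -> X') (f' : Y -> Y') :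
  bilin g -> linear f -> linear f' -> bilin (fun x y => g (f x) (f' y)).
Proof.
move=> [gl gr gb] fL fL'.
split=> [y x x'|x y y'|c x y] /=; first by rewrite (linD fL) gl.
  by rewrite (linD fL') gr.
by rewrite (linZ fL) (linZ fL'); exact: gb.
Qed.

Lemma bilin_scale (X Y : lmodType k) (f : X -> k) : scalar f -> bilin (fun x (y : Y) => f x *: y).
Proof.
move=> fL; apply: bilin_of_linear => [y c x x'|x c y y'].
  by rewrite fL scalerDl scalerA.
by rewrite scalerDr !scalerA mulrC.
Qed.

Lemma bilin_scaler (X Y : lmodType k) (f : Y -> k) : scalar f -> bilin (fun (x : X) y => f y *: x).
Proof.
move=> fL; apply: bilin_of_linear => [y c x x'|x c y y'].
  by rewrite scalerDr !scalerA mulrC.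
by rewrite fL scalerDl scalerA.
Qed.

End Bilinear.

Section TensorAlgebra.
Variables (k : fieldType).

Lemma sweedler_param_linear (X Y Z P : lmodType k) (g : Z -> X -> Y -> P) (t : X ⊗ Y) :
  (forall x y, linear (fun z => g z x y)) -> linear (fun z => sweedler (g z) t).
Proof.
move=> gL c z z'; rewrite 3!sweedlerE scaler_sumr -big_split.
by apply: eq_bigr => q _; rewrite gL.
Qed.

Lemma tmul_pure (X Y : lmodType k) mX mY :
  (forall x, linear (mX x)) -> (forall x, linear (mX^~ x)) ->
  (forall y, linear (mY y)) -> (forall y, linear (mY^~ y)) ->
  forall (x x' : X) (y y' : Y), tmul mX mY (x ⊗ y) (x' ⊗ y') = mX x x' ⊗ mY y y'.
Proof.
move=> Xr Xl Yr Yl x x' y y'.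
have lx u v v' : linear (fun z => mX z u ⊗ mY v v').
  by move=> c a b; rewrite Xl pure_linl.
have ly u v v' : linear (fun z => mX u v ⊗ mY z v').
  by move=> c a b; rewrite Yl pure_linr.
rewrite /tmul sweedler_pure ?sweedler_pure //; last first.
  by apply: bilin_of_linear => z; apply: sweedler_param_linear.
by apply: bilin_of_linear => [v|v] c a b; rewrite ?Xr ?Yr ?pure_linl ?pure_linr.
Qed.

Lemma tmul_linear (X Y : lmodType k) mX mY :
  (forall x, linear (mX x)) -> (forall x, linear (mX^~ x)) ->
  (forall y, linear (mY y)) -> (forall y, linear (mY^~ y)) ->
  (forall s : X ⊗ Y, linear (tmul mX mY s)) /\
  (forall s : X ⊗ Y, linear ((tmul mX mY)^~ s)).
Proof.
move=> Xr Xl Yr Yl; split=> s.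
  rewrite /tmul; apply: sweedler_param_linear => x y.
  by apply: sweedler_linear => [v|v] c a b; rewrite ?Xr ?Yr ?pure_linl ?pure_linr.
rewrite /tmul; apply: sweedler_linear => z.
  by apply: sweedler_param_linear => x y c a b; rewrite Xl pure_linl.
by apply: sweedler_param_linear => x y c a b; rewrite Yl pure_linr.
Qed.

Variables (H : lmodType k) (D : hopf_data H).
Hypothesis algD : is_algebra D.

(** Both products in the axioms on comul(1) have the unit in an outer slot, so that
only the middle factors get multiplied. *)
Lemma hmul3_l (t : H ⊗ H) :
  hmul3 D (t ⊗ hone D) (tmap (fun h => hone D ⊗ h) id t) =
  sweedler (fun a b => sweedler (fun c d => (a ⊗ hmul D b c) ⊗ d) t) t.
Proof.
have [mr ml _ m1 m1r] := algD; have [mmr mml] := tmul_linear mr ml mr ml.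
have [m3r m3l] := tmul_linear mmr mml mr ml.
rewrite /hmul3 [t in X in tmul _ _ X]tensor_sum pure_suml.
rewrite (lin_sum (m3l _)).
apply: eq_bigr => q _; rewrite /tmap (sweedlerE (fun x y => (hone D ⊗ x) ⊗ y)).
rewrite (lin_sum (m3r _)).
by apply: eq_bigr => q' _; rewrite !tmul_pure // m1r m1.
Qed.

Lemma hmul3_r (t : H ⊗ H) :
  hmul3 D (tmap (fun h => hone D ⊗ h) id t) (t ⊗ hone D) =
  sweedler (fun a b => sweedler (fun c d => (a ⊗ hmul D c b) ⊗ d) t) t.
Proof.
have [mr ml _ m1 m1r] := algD; have [mmr mml] := tmul_linear mr ml mr ml.
have [m3r m3l] := tmul_linear mmr mml mr ml.
rewrite /hmul3 [t in X in tmul _ _ _ X]tensor_sum pure_suml.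
rewrite (lin_sum (m3r _)).
apply: eq_bigr => q _; rewrite /tmap (sweedlerE (fun x y => (hone D ⊗ x) ⊗ y)).
rewrite (lin_sum (m3l _)).
by apply: eq_bigr => q' _; rewrite !tmul_pure // m1r m1.
Qed.

Lemma sweedler_tmul_one (P : zmodType) (g : H -> H -> P) (t : H ⊗ H) h : bilin g ->
  sweedler g (tmul (hmul D) (hmul D) t (h ⊗ hone D)) = sweedler (fun a b => g (hmul D a h) b) t.
Proof.
have [mr ml _ _ m1r] := algD => gP; rewrite (sweedler_tmul _ _ _ _ gP).
apply: eq_sweedler => a b; rewrite sweedler_pure ?m1r //.
exact: bilin_comp.
Qed.

Lemma sweedler_one_tmul (P : lmodType k) (g : H -> H -> P) (t : H ⊗ H) h :
  (forall y, linear (g^~ y)) -> (forall x, linear (g x)) ->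
  sweedler g (tmul (hmul D) (hmul D) (hone D ⊗ h) t) = sweedler (fun a b => g a (hmul D h b)) t.
Proof.
have [mr ml _ m1 _] := algD => gl gr.
rewrite (sweedler_tmul _ _ _ _ (bilin_of_linear gl gr)) sweedler_pure.
  by apply: eq_sweedler => a b; rewrite m1.
apply: bilin_of_linear => z; apply: sweedler_param_linear => x y c u v.
  by rewrite ml gl.
by rewrite ml gr.
Qed.
End TensorAlgebra.

(** * Perfect pairings *)

(** The pairs (x_i, y_i) in r are dual bases for the pairing p.  Such a system gives
nondegeneracy on both sides and finite dimension at once, without a choice of bases. *)
Record perfect (k : fieldType) (X Y : lmodType k) (p : X -> Y -> k)
    (r : seq (X * Y)) : Prop := Perfect {
  perfl : forall y, scalar (p^~ y);
  perfr : forall x, scalar (p x);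
  perfX : forall x, \sum_(q <- r) p x q.2 *: q.1 = x;
  perfY : forall y, \sum_(q <- r) p q.1 y *: q.2 = y
}.

Lemma perfect_flip (k : fieldType) (X Y : lmodType k) (p : X -> Y -> k) r :
  perfect p r -> perfect (fun y x => p x y) [seq (q.2, q.1) | q <- r].
Proof.
case=> pl pr pX pY; split=> // z; rewrite big_map /=; [exact: pY|exact: pX].
Qed.

Lemma perf_inj (k : fieldType) (X Y : lmodType k) (p : X -> Y -> k) r :
  perfect p r -> forall x x', (forall y, p x y = p x' y) -> x = x'.
Proof.
move=> pP x x' E; rewrite -(perfX pP x) -(perfX pP x').
by apply: eq_bigr => q _; rewrite E.
Qed.

Lemma perf_scalel (k : fieldType) (X Y : lmodType k) (p : X -> Y -> k) r :
  perfect p r -> forall c x y, p (c *: x) y = c * p x y.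
Proof.
by move=> pP c x y; exact: (scalZ (perfl pP y)).
Qed.

Section Test.
Variables (k : fieldType) (X Y : lmodType k) (p : X -> Y -> k) (r : seq (X * Y)).
Hypothesis pP : perfect p r.

Definition test2 y1 y2 (t : X ⊗ X) : k := sweedler (fun x1 x2 => p x1 y1 * p x2 y2) t.

Lemma test2_bilin y1 y2 : bilin (fun x1 x2 => p x1 y1 * p x2 y2).
Proof. by apply: bilin_mul; exact: (perfl pP). Qed.

Lemma test2_scalar y1 y2 : scalar (test2 y1 y2).
Proof.
apply: (@sweedler_linear k X X k^o) => [x2 c x x'|x1 c x x'] /=.
  by rewrite (perfl pP) mulrDl -[_ * _ * _]mulrA.
by rewrite (perfl pP) mulrDr mulrCA.
Qed.

Lemma test2_pure y1 y2 x1 x2 : test2 y1 y2 (x1 ⊗ x2) = p x1 y1 * p x2 y2.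
Proof. by rewrite /test2 (sweedler_pure (test2_bilin y1 y2)). Qed.

Lemma test2_expand (t : X ⊗ X) :
  t = \sum_(i <- r) \sum_(j <- r) test2 i.2 j.2 t *: (i.1 ⊗ j.1).
Proof.
rewrite [t in LHS]tensor_sum.
transitivity (\sum_(q <- repr t) \sum_(i <- r) \sum_(j <- r)
   (p q.1 i.2 * p q.2 j.2) *: (i.1 ⊗ j.1)).
  apply: eq_bigr => q _; rewrite -{1}(perfX pP q.1) pure_suml; apply: eq_bigr => i _.
  rewrite -{1}(perfX pP q.2) pure_sumr; apply: eq_bigr => j _.
  by rewrite pureZl pureZr scalerA.
rewrite exchange_big; apply: eq_bigr => i _; rewrite exchange_big; apply: eq_bigr => j _.
by rewrite -scaler_suml.
Qed.

(** Dual bases recover a tensor from its values on pairs of test vectors, so identities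
between tensors become identities between scalars. *)
Lemma test2_ext (s t : X ⊗ X) : (forall y1 y2, test2 y1 y2 s = test2 y1 y2 t) -> s = t.
Proof.
move=> E; rewrite (test2_expand s) (test2_expand t).
by apply: eq_bigr => i _; apply: eq_bigr => j _; rewrite E.
Qed.

Definition test3 y1 y2 y3 (t : (X ⊗ X) ⊗ X) : k :=
  sweedler (fun x12 x3 => test2 y1 y2 x12 * p x3 y3) t.

Lemma test3_bilin y1 y2 y3 : bilin (fun x12 x3 => test2 y1 y2 x12 * p x3 y3).
Proof. by apply: bilin_mul; [exact: test2_scalar|exact: (perfl pP)]. Qed.

Lemma test3_scalar y1 y2 y3 : scalar (test3 y1 y2 y3).
Proof.
apply: (@sweedler_linear k (X ⊗ X)%type X k^o) => [x2 c x x'|x1 c x x'] /=.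
  by rewrite test2_scalar mulrDl -[_ * _ * _]mulrA.
by rewrite (perfl pP) mulrDr mulrCA.
Qed.

Lemma test3_pure y1 y2 y3 x1 x2 x3 :
  test3 y1 y2 y3 ((x1 ⊗ x2) ⊗ x3) = p x1 y1 * p x2 y2 * p x3 y3.
Proof. by rewrite /test3 (sweedler_pure (test3_bilin y1 y2 y3)) test2_pure. Qed.

Lemma test3_ext (s t : (X ⊗ X) ⊗ X) :
  (forall y1 y2 y3, test3 y1 y2 y3 s = test3 y1 y2 y3 t) -> s = t.
Proof.
suff expand u : u = \sum_(i <- r) \sum_(j <- r) \sum_(l <- r)
    test3 i.2 j.2 l.2 u *: ((i.1 ⊗ j.1) ⊗ l.1).
  move=> E; rewrite (expand s) (expand t).
  by do 3!(apply: eq_bigr => ? _); rewrite E.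
rewrite [u in LHS]tensor_sum.
transitivity (\sum_(q <- repr u) \sum_(i <- r) \sum_(j <- r) \sum_(l <- r)
   (test2 i.2 j.2 q.1 * p q.2 l.2) *: ((i.1 ⊗ j.1) ⊗ l.1)).
  apply: eq_bigr => q _; rewrite {1}(test2_expand q.1) pure_suml; apply: eq_bigr => i _.
  rewrite pure_suml; apply: eq_bigr => j _; rewrite -{1}(perfX pP q.2) pure_sumr.
  by apply: eq_bigr => l _; rewrite pureZl pureZr scalerA.
rewrite exchange_big; apply: eq_bigr => i _; rewrite exchange_big; apply: eq_bigr => j _.
rewrite exchange_big; apply: eq_bigr => l _.
by rewrite -scaler_suml.
Qed.
End Test.

Lemma linear_bundle (k : fieldType) (X Y : lmodType k) (g : X -> Y) :
  linear g -> exists h : {linear X -> Y}, h =1 g.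
Proof.
move=> gL; pose gl := GRing.isLinear.Build k X Y *:%R g gL.
by exists (HB.pack_for {linear X -> Y} g gl).
Qed.

Section Transpose.
Variables (k : fieldType) (A B : algType k) (p : A -> B -> k) (r : seq (A * B)).
Hypothesis pP : perfect p r.

(** The multiplication of A transposes to y |-> sum_(i,j) <x_i x_j, y> y_i (x) y_j. *)
Lemma transpose_mul : exists D : {linear B -> (B ⊗ B)%type}, forall a1 a2 b,
  sweedler (fun b1 b2 => p a1 b1 * p a2 b2) (D b) = p (a1 * a2) b.
Proof.
pose D b : B ⊗ B := \sum_(i <- r) \sum_(j <- r) p (i.1 * j.1) b *: (i.2 ⊗ j.2).
have DL : linear D.
  move=> c u v; rewrite scaler_sumr -big_split; apply: eq_bigr => i _.
  rewrite scaler_sumr -big_split; apply: eq_bigr => j _ /=.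
  by rewrite (perfr pP) scalerDl scalerA.
have [D' D'E] := linear_bundle DL; exists D' => a1 a2 b; rewrite D'E /D.
have tL := test2_scalar (perfect_flip pP) a1 a2.
rewrite -[LHS]/(test2 (fun b a => p a b) a1 a2 _) (scal_sum tL).
rewrite -[a1 in RHS](perfX pP) mulr_suml (scal_sum (perfl pP b)); apply: eq_bigr => i _.
rewrite (scal_sum tL) -[a2 in RHS](perfX pP) mulr_sumr (scal_sum (perfl pP b)).
apply: eq_bigr => j _; rewrite (scalZ tL) (test2_pure (perfect_flip pP)).
by rewrite -scalerAl -scalerAr !(scalZ (perfl pP b)) mulrC -mulrA.
Qed.

Lemma transpose_endo (S : B -> B) : linear S ->
  exists S' : {linear A -> A}, forall a b, p (S' a) b = p a (S b).
Proof.
move=> SL; pose S' a := \sum_(q <- r) p a (S q.2) *: q.1.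
have S'L : linear S'.
  move=> c u v; rewrite scaler_sumr -big_split; apply: eq_bigr => i _.
  by rewrite (perfl pP) scalerDl scalerA.
have [S'' S''E] := linear_bundle S'L; exists S'' => a b; rewrite S''E /S'.
rewrite (scal_sum (perfl pP b)) -[b in RHS](perfY pP) (lin_sum SL) (scal_sum (perfr pP a)).
apply: eq_bigr => q _.
by rewrite (scalZ (perfl pP b)) (linZ SL) (scalZ (perfr pP a)) mulrC.
Qed.
End Transpose.

(** * The dual of a weak Hopf algebra *)

Record hopf_pairing (k : fieldType) (X Y : lmodType k) (p : X -> Y -> k)
    (DX : hopf_data X) (DY : hopf_data Y) : Prop := HopfPairing {
  hp_mull : forall x x' y, p (hmul DX x x') y = test2 (fun y x => p x y) x x' (comul DY y);
  hp_onel : forall y, p (hone DX) y = counit DY y;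
  hp_mulr : forall x y y', p x (hmul DY y y') = test2 p y y' (comul DX x);
  hp_oner : forall x, p x (hone DY) = counit DX x;
  hp_anti : forall x y, p (antipode DX x) y = p x (antipode DY y)
}.

Lemma exchange_sweedler4 (k : fieldType) (U1 V1 U2 V2 U3 V3 U4 V4 : lmodType k)
    (r : U1 ⊗ V1) (s : U2 ⊗ V2) (t : U3 ⊗ V3) (u : U4 ⊗ V4)
    (F : U1 -> V1 -> U2 -> V2 -> U3 -> V3 -> U4 -> V4 -> k) :
  sweedler (fun a a' => sweedler (fun b b' => sweedler (fun c c' => sweedler (fun d d' =>
    F a a' b b' c c' d d') u) t) s) r =
  sweedler (fun c c' => sweedler (fun d d' => sweedler (fun a a' => sweedler (fun b b' =>
    F a a' b b' c c' d d') s) r) u) t.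
Proof.
under eq_sweedler do rewrite exchange_sweedler.
rewrite exchange_sweedler; apply: eq_sweedler => c c'.
under eq_sweedler do rewrite exchange_sweedler.
by rewrite exchange_sweedler.
Qed.

Section Duality.
Variables (k : fieldType) (X Y : lmodType k) (p : X -> Y -> k) (r : seq (X * Y)).
Variables (DX : hopf_data X) (DY : hopf_data Y).
Hypothesis pP : perfect p r.
Hypothesis hp : hopf_pairing p DX DY.
Local Notation ip := (fun y x => p x y).

Let pL y : scalar (p^~ y) := perfl pP y.
Let pR x : scalar (p x) := perfr pP x.

Let pZ c x y : p (c *: x) y = c * p x y.
Proof. exact: (scalZ (pL y)). Qed.

Let pZr c x y : p x (c *: y) = c * p x y.
Proof. exact: (scalZ (pR x)). Qed.

Let p_sweedler (U V : lmodType k) (g : U -> V -> X) t y :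
  p (sweedler g t) y = sweedler (fun u v => p (g u v) y) t.
Proof. exact: (sweedler_scal (h := p^~ y)). Qed.

Let p_sweedlerr (U V : lmodType k) (g : U -> V -> Y) t x :
  p x (sweedler g t) = sweedler (fun u v => p x (g u v)) t.
Proof. exact: sweedler_scal. Qed.

(** Coassociativity and the counit laws of X are associativity and the unit laws of
Y, read through the pairing. *)
Lemma dual_coalgebra : is_algebra DY -> is_coalgebra DX.
Proof.
move=> [mr ml mA m1 m1r].
have DL : linear (comul DX).
  move=> c x x'; apply: (test2_ext pP) => y y'.
  by rewrite (test2_scalar pP) -!(hp_mulr hp) pL.
split=> // [|x|x|x].
- by move=> c x x'; rewrite -!(hp_oner hp) pL.
- apply: (test3_ext pP) => y1 y2 y3.
  rewrite /test3 (sweedler_tmap _ _ _ (test3_bilin pP _ _ _)).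
  rewrite [RHS](sweedler_scal _ _ (test3_scalar pP _ _ _)).
  rewrite [LHS](@eq_sweedler _ _ _ _ _ (fun a b => p a (hmul DY y1 y2) * p b y3)).
    rewrite -[LHS]/(test2 p _ _ _) -(hp_mulr hp) -mA (hp_mulr hp).
    apply: eq_sweedler => a b; rewrite (sweedler_scal _ _ (test3_scalar pP _ _ _)).
    rewrite (hp_mulr hp) /test2 (@sweedler_scal _ _ _ k^o ( *%R (p a y1))).
      by apply: eq_sweedler => c d; rewrite (test3_pure pP) mulrA.
    by move=> c u v; rewrite mulrDr mulrCA.
  by move=> a b; rewrite (hp_mulr hp).
- apply: (perf_inj pP) => y; rewrite p_sweedler.
  rewrite -[in RHS](m1 y) (hp_mulr hp); apply: eq_sweedler => a b.
  by rewrite pZ -(hp_oner hp).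
- apply: (perf_inj pP) => y; rewrite p_sweedler.
  rewrite -[in RHS](m1r y) (hp_mulr hp); apply: eq_sweedler => a b.
  by rewrite pZ -(hp_oner hp) mulrC.
Qed.

Hypothesis algX : is_algebra DX.
Hypothesis wY : is_weak_hopf DY.
Let algY := weak_hopf_algebra wY.

Let pM x x' y : p (hmul DX x x') y = sweedler (fun y1 y2 => p x y1 * p x' y2) (comul DY y).
Proof. exact: (hp_mull hp). Qed.
Let pMr x y y' : p x (hmul DY y y') = sweedler (fun x1 x2 => p x1 y * p x2 y') (comul DX x).
Proof. exact: (hp_mulr hp). Qed.

Let bilR (a a' : X) : bilin (fun y1 y2 => p a y1 * p a' y2).
Proof. exact: bilin_mul. Qed.

Let dual_comulM x x' :
  comul DX (hmul DX x x') = tmul (hmul DX) (hmul DX) (comul DX x) (comul DX x').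
Proof.
apply: (test2_ext pP) => y y'; rewrite -(hp_mulr hp) pM (weak_hopf_comulM wY).
rewrite (sweedler_tmul _ _ _ _ (bilR x x')) /test2 (sweedler_tmul _ _ _ _ (test2_bilin pP y y')).
transitivity (sweedler (fun b1 b2 => sweedler (fun c1 c2 =>
  sweedler (fun a1 a2 => sweedler (fun d1 d2 => p a1 b1 * p a2 c1 * (p d1 b2 * p d2 c2))
     (comul DX x')) (comul DX x)) (comul DY y')) (comul DY y)).
  apply: eq_sweedler => b1 b2; apply: eq_sweedler => c1 c2.
  by rewrite !pMr mull_sweedler; apply: eq_sweedler => a1 a2; rewrite mulr_sweedler.
rewrite [LHS]exchange_sweedler4.
apply: eq_sweedler => a1 a2; apply: eq_sweedler => d1 d2.
rewrite !pM mull_sweedler; apply: eq_sweedler => b1 b2; rewrite mulr_sweedler.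
by apply: eq_sweedler => c1 c2; rewrite mulrACA.
Qed.

(** The value of both sides of the first axiom on comul(1) of Y at (x, y, z). *)
Let dual_counitM x y z :
  counit DX (hmul DX (hmul DX x y) z) =
  sweedler (fun g1 g2 => counit DX (hmul DX x g1) * counit DX (hmul DX g2 z)) (comul DX y).
Proof.
have E := weak_hopf_comul1 wY; rewrite (hmul3_l algY) in E.
have {E} := congr1 (test3 ip x y z) E.
have ipP := perfect_flip pP.
rewrite [in LHS]/test3 (sweedler_tmap _ _ _ (test3_bilin ipP x y z)).
under [LHS]eq_sweedler do rewrite -(hp_mull hp).
rewrite -pM (hp_oner hp) => ->.
rewrite (sweedler_scal _ _ (test3_scalar ipP _ _ _)).
under [LHS]eq_sweedler do (rewrite (sweedler_scal _ _ (test3_scalar ipP _ _ _));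
  under eq_sweedler do rewrite (test3_pure ipP) (hp_mulr hp) mulr_sweedler mull_sweedler).
under [RHS]eq_sweedler do rewrite -!(hp_oner hp) !pM mull_sweedler.
under [RHS]eq_sweedler do under eq_sweedler do rewrite mulr_sweedler.
rewrite [RHS]exchange_sweedler; apply: eq_sweedler => a b.
rewrite [RHS]exchange_sweedler; apply: eq_sweedler => c d.
by apply: eq_sweedler => e f; rewrite !mulrA.
Qed.

(** The same with the other axiom on comul(1) of Y. *)
Let dual_counitM' x y z :
  counit DX (hmul DX (hmul DX x y) z) =
  sweedler (fun g1 g2 => counit DX (hmul DX x g2) * counit DX (hmul DX g1 z)) (comul DX y).
Proof.
have E := weak_hopf_comul1' wY; rewrite (hmul3_r algY) in E.
have {E} := congr1 (test3 ip x y z) E.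
have ipP := perfect_flip pP.
rewrite [in LHS]/test3 (sweedler_tmap _ _ _ (test3_bilin ipP x y z)).
under [LHS]eq_sweedler do rewrite -(hp_mull hp).
rewrite -pM (hp_oner hp) => ->.
rewrite (sweedler_scal _ _ (test3_scalar ipP _ _ _)).
under [LHS]eq_sweedler do (rewrite (sweedler_scal _ _ (test3_scalar ipP _ _ _));
  under eq_sweedler do rewrite (test3_pure ipP) (hp_mulr hp) mulr_sweedler mull_sweedler).
under [RHS]eq_sweedler do rewrite -!(hp_oner hp) !pM mull_sweedler.
under [RHS]eq_sweedler do under eq_sweedler do rewrite mulr_sweedler.
rewrite [RHS]exchange_sweedler; apply: eq_sweedler => a b.
rewrite [RHS]exchange_sweedler; apply: eq_sweedler => c d.
by apply: eq_sweedler => e f; rewrite -!mulrA; congr (_ * _); rewrite mulrCA.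
Qed.

(** The iterated comultiplication of the unit of X is the functional
y1, y2, y3 |-> counit(y1 y2 y3) on Y. *)
Let comul1_test y1 y2 y3 :
  test3 p y1 y2 y3 (tmap (comul DX) id (comul DX (hone DX))) =
  counit DY (hmul DY (hmul DY y1 y2) y3).
Proof.
rewrite /test3 (sweedler_tmap _ _ _ (test3_bilin pP _ _ _)).
under eq_sweedler do rewrite -(hp_mulr hp).
by rewrite -pMr (hp_onel hp).
Qed.

Let dual_comul1 :
  tmap (comul DX) id (comul DX (hone DX)) = hmul3 DX (comul1_one DX) (one_comul1 DX).
Proof.
apply: (test3_ext pP) => y1 y2 y3.
rewrite comul1_test (weak_hopf_counitM wY) (hmul3_l algX).
rewrite (sweedler_scal _ _ (test3_scalar pP _ _ _)).
under [RHS]eq_sweedler do (rewrite (sweedler_scal _ _ (test3_scalar pP _ _ _));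
  under eq_sweedler do rewrite (test3_pure pP) (hp_mull hp) mulr_sweedler mull_sweedler).
under [LHS]eq_sweedler do rewrite -!(hp_onel hp) !pMr mull_sweedler.
under [LHS]eq_sweedler do under eq_sweedler do rewrite mulr_sweedler.
rewrite [LHS]exchange_sweedler; apply: eq_sweedler => a b.
rewrite [LHS]exchange_sweedler; apply: eq_sweedler => c d.
by apply: eq_sweedler => e f; rewrite !mulrA.
Qed.

Let dual_comul1' :
  tmap (comul DX) id (comul DX (hone DX)) = hmul3 DX (one_comul1 DX) (comul1_one DX).
Proof.
apply: (test3_ext pP) => y1 y2 y3.
rewrite comul1_test (weak_hopf_counitM' wY) (hmul3_r algX).
rewrite (sweedler_scal _ _ (test3_scalar pP _ _ _)).
under [RHS]eq_sweedler do (rewrite (sweedler_scal _ _ (test3_scalar pP _ _ _));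
  under eq_sweedler do rewrite (test3_pure pP) (hp_mull hp) mulr_sweedler mull_sweedler).
under [LHS]eq_sweedler do rewrite -!(hp_onel hp) !pMr mull_sweedler.
under [LHS]eq_sweedler do under eq_sweedler do rewrite mulr_sweedler.
rewrite [LHS]exchange_sweedler; apply: eq_sweedler => a b.
rewrite [LHS]exchange_sweedler; apply: eq_sweedler => c d.
by apply: eq_sweedler => e f; rewrite -!mulrA; congr (_ * _); rewrite mulrCA.
Qed.

Let SXL : linear (antipode DX).
Proof.
by move=> c x x'; apply: (perf_inj pP) => y; rewrite pL !(hp_anti hp) pL.
Qed.

Let eXL : scalar (counit DX).
Proof. by move=> c x x'; rewrite -!(hp_oner hp) pL. Qed.

Let eYL : scalar (counit DY).
Proof. by move=> c x x'; rewrite -!(hp_onel hp) pR. Qed.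

Let dual_antipode_l x :
  sweedler (fun x1 x2 => hmul DX x1 (antipode DX x2)) (comul DX x) =
  sweedler (fun a b => counit DX a *: b)
    (tmul (hmul DX) (hmul DX) (comul DX (hone DX)) (x ⊗ hone DX)).
Proof.
apply: (perf_inj pP) => y; rewrite (sweedler_tmul_one algX) ?p_sweedler; last exact: bilin_scale.
transitivity (p x (sweedler (fun y1 y2 => hmul DY y1 (antipode DY y2)) (comul DY y))).
  under [LHS]eq_sweedler do rewrite pM.
  rewrite [RHS]p_sweedlerr exchange_sweedler; apply: eq_sweedler => a b.
  by rewrite pMr; apply: eq_sweedler => c d; rewrite (hp_anti hp).
rewrite (weak_hopf_antipode_l wY) (sweedler_tmul_one algY) ?p_sweedlerr; last exact: bilin_scale.
under [LHS]eq_sweedler do rewrite pZr -(hp_onel hp) pMr mull_sweedler.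
under [RHS]eq_sweedler do rewrite pZ -(hp_oner hp) pM mull_sweedler.
rewrite exchange_sweedler; apply: eq_sweedler => a b; apply: eq_sweedler => c d.
by rewrite -!mulrA; congr (_ * _); rewrite mulrC.
Qed.

Let dual_antipode_r x :
  sweedler (fun x1 x2 => hmul DX (antipode DX x1) x2) (comul DX x) =
  sweedler (fun a b => counit DX b *: a)
    (tmul (hmul DX) (hmul DX) (hone DX ⊗ x) (comul DX (hone DX))).
Proof.
have lX (u : X) : linear (fun a : X => counit DX u *: a) by move=> c a b; rewrite scalerDr !scalerA mulrC.
have lY (u : Y) : linear (fun a : Y => counit DY u *: a) by move=> c a b; rewrite scalerDr !scalerA mulrC.
have rX (u : X) : linear (fun a => counit DX a *: u) by move=> c a b; rewrite eXL scalerDl scalerA.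
have rY (u : Y) : linear (fun a => counit DY a *: u) by move=> c a b; rewrite eYL scalerDl scalerA.
apply: (perf_inj pP) => y; rewrite (sweedler_one_tmul algX) // !p_sweedler.
transitivity (p x (sweedler (fun y1 y2 => hmul DY (antipode DY y1) y2) (comul DY y))).
  under [LHS]eq_sweedler do rewrite pM.
  rewrite [RHS]p_sweedlerr exchange_sweedler; apply: eq_sweedler => a b.
  by rewrite pMr; apply: eq_sweedler => c d; rewrite (hp_anti hp).
rewrite (weak_hopf_antipode_r wY) (sweedler_one_tmul algY) // p_sweedlerr.
under [LHS]eq_sweedler do rewrite pZr -(hp_onel hp) pMr mull_sweedler.
under [RHS]eq_sweedler do rewrite pZ -(hp_oner hp) pM mull_sweedler.
rewrite exchange_sweedler; apply: eq_sweedler => a b; apply: eq_sweedler => c d.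
by rewrite mulrC -[RHS]mulrA [p b d * p a y]mulrC.
Qed.

Let dual_antipode x :
  sweedler (fun x12 x3 => sweedler (fun x1 x2 =>
      hmul DX (hmul DX (antipode DX x1) x2) (antipode DX x3)) x12)
    (tmap (comul DX) id (comul DX x)) = antipode DX x.
Proof.
have [mXr mXl _ _ _] := algX; have [mYr mYl _ _ _] := algY.
have bX : bilin (fun x12 x3 => sweedler (fun x1 x2 =>
      hmul DX (hmul DX (antipode DX x1) x2) (antipode DX x3)) x12).
  apply: bilin_of_linear => z.
    by apply: sweedler_linear => u c a b; rewrite ?SXL ?mXl ?mXr ?mXl ?mXr.
  by apply: sweedler_param_linear => u v c a b; rewrite SXL mXr.
have SYL := weak_hopf_antipode_linear wY.
have bY : bilin (fun x12 x3 => sweedler (fun x1 x2 =>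
      hmul DY (hmul DY (antipode DY x1) x2) (antipode DY x3)) x12).
  apply: bilin_of_linear => z.
    by apply: sweedler_linear => u c a b; rewrite ?SYL ?mYl ?mYr ?mYl ?mYr.
  by apply: sweedler_param_linear => u v c a b; rewrite SYL mYr.
apply: (perf_inj pP) => y; rewrite (hp_anti hp) -(weak_hopf_antipode wY).
rewrite (sweedler_tmap _ _ _ bX) (sweedler_tmap _ _ _ bY).
rewrite p_sweedler p_sweedlerr.
under [LHS]eq_sweedler do rewrite p_sweedler.
under [RHS]eq_sweedler do rewrite p_sweedlerr.
under [LHS]eq_sweedler do (under eq_sweedler do rewrite pM; rewrite exchange_sweedler).
rewrite [LHS]exchange_sweedler; apply: eq_sweedler => a b.
transitivity (sweedler (fun x1 x2 =>
   p (sweedler (fun z1 z2 => hmul DX (antipode DX z1) z2) (comul DX x1)) a * p x2 (antipode DY b))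
   (comul DX x)).
  apply: eq_sweedler => c d; rewrite p_sweedler mull_sweedler.
  by apply: eq_sweedler => e f; rewrite (hp_anti hp).
under [LHS]eq_sweedler do rewrite p_sweedler.
transitivity (sweedler (fun x1 x2 =>
   p x1 (sweedler (fun z1 z2 => hmul DY (antipode DY z1) z2) (comul DY a)) * p x2 (antipode DY b))
   (comul DX x)).
  apply: eq_sweedler => c d; congr (_ * _); rewrite p_sweedlerr.
  under [LHS]eq_sweedler do rewrite pM.
  rewrite exchange_sweedler; apply: eq_sweedler => e f.
  by rewrite pMr; apply: eq_sweedler => g h; rewrite (hp_anti hp).
rewrite -pMr -p_sweedlerr.
by congr (p x _); rewrite -(@sweedler_lin _ _ _ _ _ ((hmul DY)^~ (antipode DY b))).
Qed.

(** Transposition exchanges the axioms on the counit with the axioms on comul(1), and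
maps each of the other axioms to itself. *)
Lemma dual_weak_hopf : is_weak_hopf DX.
Proof.
split=> //; exact: dual_coalgebra.
Qed.

End Duality.

Section DualIso.
Variables (k : fieldType) (X Y : lmodType k) (p : X -> Y -> k) (r : seq (X * Y)).
Hypothesis pP : perfect p r.

Lemma ev_dual_form (H : lmodType k) (g : H -> k) : scalar g -> ev (dual_form g) =1 g.
Proof. by move=> gL h; rewrite /ev insubdK //; exact/dual_predP. Qed.

Lemma ev_inj (H : lmodType k) (g g' : dual H) : ev g =1 ev g' -> g = g'.
Proof. by move=> E; apply: val_inj; apply/funext. Qed.

Lemma ev_scalar (H : lmodType k) (g : dual H) : scalar (ev g).
Proof. exact/dual_predP/(valP g). Qed.

Lemma ev_linear (H : lmodType k) (h : H) : scalar ((@ev k H)^~ h).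
Proof. by []. Qed.

Definition to_dual (x : X) : dual Y := dual_form (p x).

Lemma ev_to_dual x y : ev (to_dual x) y = p x y.
Proof. by rewrite ev_dual_form //; exact: (perfr pP). Qed.

Lemma to_dual_linear : linear to_dual.
Proof.
by move=> c x x'; apply: ev_inj => y; rewrite ev_linear !ev_to_dual (perfl pP).
Qed.

(** The evaluation of the dual is perfect as well; hence a comultiplication of the dual
is determined by the transposition property. *)
Lemma perfect_ev : perfect (@ev k Y) [seq (to_dual q.1, q.2) | q <- r].
Proof.
split=> [y|f|f|y]; first exact: ev_linear; first exact: ev_scalar.
- apply: ev_inj => y; rewrite big_map -[in RHS](perfY pP y).
  rewrite (scal_sum (ev_linear y)) (scal_sum (ev_scalar f)).
  by apply: eq_bigr => q _ /=; rewrite (scalZ (ev_linear y)) (scalZ (ev_scalar f)) ev_to_dual mulrC.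
- by rewrite big_map -[RHS](perfY pP y); apply: eq_bigr => q _; rewrite ev_to_dual.
Qed.

Lemma to_dual_bij : bijective to_dual.
Proof.
exists (fun f => \sum_(q <- r) ev f q.2 *: q.1) => [x|f].
  by rewrite -[RHS](perfX pP x); apply: eq_bigr => q _; rewrite ev_to_dual.
rewrite -[RHS](perfX perfect_ev f) big_map.
apply: (big_ind2 (fun x g => to_dual x = g)) => [|x g x' g' <- <-|q _].
- exact: lin0 to_dual_linear.
- exact: linD to_dual_linear _ _.
by apply: ev_inj => y; rewrite ev_to_dual (perf_scalel pP) -ev_to_dual.
Qed.

Variables (DX : hopf_data X) (DY : hopf_data Y).
Hypothesis hp : hopf_pairing p DX DY.

Lemma dual_iso : weak_hopf_isomorphic DX (dual_hopf DY).
Proof.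
exists to_dual; split.
- exact: to_dual_linear.
- exact: to_dual_bij.
- split=> [x x'|]; apply: ev_inj => y; rewrite ev_to_dual.
    rewrite (hp_mull hp) ev_dual_form.
      by apply: eq_sweedler => a b; rewrite !ev_to_dual.
    have E h : sweedler (fun h1 h2 => ev (to_dual x) h1 * ev (to_dual x') h2) (comul DY h) =
        p (hmul DX x x') h.
      by rewrite (hp_mull hp); apply: eq_sweedler => a b; rewrite !ev_to_dual.
    by move=> c a b; rewrite !E (perfr pP).
  rewrite (hp_onel hp) ev_dual_form // => c a b.
  by rewrite -!(hp_onel hp) (perfr pP).
- move=> x; split; last by rewrite /= ev_to_dual (hp_oner hp).
  have E h g : sweedler (fun f1 f2 => ev f1 h * ev f2 g) (tmap to_dual to_dual (comul DX x)) =
      ev (to_dual x) (hmul DY h g).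
    rewrite (sweedler_tmap _ _ _ (test2_bilin perfect_ev h g)) ev_to_dual (hp_mulr hp).
    by apply: eq_sweedler => a b; rewrite !ev_to_dual.
  apply: xget_unique => // t tP; apply: (test2_ext perfect_ev) => h g.
  by rewrite /test2 tP E.
move=> x; apply: ev_inj => y; rewrite ev_to_dual (hp_anti hp) ev_dual_form ?ev_to_dual //.
by move=> c a b; rewrite !ev_to_dual -!(hp_anti hp) (perfr pP).
Qed.

Lemma perfect_finite_dim : finite_dim Y.
Proof.
exists (size r), (fun i => (tnth (in_tuple r) i).2) => y.
exists (fun i => p (tnth (in_tuple r) i).1 y).
by rewrite -[LHS](perfY pP y) big_tnth.
Qed.
End DualIso.

(** * Separable and Frobenius algebras *)

(** Induction on the number of terms.  If some functional does not vanish on the right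
leg of the first term, the hypothesis expresses its left leg by the others, and the
first term can be absorbed in them. *)
Lemma separation (k : fieldType) (X Y : lmodType k) (I : Type) (t : I -> Y -> k) :
  (forall i, scalar (t i)) -> (forall y, (forall i, t i y = 0) -> y = 0) ->
  forall r : seq (X * Y), (forall i, \sum_(q <- r) t i q.2 *: q.1 = 0) ->
  \sum_(q <- r) q.1 ⊗ q.2 = 0.
Proof.
move=> tL t_sep r; have [n] := ubnP (size r); elim: n r => // n IH [|[x y] r] /= szr rP.
  by rewrite big_nil.
have [y0|] := pselect (forall i, t i y = 0).
  rewrite big_cons /= (t_sep y y0) -[X in x ⊗ X](scale0r 0) pureZr scale0r add0r.
  by apply: IH => // i; have := rP i; rewrite big_cons /= y0 scale0r add0r.
move=> /existsNP[i /eqP c0]; set c := t i y in c0.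
(* substituting the value of x below subtracts a multiple of y from the right legs *)
pose r' := [seq (q.1, q.2 - (c^-1 * t i q.2) *: y) | q <- r].
have xE : x = - (c^-1 *: \sum_(q <- r) t i q.2 *: q.1).
  have /eqP := rP i; rewrite big_cons /= addr_eq0 => /eqP E.
  by rewrite -scalerN -E -/c scalerA mulVf ?scale1r.
transitivity (\sum_(q <- r') q.1 ⊗ q.2).
  rewrite big_cons big_map /= xE -scaleN1r pureZl pureZl pure_suml.
  rewrite scalerA mulN1r scaler_sumr -big_split; apply: eq_bigr => q _ /=.
  rewrite pureDr addrC; congr (_ + _).
  by rewrite pureZl -[- (_ *: y)]scaleNr pureZr scalerA mulNr.
apply: IH => [|j]; first by rewrite size_map.
rewrite big_map -[RHS](rP j) [RHS]big_cons /=.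
rewrite xE scalerN scalerA scaler_sumr addrC -sumrB; apply: eq_bigr => q _ /=.
rewrite -scaleNr addrC (tL j) scalerDl addrC mulNr scaleNr; congr (_ - _).
by rewrite scalerA mulrAC [t j y * _]mulrC mulrAC.
Qed.

Section Separable.
Variables (k : fieldType) (H : algType k) (f : H ⊗ H).
Hypothesis fP : symmetric_separability f.

Lemma sep_casimir (P : zmodType) (g : H -> H -> P) h : bilin g ->
  sweedler (fun a b => g (h * a) b) f = sweedler (fun a b => g a (b * h)) f.
Proof.
move=> gP; have [/(_ h)/(congr1 (sweedler g)) + _ _] := fP.
by rewrite !sweedler_sweedler_pure.
Qed.

Lemma sep_flip (P : zmodType) (g : H -> H -> P) : bilin g ->
  sweedler (fun a b => g b a) f = sweedler g f.
Proof.
by move=> gP; have [_ _ /(congr1 (sweedler g))] := fP; rewrite sweedler_sweedler_pure.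
Qed.

Lemma sep_mul : sweedler (fun a b => a * b) f = 1.
Proof. by have [] := fP. Qed.

Lemma bilin_mulr : bilin (fun a b : H => a * b).
Proof.
by apply: bilin_of_linear => c a x y; rewrite /= ?mulrDl ?mulrDr -?scalerAl -?scalerAr.
Qed.

Lemma bilin_mull : bilin (fun a b : H => b * a).
Proof.
by apply: bilin_of_linear => c a x y; rewrite /= ?mulrDl ?mulrDr -?scalerAl -?scalerAr.
Qed.

Lemma sep_mul_flip : sweedler (fun a b => b * a) f = 1.
Proof. exact: etrans (sep_flip bilin_mulr) sep_mul. Qed.

Variable T : H -> k.
Hypotheses (TL : scalar T) (T_trace : is_trace T).

(** This element z is the discrepancy between f and dual bases for T: one has
f1 T(f2 h) = h z, so that f1 and f2 z^-1 are dual bases once z is invertible. *)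
Definition sep_trace : H := sweedler (fun a b => T b *: a) f.
Local Notation z := sep_trace.

Let bilTb : bilin (fun a b : H => T b *: a).
Proof. exact: bilin_scaler. Qed.
Let bilTa : bilin (fun a b : H => T a *: b).
Proof. exact: bilin_scale. Qed.

Lemma sep_traceE h : sweedler (fun a b => T (b * h) *: a) f = h * z.
Proof.
rewrite -(sep_casimir h bilTb) [RHS]mulr_sumr; apply: eq_bigr => q _.
by rewrite scalerAr.
Qed.

(** Flip f, use the trace property, and flip back. *)
Lemma sep_trace_central h : h * z = z * h.
Proof.
have bilT : bilin (fun a b : H => T (b * h) *: a).
  by apply: (@bilin_scaler k H H (fun b => T (b * h))) => c a b; rewrite mulrDl -scalerAl TL.
rewrite -sep_traceE -(sep_flip bilT).
under eq_sweedler do rewrite T_trace.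
rewrite (sep_casimir h bilTa) -[RHS]/(sep_trace * h) /sep_trace -(sep_flip bilTb).
by rewrite [RHS]mulr_suml; apply: eq_bigr => q _; rewrite scalerAl.
Qed.

Hypothesis T_nondeg : forall g, (forall h, T (g * h) = 0) -> g = 0.

(** If g z = 0 then f1 T(h g f2) = 0 for all h, whence f1 (x) g f2 = 0 since T is
nondegenerate; multiplying the legs in the opposite order gives g = 0. *)
Lemma sep_trace_inj g : g * z = 0 -> g = 0.
Proof.
move=> gz.
have : \sum_(q <- [seq (q.1, g * q.2) | q <- repr f]) q.1 ⊗ q.2 = 0.
  apply: (@separation _ _ _ H (fun h y => T (y * h))) => [h c a b|y /T_nondeg //|h].
    by rewrite mulrDl -scalerAl TL.
  rewrite big_map /=; transitivity (h * g * z); last by rewrite -mulrA gz mulr0.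
  rewrite -sep_traceE; apply: eq_bigr => q _.
  by rewrite -[g * q.2 * h]mulrA T_trace mulrA.
have gP := bilin_mull.
move/(congr1 (sweedler (fun a b => b * a))); rewrite sweedler_sum_pure // big_map /=.
rewrite [in RHS]/sweedler (tlift0 gP) => <-.
under eq_bigr do rewrite -mulrA.
rewrite -mulr_sumr -[X in _ = _ * X]/(sweedler (fun a b : H => b * a) f).
by rewrite sep_mul_flip mulr1.
Qed.

(** As z is not a zero divisor, a relation of least degree has a nonzero constant term. *)
Lemma integral_inverse p : p != 0 -> horner_alg z p = 0 -> exists z', z * z' = 1.
Proof.
elim/poly_ind: p => [|p c IH p0]; first by rewrite eqxx.
rewrite rmorphD rmorphM /= horner_algX horner_algC.
have [c0|c0] := eqVneq c 0.
  rewrite c0 scale0r addr0 => /sep_trace_inj; apply: IH.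
  by apply: contraNneq p0 => ->; rewrite c0 mul0r add0r polyC0.
move=> /eqP; rewrite addr_eq0 => /eqP E.
exists (- (c^-1 *: horner_alg z p)).
rewrite mulrN -scalerAr -sep_trace_central E scalerN opprK scalerA mulVf //.
by rewrite scale1r.
Qed.

(** Multiplication by z maps the finite span of the left legs of f to itself, by the
matrix G below, so that the characteristic polynomial of G annihilates z. *)
Lemma sep_trace_inv : exists z', z * z' = 1 /\ z' * z = 1.
Proof.
suff [z' z'P] : exists z', z * z' = 1 by exists z'; split=> //; rewrite sep_trace_central.
have [n szf] : exists n, size (repr f) = n.+1.
  have := sep_mul; rewrite sweedlerE; case: (repr f) => [|q r _]; last by exists (size r).
  by rewrite big_nil => /esym/eqP; rewrite oner_eq0.
pose r := repr f; pose x (i : 'I_n.+1) := (nth 0 r i).1; pose y (i : 'I_n.+1) := (nth 0 r i).2.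
have sumf (F : H * H -> H) : \sum_(q <- r) F q = \sum_(i < n.+1) F (x i, y i).
  rewrite (big_nth 0) szf big_mkord; apply: eq_bigr => i _.
  by rewrite /x /y; case: (nth 0 r i).
pose G := \matrix_(j < n.+1, i < n.+1) T (y i * x j).
have zx j : z * x j = \sum_i G j i *: x i.
  rewrite -sep_trace_central -sep_traceE [LHS]sumf.
  by apply: eq_bigr => i _; rewrite mxE.
pose ev (p : {poly k}) : H := horner_alg z p.
have ev0 : ev 0 = 0 by rewrite /ev rmorph0.
have evMXD p c : ev (p * 'X + c%:P) = ev p * z + c *: 1.
  by rewrite /ev rmorphD rmorphM /= horner_algX horner_algC.
have px p j : ev p * x j = \sum_i horner_mx G p j i *: x i.
  elim/poly_ind: p j => [|p c IH] j.
    by rewrite ev0 rmorph0 mul0r big1 // => i _; rewrite mxE scale0r.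
  rewrite evMXD rmorphD rmorphM /= horner_mx_X horner_mx_C.
  rewrite mulrDl -mulrA zx mulr_sumr -scalerAl mul1r.
  under [RHS]eq_bigr do rewrite mxE scalerDl.
  rewrite big_split; congr (_ + _).
    under [LHS]eq_bigr do rewrite -scalerAr IH scaler_sumr.
    rewrite exchange_big; apply: eq_bigr => l _.
    have -> : horner_mx G p * G = G * horner_mx G p by apply: comm_horner_mx.
    by rewrite mxE scaler_suml; apply: eq_bigr => i _; rewrite scalerA.
  rewrite (bigD1 j) //= big1 ?addr0 => [|i ij]; first by rewrite mxE eqxx.
  by rewrite mxE eq_sym (negPf ij) scale0r.
have p0 := monic_neq0 (char_poly_monic G).
have chi0 i : ev (char_poly G) * x i = 0.
  by rewrite px Cayley_Hamilton big1 // => l _; rewrite mxE scale0r.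
apply: (integral_inverse p0); apply: sep_trace_inj.
rewrite -/(ev _); have -> : ev (char_poly G) * z = \sum_i ev (char_poly G) * (T (y i) *: x i).
  by rewrite -mulr_sumr; congr (_ * _); exact: sumf.
by rewrite big1 // => i _; rewrite -scalerAr chi0 scaler0.
Qed.
End Separable.

(** The pairs in r are dual bases for the bilinear form (g, h) |-> T(g h). *)
Definition frobenius (k : fieldType) (H : algType k) (T : H -> k) (r : seq (H * H)) : Prop :=
  forall h, \sum_(q <- r) T (q.2 * h) *: q.1 = h.

Section Frobenius.
Variables (k : fieldType) (H : algType k) (T : H -> k) (r : seq (H * H)).
Hypotheses (TL : scalar T) (T_trace : is_trace T) (rP : frobenius T r).

(** Dual bases of a nondegenerate form are unique as a tensor, and the flip of dual bases
for a trace is again a system of dual bases. *)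
Lemma frobenius_flip (P : zmodType) (g : H -> H -> P) : bilin g ->
  \sum_(q <- r) g q.2 q.1 = \sum_(q <- r) g q.1 q.2.
Proof.
move=> [gl gr gb].
have g0l y : g 0 y = 0 by apply: (addrI (g 0 y)); rewrite -gl !addr0.
have g0r x : g x 0 = 0 by apply: (addrI (g x 0)); rewrite -gr !addr0.
have gsl I (s : seq I) F y : g (\sum_(i <- s) F i) y = \sum_(i <- s) g (F i) y.
  exact: (big_morph (g^~ y) (gl y) (g0l y)).
have gsr I (s : seq I) F x : g x (\sum_(i <- s) F i) = \sum_(i <- s) g x (F i).
  exact: (big_morph (g x) (gr x) (g0r x)).
under [RHS]eq_bigr do rewrite -[X in g _ X]rP gsr.
rewrite exchange_big; apply: eq_bigr => q _.
rewrite -[in LHS](rP q.2) gsl; apply: eq_bigr => q' _.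
by rewrite -gb T_trace.
Qed.

Lemma frobenius_nondeg h : (forall g, T (h * g) = 0) -> h = 0.
Proof. by move=> h0; rewrite -(rP h) big1 // => q _; rewrite T_trace h0 scale0r. Qed.
End Frobenius.

Lemma sep_frobenius (k : fieldType) (H : algType k) (f : H ⊗ H) (T : H -> k) w :
  symmetric_separability f -> scalar T -> is_trace T -> sep_trace f T * w = 1 ->
  frobenius T [seq (q.1, q.2 * w) | q <- repr f].
Proof.
move=> fP TL TT zw h; rewrite big_map /=.
under eq_bigr do rewrite -mulrA.
have := sep_traceE fP TL (w * h); rewrite sweedlerE => ->.
by rewrite sep_trace_central // mulrA zw mul1r.
Qed.

Section FrobeniusTower.
Variables (k : fieldType) (D H : algType k) (i : D -> H) (E : H -> D) (n : nat) (a b : 'I_n -> H).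
Variables (t : D -> k) (r : seq (D * D)).
Hypothesis abP : forall h, \sum_j a j * i (E (b j * h)) = h.
Hypotheses (iL : linear i) (EM : forall d h, E (i d * h) = d * E h).
Hypothesis rP : frobenius t r.

(** Dual bases compose along D < H: those of E are multiplied from the inside by those
of t. *)
Lemma frobenius_tower :
  frobenius (fun h => t (E h)) [seq (a j * i q.1, i q.2 * b j) | j <- enum 'I_n, q <- r].
Proof.
move=> h; rewrite big_flatten big_map big_enum /= -[RHS]abP; apply: eq_bigr => j _.
rewrite big_map /=.
rewrite -[X in i X]rP (lin_sum iL) mulr_sumr; apply: eq_bigr => q _.
by rewrite (linZ iL) scalerAr -mulrA EM.
Qed.
End FrobeniusTower.

Section TowerCasimir.
Variables (k : fieldType) (D H : algType k) (i : D -> H) (E : H -> D) (n : nat) (a b : 'I_n -> H).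
Hypothesis abl : forall h, \sum_j i (E (h * a j)) * b j = h.
Hypothesis abr : forall h, \sum_j a j * i (E (b j * h)) = h.
Hypotheses (iL : linear i) (iM : {morph i : x y / x * y}).
Variable f : D ⊗ D.
Hypothesis fP : symmetric_separability f.

(** A separability element of H up to normalization, from dual bases of E : H -> D and a
separability element of D. *)
Definition tower_casimir : seq (H * H) :=
  [seq (a j * i q.1, i q.2 * b j) | j <- enum 'I_n, q <- repr f].

Lemma tower_casimirE (P : zmodType) (g : H -> H -> P) :
  \sum_(q <- tower_casimir) g q.1 q.2 =
  \sum_j sweedler (fun f1 f2 => g (a j * i f1) (i f2 * b j)) f.
Proof.
rewrite big_flatten big_map big_enum /=; apply: eq_bigr => j _.
by rewrite big_map.
Qed.

(** Moving h through the dual bases of E produces coefficients in D, and these move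
through f. *)
Lemma tower_casimir_comm (P : zmodType) (g : H -> H -> P) h : bilin g ->
  \sum_(q <- tower_casimir) g (h * q.1) q.2 = \sum_(q <- tower_casimir) g q.1 (q.2 * h).
Proof.
move=> gP; have [gl gr gb] := gP.
have g0l y : g 0 y = 0 by apply: (addrI (g 0 y)); rewrite -gl !addr0.
have g0r x : g x 0 = 0 by apply: (addrI (g x 0)); rewrite -gr !addr0.
rewrite (@tower_casimirE _ (fun u v => g (h * u) v)) (@tower_casimirE _ (fun u v => g u (v * h))).
pose F s j := sweedler (fun f1 f2 => g (a s * i f1) (i f2 * (i (E (b s * h * a j)) * b j))) f.
transitivity (\sum_j \sum_s F s j).
  apply: eq_bigr => j _.
  transitivity (\sum_s sweedler (fun f1 f2 => g (a s * i (E (b s * h * a j) * f1)) (i f2 * b j)) f).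
    rewrite exchange_big; apply: eq_bigr => q _ /=.
    rewrite -(big_morph (g^~ _) (gl _) (g0l _)) mulrA -[h * a j]abr mulr_suml; congr (g _ _).
    by apply: eq_bigr => s _; rewrite iM !mulrA.
  apply: eq_bigr => s _; rewrite /F.
  have bil : bilin (fun f1 f2 => g (a s * i f1) (i f2 * b j)).
    apply: (bilin_comp gP) => c u v; rewrite iL.
      by rewrite mulrDr scalerAr.
    by rewrite mulrDl scalerAl.
  rewrite (sep_casimir fP _ bil); apply: eq_sweedler => f1 f2.
  by rewrite iM !mulrA.
rewrite exchange_big; apply: eq_bigr => s _ /=; rewrite exchange_big; apply: eq_bigr => q _ /=.
rewrite -(big_morph (g _) (gr _) (g0r _)) -[in RHS]mulrA -[b s * h in RHS]abl -mulr_sumr.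
by [].
Qed.

Lemma tower_casimir_mul : \sum_(q <- tower_casimir) q.1 * q.2 = \sum_j a j * (i 1 * b j).
Proof.
rewrite (tower_casimirE (fun u v => u * v)); apply: eq_bigr => j _.
have L : linear (fun d => a j * (i d * b j)).
  by move=> c u v; rewrite iL mulrDl mulrDr -scalerAl -scalerAr.
rewrite -(sep_mul fP) (sweedler_lin _ _ L); apply: eq_sweedler => u v.
by rewrite iM !mulrA.
Qed.
End TowerCasimir.

Section Subspace.
Variables (k : fieldType) (n : nat) (I : set 'rV[k]_n).
Hypothesis I0 : I 0.
Hypothesis IL : forall c u v, I u -> I v -> I (c *: u + v).

(** A matrix of maximal rank among those with row space inside the subspace. *)
Lemma subspace_matrix : exists M : 'M[k]_n, forall v, I v <-> (v <= M)%MS.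
Proof.
pose P m := `[< exists2 M : 'M[k]_n, \rank M = m & forall v, (v <= M)%MS -> I v >].
have Pex : exists m, P m.
  exists 0; apply/asboolP; exists 0; first exact: mxrank0.
  by move=> v; rewrite submx0 => /eqP ->.
have Pmax m : P m -> (m <= n)%N by move=> /asboolP[M <- _]; exact: rank_leq_row.
case: (ex_maxnP Pex Pmax) => m /asboolP[M rM MI] m_max.
exists M => v; split=> [Iv|]; last exact: MI.
apply/negPn/negP => vM.
have : P (\rank (M + v)%MS).
  apply/asboolP; exists (M + v)%MS => // u /sub_addsmxP[[a b]] /= ->.
  rewrite addrC; have -> : b *m v = b 0 0 *: v by rewrite [b]mx11_scalar mul_scalar_mx mxE eqxx.
  by apply: IL => //; apply: MI; exact: submxMl.
move=> /m_max; rewrite leqNgt -rM => /negP; apply.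
have : (M < M + v)%MS.
  rewrite /ltmx addsmxSl /=; by apply: contra vM; exact: submx_trans (addsmxSr _ _).
exact: rank_ltmx.
Qed.
End Subspace.

Section Maschke.
Variables (k : fieldType) (H : algType k) (T : H -> k) (r0 : seq (H * H)) (r : seq (H * H)).
Hypotheses (TL : scalar T) (r0P : frobenius T r0).
Hypothesis casimir : forall (g : H -> H -> H) h, bilin g ->
  \sum_(q <- r) g (h * q.1) q.2 = \sum_(q <- r) g q.1 (q.2 * h).
Hypothesis r1 : \sum_(q <- r) q.1 * q.2 = 1.

(** Coordinates given by the dual bases embed H in a space of row vectors, where the
image of the ideal is a row space and has a projection. *)
Lemma left_ideal_projection (I : set H) : left_ideal I ->
  exists p : H -> H, [/\ linear p, forall h, I (p h) & forall h, I h -> p h = h].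
Proof.
move=> [I0 ID IM]; pose n := size r0.
have IZ c h : I h -> I (c *: h) by move=> /(IM (c%:A)); rewrite -scalerAl mul1r.
pose x (i : 'I_n) := (nth 0 r0 i).1.
pose xi h : 'rV[k]_n := \row_i T ((nth 0 r0 i).2 * h).
pose g (v : 'rV[k]_n) := \sum_i v 0 i *: x i.
have xiK h : g (xi h) = h.
  rewrite -[RHS]r0P (big_nth 0) big_mkord; apply: eq_bigr => i _.
  by rewrite mxE.
have gL : linear g.
  move=> c u v; rewrite /g scaler_sumr -big_split; apply: eq_bigr => i _.
  by rewrite !mxE scalerDl scalerA.
have xiL : linear xi.
  move=> c u v; apply/rowP => i; rewrite !mxE mulrDr -scalerAr TL.
  by [].
have [M MP] : exists M : 'M[k]_n, forall v, (exists2 h, I h & v = xi h) <-> (v <= M)%MS.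
  apply: subspace_matrix => [|c _ _ [u Iu ->] [v Iv ->]]; first by exists 0; rewrite ?(lin0 xiL).
  by exists (c *: u + v); [apply: ID; first exact: IZ | rewrite xiL].
exists (fun h => g (xi h *m (pinvmx M *m M))); split=> [c u v|h|h Ih].
- by rewrite xiL mulmxDl -scalemxAl gL.
- have /MP[h' Ih' ->] : (xi h *m (pinvmx M *m M) <= M)%MS by rewrite mulmxA submxMl.
  by rewrite xiK.
by rewrite mulmxA mulmxKpV ?xiK //; apply/MP; exists h.
Qed.

(** The average q1 p(q2 -) of a linear projection p onto a left ideal, over a
separability element (q1, q2), is an H-linear projection; its kernel is a complement. *)
Lemma separable_semisimple : semisimple H.
Proof.
move=> I IP; have [I0 ID IM] := IP; have [p [pL pI pK]] := left_ideal_projection IP.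
pose P h := \sum_(q <- r) q.1 * p (q.2 * h).
have PD u v : P (u + v) = P u + P v.
  rewrite -big_split; apply: eq_bigr => q _.
  by rewrite mulrDr (linD pL) mulrDr.
have PM a h : P (a * h) = a * P h.
  rewrite /P mulr_sumr; under [RHS]eq_bigr do rewrite mulrA.
  under [LHS]eq_bigr do rewrite mulrA.
  rewrite (casimir (g := fun u v => u * p (v * h))) //.
  apply: bilin_of_linear => [y|y] c u v /=; first by rewrite mulrDl scalerAl.
  by rewrite mulrDl -scalerAl pL mulrDr scalerAr.
have PI h : I (P h) by apply: big_ind => // q _; apply: IM.
have PK h : I h -> P h = h.
  move=> Ih; rewrite -[RHS]mul1r -r1 mulr_suml; apply: eq_bigr => q _.
  by rewrite pK ?mulrA //; apply: IM.
have PN h : P (- h) = - P h by rewrite -mulN1r PM mulN1r.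
exists (fun h => P h = 0).
  split=> [|g h Pg Ph|a h Ph] /=; first by have := PM 0 0; rewrite !mul0r.
    by rewrite PD Pg Ph addr0.
  by rewrite PM Ph mulr0.
split=> [h Ih Ph|h]; first by rewrite -(PK h).
exists (P h), (h - P h); split=> //=; last by rewrite addrC subrK.
by rewrite PD PN (PK (P h)) ?subrr.
Qed.
End Maschke.

Section AntiTransport.
Variables (k : fieldType) (H H' : algType k) (h : H -> H').
Hypotheses (hL : linear h) (h1 : h 1 = 1) (hM : forall u v, h u * h v = h (v * u)).
Hypothesis h_surj : forall v, exists u, h u = v.
Variable f : H ⊗ H.
Hypothesis fP : symmetric_separability f.

(** An anti-isomorphism turns the Casimir property around, which is harmless because f
is symmetric. *)
Lemma anti_sep : symmetric_separability (tmap h h f).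
Proof.
have bil : bilin (fun u v => h u ⊗ h v) by exact: (bilin_comp (@bilin_pure _ _ _) hL hL).
split=> [v||].
- have [u <-] := h_surj v.
  have bl : bilin (fun a b : H' => (h u * a) ⊗ b).
    by apply: (bilin_comp (@bilin_pure _ _ _)) => c x y //; rewrite mulrDr scalerAr.
  have br : bilin (fun a b : H' => a ⊗ (b * h u)).
    by apply: (bilin_comp (@bilin_pure _ _ _)) => c x y //; rewrite mulrDl scalerAl.
  rewrite (sweedler_tmap _ _ _ bl) (sweedler_tmap _ _ _ br).
  under [LHS]eq_sweedler do rewrite hM.
  under [RHS]eq_sweedler do rewrite hM.
  have bl' : bilin (fun a b => h (a * u) ⊗ h b).
    apply: (bilin_comp bil (f := *%R^~ u) (f' := id)) => // c x y.
    by rewrite mulrDl scalerAl.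
  have br' : bilin (fun a b => h a ⊗ h (u * b)).
    apply: (bilin_comp bil (f := id) (f' := *%R u)) => // c x y.
    by rewrite mulrDr scalerAr.
  rewrite -(sep_flip fP bl') -(sep_flip fP br').
  have bilf : bilin (fun a b => h b ⊗ h a).
    by have [? ? b] := bil; split=> [y x x'|x y y'|c x y]; rewrite ?(linD hL) ?pureDl ?pureDr -?b.
  by rewrite (sep_casimir fP u bilf).
- rewrite sweedler_tmap; last exact: bilin_mulr.
  under eq_sweedler do rewrite hM.
  by rewrite -(sweedler_lin _ _ hL) (sep_mul_flip fP).
rewrite sweedler_tmap; last first.
  by have [bl br b] := @bilin_pure k H' H'; split=> [y x x'|x y y'|c x y]; rewrite ?br ?bl -?b.
exact: (sep_flip fP bil).
Qed.
End AntiTransport.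

(** * The basic construction *)

(** What is used of Jones' basic construction R = Q e Q of a Frobenius extension Q of P:
the relation e q e = E(q) e, and the fact that r e and e r are determined by their
expectations. *)
Record basic_construction (k : fieldType) (P Q R : algType k) (j : {lrmorphism P -> Q})
    (E : {linear Q -> P}) (i : {lrmorphism Q -> R}) (E' : {linear R -> Q}) (e : R) (l : k)
    (n : nat) (x y : 'I_n -> Q) : Prop := BasicConstruction {
  bc_l : l != 0;
  bc_dbl : forall q, \sum_s j (E (q * x s)) * y s = q;
  bc_dbr : forall q, \sum_s x s * j (E (y s * q)) = q;
  bc_index : \sum_s x s * y s = l^-1 *: 1;
  bc_El : forall p q, E (j p * q) = p * E q;
  bc_Er : forall p q, E (q * j p) = E q * p;
  bc_E'l : forall q r, E' (i q * r) = q * E' r;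
  bc_E'r : forall q r, E' (r * i q) = E' r * q;
  bc_E'1 : E' 1 = 1;
  bc_E'e : E' e = l *: 1;
  bc_eqe : forall q, e * i q * e = i (j (E q)) * e;
  bc_comm : forall p, e * i (j p) = i (j p) * e;
  bc_one : \sum_s i (x s) * e * i (y s) = 1;
  bc_pushl : forall r, i (E' (r * e)) * e = l *: (r * e);
  bc_pushr : forall r, e * i (E' (e * r)) = l *: (e * r)
}.

Lemma centr_comm (k : fieldType) (X : algType k) (Y : Type) (i : Y -> X) (a : centr i) z : val a * i z = i z * val a.
Proof. exact: (centrP _ _ (valP a)). Qed.

Section JonesBasic.
Variables (k : fieldType) (F : strongly_separable k).
Local Notation R := (Defs.total (jones F)).
Local Notation i := (Defs.incl (jones F) : Defs.total F -> R).
Local Notation e := (jtens 1 1 : R).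

Lemma jones_tensE a b : (jtens a b : R) = i a * e * i b.
Proof.
have -> : i a * e = jtens a 1 by rewrite -[LHS]/(jones_incl a * jtens 1 1) jones_incl_tens mulr1.
by rewrite -[RHS]/(jtens a 1 * jones_incl b) jones_tens_incl mul1r.
Qed.

Lemma jones_basic_construction :
  basic_construction (Defs.incl F) (cexp F) (Defs.incl (jones F)) (cexp (jones F)) e (lam F) (dbl F) (dbr F).
Proof.
split.
- exact: lam_neq0.
- exact: dbPl.
- exact: dbPr.
- exact: dbl_dbr.
- exact: cexpl.
- by move=> p q; exact: cexpr.
- by move=> q r; exact: (cexpl (F := jones F)).
- by move=> q r; exact: (cexpr (F := jones F)).
- exact: (cexp1 (jones F)).
- by rewrite -[LHS]/(jones_cexp (jtens 1 1)) jones_cexpE mulr1.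
- move=> q; have -> : i (Defs.incl F (cexp F q)) * e = jtens (Defs.incl F (cexp F q)) 1.
    by rewrite -[LHS]/(jones_incl _ * jtens 1 1) jones_incl_tens mulr1.
  rewrite -[LHS]/(jtens 1 1 * jones_incl q * jtens 1 1) jones_tens_incl jtensM.
  by rewrite !mul1r mulr1.
- move=> p; rewrite -[LHS]/(jtens 1 1 * jones_incl (Defs.incl F p)).
  rewrite -[RHS]/(jones_incl (Defs.incl F p) * jtens 1 1).
  by rewrite jones_incl_tens jones_tens_incl mul1r mulr1 -[in RHS](mul1r (Defs.incl F p)) jtens_bal mulr1.
- rewrite -[RHS]/(jones_one F) /jones_one; apply: eq_bigr => s _.
  by rewrite -jones_tensE.
- move=> r; elim/(@jones_ind k F): r => [|s t IHs IHt|a b].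
  + by rewrite mul0r linear0 rmorph0 mul0r scaler0.
  + by rewrite mulrDl linearD rmorphD mulrDl IHs IHt scalerDr.
  rewrite -[jtens a b * _]/(jtens a b * jtens 1 1) jtensM mulr1.
  rewrite -[LHS]/(jones_incl (jones_cexp (jtens _ 1)) * jtens 1 1) jones_cexpE mulr1.
  by rewrite linearZ -scalerAl /= jones_incl_tens mulr1.
move=> r; elim/(@jones_ind k F): r => [|s t IHs IHt|a b].
+ by rewrite mulr0 linear0 rmorph0 mulr0 scaler0.
+ by rewrite mulrDr linearD rmorphD mulrDr IHs IHt scalerDr.
rewrite -[_ * jtens a b]/(jtens 1 1 * jtens a b) jtensM !mul1r.
rewrite -[LHS]/(jtens 1 1 * jones_incl (jones_cexp (jtens _ b))) jones_cexpE.
by rewrite linearZ -scalerAr /= jones_tens_incl mul1r -[in RHS](mul1r (Defs.incl F _)) jtens_bal.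
Qed.
End JonesBasic.

Section Phi.
Variables (k : fieldType) (P Q R : algType k) (j : {lrmorphism P -> Q}).
Variables (E : {linear Q -> P}) (i : {lrmorphism Q -> R}) (E' : {linear R -> Q}) (e : R) (l : k).
Variables (n : nat) (x y : 'I_n -> Q).
Hypothesis BC : basic_construction j E i E' e l x y.
Local Notation U := (centr j).
Local Notation V := (centr i).

(** On U this is the anti-isomorphism of U onto V. *)
Definition anti (q : Q) : R := \sum_s i (x s) * (i q * e) * i (y s).

(** Dual bases of a Frobenius homomorphism form a Casimir element over P, so summing an
element that commutes with P against them gives one that commutes with Q. *)
Lemma casimir_comm (S : algType k) (h : {rmorphism Q -> S}) (c : S) :
  (forall p, c * h (j p) = h (j p) * c) ->
  forall q, (\sum_s h (x s) * c * h (y s)) * h q = h q * \sum_s h (x s) * c * h (y s).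
Proof.
move=> cP q.
transitivity (\sum_t \sum_s h (x t) * h (j (E (y t * q * x s))) * c * h (y s)).
  rewrite mulr_suml; apply: eq_bigr => t _.
  rewrite -[LHS]mulrA -rmorphM -[y t * q in LHS](bc_dbl BC) rmorph_sum mulr_sumr.
  apply: eq_bigr => s _ /=; rewrite rmorphM.
  by rewrite mulrA -[h (x t) * c * _]mulrA cP !mulrA.
rewrite exchange_big mulr_sumr; apply: eq_bigr => s _ /=.
rewrite -!mulr_suml !mulrA; congr (_ * _ * _).
rewrite -!rmorphM -[q * x s in RHS](bc_dbr BC) !rmorph_sum; apply: eq_bigr => t _.
by rewrite -!rmorphM !mulrA.
Qed.

Lemma ue_comm (u : U) p : i (val u) * e * i (j p) = i (j p) * (i (val u) * e).
Proof.
by rewrite -mulrA (bc_comm BC) !mulrA -!rmorphM centr_comm.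
Qed.

Lemma anti_V (u : U) : anti (val u) \in centr_pred i.
Proof. by apply/centrP => q; apply: (casimir_comm (h := i)) => p; exact: ue_comm. Qed.

Definition antiV (u : U) : V := Sub (anti (val u)) (anti_V u).

(** Moves the value of anti past e in a product of two such values. *)
Lemma anti_e (u : U) : anti (val u) * e = i (val u) * e.
Proof.
transitivity (i (\sum_s x s * j (E (y s))) * (i (val u) * e)).
  rewrite mulr_suml rmorph_sum mulr_suml; apply: eq_bigr => s _.
  rewrite -!mulrA [e * (_ * e)]mulrA (bc_eqe BC) rmorphM -!mulrA; congr (_ * _).
  by rewrite !mulrA -!rmorphM centr_comm.
have := bc_dbr BC 1; under eq_bigr do rewrite mulr1.
by move=> ->; rewrite rmorph1 mul1r.
Qed.

Lemma antiV_mul u v : antiV u * antiV v = antiV (v * u).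
Proof.
apply: val_inj; rewrite /= /anti mulr_sumr; apply: eq_bigr => s _.
have uV q : anti (val u) * i q = i q * anti (val u) := centrP _ _ (anti_V u) q.
rewrite -[\sum_s _]/(anti (val u)) !mulrA uV -[_ * anti _ * i _]mulrA uV.
by rewrite -!mulrA [anti _ * (e * _)]mulrA anti_e rmorphM !mulrA.
Qed.

Lemma antiV1 : antiV 1 = 1.
Proof.
apply: val_inj; rewrite /= /anti -[RHS](bc_one BC); apply: eq_bigr => s _.
by rewrite rmorph1 mul1r.
Qed.

Lemma antiV_linear : linear antiV.
Proof.
move=> c u v; apply: val_inj; rewrite linearP /= /anti scaler_sumr -big_split.
apply: eq_bigr => s _ /=.
by rewrite !linearP /= !mulrDl mulrDr mulrDl -!scalerAl -scalerAr -scalerAl.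
Qed.

(** The preimage of v is lam^-1 E'(v e), since v e determines v in V. *)
Lemma antiV_surj v : exists u, antiV u = v.
Proof.
pose q := l^-1 *: E' (val v * e).
have qP : q \in centr_pred j.
  apply/centrP => p; rewrite /q -scalerAl -scalerAr -(bc_E'r BC) -(bc_E'l BC).
  by rewrite -mulrA (bc_comm BC) !mulrA centr_comm.
exists (Sub q qP); apply: val_inj; rewrite /= /anti.
have -> : i q * e = val v * e.
  rewrite /q linearZ -scalerAl (bc_pushl BC) scalerA mulVf ?(bc_l BC) ?scale1r //.
rewrite -[RHS]mulr1 -(bc_one BC) mulr_sumr; apply: eq_bigr => s _.
by rewrite !mulrA centr_comm.
Qed.
End Phi.

Section JonesTrace.
Variables (k : fieldType) (F : strongly_separable k) (t : base F -> k).
Hypotheses (tL : scalar t) (tC : is_trace t).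
Hypothesis tEC : is_trace (fun m : Defs.total F => t (cexp F m)).

(** On generators, the trace of (a e b)(c e d) is lam t(E(b c) E(d a)). *)
Lemma jones_trace : is_trace (fun c : Defs.total (jones F) => t (cexp F (cexp (jones F) c))).
Proof.
have tD : {morph t : u v / u + v} := scalD tL.
pose s (c : Defs.total (jones F)) := t (cexp F (jones_cexp c)).
have sD : {morph s : u v / u + v} by move=> u v; rewrite /s !linearD tD.
have s0 : s 0 = 0 by rewrite /s !linear0 (scal0 tL).
move=> g h; rewrite -[LHS]/(s (g * h)) -[RHS]/(s (h * g)).
elim/(@jones_ind k F): g => [|u v IHu IHv|a b]; first by rewrite mul0r mulr0.
  by rewrite mulrDl mulrDr !sD IHu IHv.
elim/(@jones_ind k F): h => [|u v IHu IHv|c d]; first by rewrite mul0r mulr0.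
  by rewrite mulrDl mulrDr !sD IHu IHv.
rewrite -[jtens a b * _]/(jones_mul _ _) -[jtens c d * _]/(jones_mul _ _) !jones_mulE /s !jones_cexpE.
rewrite !linearZ /= !(scalZ tL); congr (_ * _).
have E p q r : t (cexp F (p * Defs.incl F q * r)) = t (cexp F (r * p) * q).
  by rewrite (tEC (p * Defs.incl F q) r) mulrA cexpr.
by rewrite !E tC.
Qed.
End JonesTrace.

(** * The tower N < M < M1 < M2 *)

Section Tower.
Variables (k : fieldType) (N M M1 M2 : algType k).
Variables (i0 : {lrmorphism N -> M}) (i1 : {lrmorphism M -> M1}) (i2 : {lrmorphism M1 -> M2}).
Variables (E0 : {linear M -> N}) (E1 : {linear M1 -> M}) (E2 : {linear M2 -> M1}).
Variables (e1 : M1) (e2 : M2) (l : k) (n n' : nat) (x y : 'I_n -> M) (x' y' : 'I_n' -> M1).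
Hypothesis BC1 : basic_construction i0 E0 i1 E1 e1 l x y.
Hypothesis BC2 : basic_construction i1 E1 i2 E2 e2 l x' y'.

Local Notation U := (centr i0).
Local Notation V := (centr i1).
Local Notation A := (centr (fun n => i1 (i0 n))).
Local Notation B := (centr (fun m => i2 (i1 m))).
(* C is the centralizer of N in M2; it contains both A and B. *)
Local Notation inC := (centr_pred (fun n => i2 (i1 (i0 n)))).
Local Notation d := (i2 e1).

Variable tau : M2 -> k.
Hypothesis tauL : scalar tau.
Hypothesis tauC : is_trace tau.
Hypothesis tauE2 : forall c, tau (i2 (E2 c)) = tau c.
Hypothesis tauE1 : forall q, tau (i2 (i1 (E1 q))) = tau (i2 q).
(* Either form of the symmetry condition on the dual bases of E0 implies this. *)
Hypothesis tau_index : forall u : U,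
  tau (i2 (i1 (\sum_j x j * val u * y j))) = l^-1 * tau (i2 (i1 (val u))).

Let l0 : l != 0 := bc_l BC1.
Let tauZ c a : tau (c *: a) = c * tau a := scalZ tauL c a.
Let tauS I (r : seq I) (F : I -> M2) : tau (\sum_(i <- r) F i) = \sum_(i <- r) tau (F i) :=
  scal_sum tauL r F.

(** ** Centralizers *)

Lemma A_comm (a : A) z : val a * i1 (i0 z) = i1 (i0 z) * val a.
Proof. exact: centr_comm. Qed.
Lemma B_comm (b : B) m : val b * i2 (i1 m) = i2 (i1 m) * val b.
Proof. exact: centr_comm. Qed.
Lemma V_comm (v : V) m : val v * i1 m = i1 m * val v.
Proof. exact: centr_comm. Qed.

Lemma inC_A (a : A) : i2 (val a) \in inC.
Proof. by apply/centrP => z; rewrite -!rmorphM A_comm. Qed.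
Lemma inC_B (b : B) : val b \in inC.
Proof. by apply/centrP => z; rewrite B_comm. Qed.
Lemma inC_V (v : V) : i2 (val v) \in inC.
Proof. by apply/centrP => z; rewrite -!rmorphM V_comm. Qed.

Lemma e1_A : e1 \in centr_pred (fun n => i1 (i0 n)).
Proof. by apply/centrP => z; rewrite (bc_comm BC1). Qed.
Lemma e2_B : e2 \in centr_pred (fun m => i2 (i1 m)).
Proof. by apply/centrP => z; rewrite (bc_comm BC2). Qed.

Definition eA : A := Sub e1 e1_A.
Definition eB : B := Sub e2 e2_B.

Lemma inC_d : d \in inC. Proof. exact: (inC_A eA). Qed.
Lemma inC_e2 : e2 \in inC. Proof. exact: (inC_B eB). Qed.

Lemma VA_subproof (v : V) : val v \in centr_pred (fun n => i1 (i0 n)).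
Proof. by apply/centrP => z; rewrite V_comm. Qed.
Definition VA (v : V) : A := Sub (val v) (VA_subproof v).

Lemma VB_subproof (v : V) : i2 (val v) \in centr_pred (fun m => i2 (i1 m)).
Proof. by apply/centrP => z; rewrite -!rmorphM V_comm. Qed.
Definition VB (v : V) : B := Sub (i2 (val v)) (VB_subproof v).

Lemma UA_subproof (u : U) : i1 (val u) \in centr_pred (fun n => i1 (i0 n)).
Proof. by apply/centrP => z; rewrite -!rmorphM centr_comm. Qed.
Definition UA (u : U) : A := Sub (i1 (val u)) (UA_subproof u).

Lemma E2_A c : c \in inC -> E2 c \in centr_pred (fun n => i1 (i0 n)).
Proof. by move=> /centrP cP; apply/centrP => z; rewrite -(bc_E'r BC2) cP (bc_E'l BC2). Qed.

Lemma E2_V (b : B) : E2 (val b) \in centr_pred i1.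
Proof. by apply/centrP => z; rewrite -(bc_E'r BC2) B_comm (bc_E'l BC2). Qed.

Lemma E1_U (a : A) : E1 (val a) \in centr_pred i0.
Proof. by apply/centrP => z; rewrite -(bc_E'r BC1) A_comm (bc_E'l BC1). Qed.

(** ** The expectation onto B *)

(** The conditional expectation onto B.  It exchanges the roles of e1 and e2: on the
commutant of N, e1 is to EB what e2 is to E2. *)
Definition EB (c : M2) : M2 := l *: \sum_j i2 (i1 (x j)) * c * i2 (i1 (y j)).

Lemma EB_linear : linear EB.
Proof.
move=> c a b; rewrite /EB scalerA mulrC -scalerA -scalerDr; congr (_ *: _).
rewrite scaler_sumr -big_split; apply: eq_bigr => j _.
by rewrite mulrDr mulrDl -scalerAr -scalerAl.
Qed.

Lemma EB_B c : c \in inC -> EB c \in centr_pred (fun m => i2 (i1 m)).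
Proof.
move=> /centrP cP; apply/centrP => m; rewrite -scalerAl -scalerAr; congr (_ *: _).
exact: (casimir_comm BC1 (h := i2 \o i1)).
Qed.

Lemma EB_mull (b : B) c : EB (val b * c) = val b * EB c.
Proof.
rewrite -scalerAr mulr_sumr; congr (_ *: _); apply: eq_bigr => j _.
by rewrite mulrA -B_comm !mulrA.
Qed.

Lemma EB_mulr (b : B) c : EB (c * val b) = EB c * val b.
Proof.
rewrite -scalerAl mulr_suml; congr (_ *: _); apply: eq_bigr => j _.
by rewrite -!mulrA B_comm.
Qed.

Lemma EB_d : EB d = l *: 1.
Proof.
rewrite /EB -[X in _ = _ *: X](rmorph1 i2) -(bc_one BC1) rmorph_sum; congr (_ *: _).
by apply: eq_bigr => j _; rewrite !rmorphM.
Qed.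

Lemma EB_pushr c : c \in inC -> d * EB (d * c) = l *: (d * c).
Proof.
move=> /centrP cP; rewrite -scalerAr; congr (_ *: _); rewrite mulr_sumr.
transitivity (d * c * i2 (i1 (\sum_j i0 (E0 (x j)) * y j))).
  rewrite !rmorph_sum mulr_sumr; apply: eq_bigr => j _.
  rewrite !mulrA -!rmorphM (bc_eqe BC1) -(bc_comm BC1) !rmorphM.
  by rewrite -[X in X * _]mulrA -cP !mulrA.
have := bc_dbl BC1 1; under eq_bigr do rewrite mul1r.
by move=> ->; rewrite !rmorph1 mulr1.
Qed.

Lemma EB_pushl c : c \in inC -> EB (c * d) * d = l *: (c * d).
Proof.
move=> /centrP cP; rewrite -scalerAl; congr (_ *: _); rewrite mulr_suml.
transitivity (i2 (i1 (\sum_j x j * i0 (E0 (y j)))) * (c * d)).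
  rewrite !rmorph_sum mulr_suml; apply: eq_bigr => j _.
  rewrite -!mulrA [d * (_ * d)]mulrA -!rmorphM (bc_eqe BC1) !rmorphM.
  by rewrite [c * (_ * _)]mulrA cP !mulrA.
have := bc_dbr BC1 1; under eq_bigr do rewrite mulr1.
by move=> ->; rewrite !rmorph1 mul1r.
Qed.

Lemma tauM q c : tau (i2 q * c) = tau (i2 (q * E2 c)).
Proof. by rewrite -tauE2 (bc_E'l BC2). Qed.
Lemma tauMr q c : tau (c * i2 q) = tau (i2 (E2 c * q)).
Proof. by rewrite -tauE2 (bc_E'r BC2). Qed.

(** After reduction to M by the trace, this is the symmetry condition on the dual bases. *)
Lemma tau_EB c : c \in inC -> tau (EB c) = tau c.
Proof.
move=> /centrP cP.
have uP : E1 (E2 c) \in centr_pred i0.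
  apply/centrP => z.
  by rewrite -(bc_E'r BC1) -(bc_E'r BC2) cP (bc_E'l BC2) (bc_E'l BC1).
have red m : tau (i2 (i1 m) * c) = tau (i2 (i1 (m * E1 (E2 c)))).
  by rewrite tauM -tauE1 (bc_E'l BC1).
rewrite tauZ tauS -[in RHS](mul1r c) -(rmorph1 i2) -(rmorph1 i1) red mul1r.
pose u : U := Sub (E1 (E2 c)) uP.
have := tau_index u; rewrite /= !rmorph_sum tauS => E.
transitivity (l * (l^-1 * tau (i2 (i1 (E1 (E2 c)))))); last by rewrite mulrA mulfV ?mul1r.
rewrite -E; congr (_ * _); apply: eq_bigr => j _.
by rewrite tauC mulrA -!rmorphM red -mulrA [i1 (y j * _)]rmorphM [i2 (_ * _)]rmorphM
  tauC -!rmorphM.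
Qed.

Lemma tau_B_EB (b : B) c : c \in inC -> tau (val b * EB c) = tau (val b * c).
Proof. by move=> cP; rewrite -EB_mull tau_EB // rpredM ?inC_B. Qed.

(** ** The trace on A, B and V *)

Variables (na nb : nat) (aj bj : 'I_na -> A) (uj vj : 'I_nb -> B).
Hypothesis abP : dual_bases i1 E1 (fun s => val (aj s)) (fun s => val (bj s)).
Hypothesis uvP : dual_bases i2 E2 (fun s => val (uj s)) (fun s => val (vj s)).
Variable rU : seq (U * U).
Hypothesis rUP : frobenius (fun u : U => tau (i2 (i1 (val u)))) rU.

Definition tauA (a : A) : k := tau (i2 (val a)).
Definition tauB (b : B) : k := tau (val b).
Definition tauV (v : V) : k := tau (i2 (val v)).

Lemma tauA_scalar : scalar tauA.
Proof. by move=> c a b; rewrite /tauA !linearP tauL. Qed.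
Lemma tauV_scalar : scalar tauV.
Proof. by move=> c a b; rewrite /tauV !linearP tauL. Qed.
Lemma tauA_trace : is_trace tauA.
Proof. by move=> a b; rewrite /tauA !rmorphM tauC. Qed.
Lemma tauB_trace : is_trace tauB.
Proof. by move=> a b; rewrite /tauB !rmorphM tauC. Qed.
Lemma tauV_trace : is_trace tauV.
Proof. by move=> a b; rewrite /tauV !rmorphM tauC. Qed.

Definition rA : seq (A * A) :=
  [seq (aj j * UA q.1, UA q.2 * bj j) | j <- enum 'I_na, q <- rU].

Lemma rA_frobenius : frobenius tauA rA.
Proof.
pose EU (a : A) : U := Sub (E1 (val a)) (E1_U a).
have := @frobenius_tower k U A UA EU na aj bj _ rU _ _ _ rUP.
rewrite -/rA => frob h.
rewrite -[RHS]frob; first by apply: eq_bigr => q _; rewrite /tauA -tauE1.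
- by move=> a; apply: val_inj; rewrite -[RHS](proj2 (abP (val a))) raddf_sum.
- by move=> c u v; apply: val_inj; rewrite /= !linearP.
- by move=> u a; apply: val_inj; rewrite /= (bc_E'l BC1).
Qed.

(** Nondegeneracy of the trace on A, for elements of M1 that merely lie in A. *)
Lemma A_nondeg m : m \in centr_pred (fun n => i1 (i0 n)) ->
  (forall a : A, tau (i2 (m * val a)) = 0) -> m = 0.
Proof.
move=> mP m0; pose a : A := Sub m mP.
have : a = 0 by apply: (frobenius_nondeg tauA_trace rA_frobenius) => b; rewrite /tauA -[RHS](m0 b).
by move/(congr1 val).
Qed.

Variables (f : V ⊗ V) (w z : V).
Hypothesis fP : symmetric_separability f.
Hypotheses (wz : w * z = 1) (zw : z * w = 1).
Hypothesis zE : z = sep_trace f tauV.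

Lemma z_central (v : V) : v * z = z * v.
Proof. by rewrite zE; exact: (sep_trace_central fP tauV_scalar tauV_trace). Qed.

Lemma w_central (v : V) : v * w = w * v.
Proof.
by rewrite -[LHS]mul1r -wz -mulrA [z * _]mulrA -z_central -!mulrA zw mulr1.
Qed.

Definition rB : seq (B * B) :=
  [seq (uj j * VB q.1, VB q.2 * vj j) | j <- enum 'I_nb, q <- [seq (q.1, q.2 * w) | q <- repr f]].

(** Dual bases of the trace on V are f1 and f2 w. *)
Lemma rB_frobenius : frobenius tauB rB.
Proof.
pose EV (b : B) : V := Sub (E2 (val b)) (E2_V b).
have fr : frobenius tauV [seq (q.1, q.2 * w) | q <- repr f].
  by apply: (sep_frobenius fP tauV_scalar tauV_trace); rewrite -zE.
have := @frobenius_tower k V B VB EV nb uj vj _ _ _ _ _ fr.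
rewrite -/rB => frob h.
rewrite -[RHS]frob; first by apply: eq_bigr => q _; rewrite /tauB -tauE2.
- by move=> a; apply: val_inj; rewrite -[RHS](proj2 (uvP (val a))) raddf_sum.
- by move=> c u v; apply: val_inj; rewrite /= !linearP.
- by move=> u a; apply: val_inj; rewrite /= (bc_E'l BC2).
Qed.

(** The dual bases for the trace on B are f-weighted dual bases of E2, and removing the
weight w leaves f1 f2 = 1. *)
Lemma rB_expand (c : M2) : \sum_(q <- rB) i2 (E2 (c * val q.1) * val z) * val q.2 = c.
Proof.
rewrite /rB big_flatten big_map big_enum /= -[RHS](proj1 (uvP c)).
apply: eq_bigr => j _; rewrite big_map /= big_map /=.
transitivity (i2 (E2 (c * val (uj j)) * val (sweedler (fun a b => a * b) f)) * val (vj j)).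
  rewrite sweedlerE raddf_sum mulr_sumr rmorph_sum mulr_suml.
  have zqw (v : V) : i2 (val z) * (i2 (val v) * i2 (val w)) = i2 (val v).
    by rewrite -!rmorphM mulrA -z_central -mulrA zw mulr1.
  apply: eq_bigr => q _; rewrite !rmorphM /= [c * (_ * _)]mulrA (bc_E'r BC2) rmorphM.
  by rewrite -[i2 (sval q.2) in RHS]zqw !mulrA.
by rewrite sep_mul // rmorph1 mulr1.
Qed.

(** ** The action of M2 on M1 *)

(** The action of M2 = End(M1 as a right M-module) on M1, with e2 acting as E1. *)
Definition act (b : M2) (m : M1) : M1 := l^-1 *: E2 (b * i2 m * e2).

Lemma act_linearl m : linear (act^~ m).
Proof.
by move=> c a b; rewrite /act !mulrDl -!scalerAl !linearP.
Qed.

Lemma act_linearr b : linear (act b).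
Proof.
by move=> c u v; rewrite /act linearP mulrDr mulrDl -scalerAr -scalerAl !linearP.
Qed.

(** An element of M2 is determined on M1 e2 by its action. *)
Lemma act_push b m : i2 (act b m) * e2 = b * i2 m * e2.
Proof.
by rewrite linearZ -scalerAl /= (bc_pushl BC2) scalerA mulVf // scale1r.
Qed.

Lemma actM b b' m : act (b * b') m = act b (act b' m).
Proof.
rewrite [in RHS]/act -[b * _ * _]mulrA act_push.
by rewrite /act !mulrA.
Qed.

Lemma act_i2 q m : act (i2 q) m = q * m.
Proof.
rewrite /act -mulrA (bc_E'l BC2) (bc_E'l BC2) (bc_E'e BC2) scalerAr -!scalerAr mulr1 scalerA.
by rewrite mulVf // scale1r.
Qed.

Lemma actVB v m : act (val (VB v)) m = val v * m.
Proof. exact: act_i2. Qed.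

Lemma act1 m : act 1 m = m.
Proof. by rewrite -[1](rmorph1 i2) act_i2 mul1r. Qed.

Lemma act_mull (b : B) m q : act (val b) (i1 m * q) = i1 m * act (val b) q.
Proof.
by rewrite /act rmorphM mulrA B_comm -!mulrA (bc_E'l BC2) scalerAr.
Qed.

Lemma act_mulr b m q : act b (q * i1 m) = act b q * i1 m.
Proof.
by rewrite /act rmorphM -!mulrA -(bc_comm BC2) !mulrA (bc_E'r BC2) scalerAl.
Qed.

Lemma act_A (b : B) a : a \in centr_pred (fun n => i1 (i0 n)) ->
  act (val b) a \in centr_pred (fun n => i1 (i0 n)).
Proof. by move=> /centrP aP; apply/centrP => p; rewrite -act_mulr aP act_mull. Qed.

Definition actA (b : B) (a : A) : A := Sub (act (val b) (val a)) (act_A b (valP a)).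

Lemma act_V (b : B) v : v \in centr_pred i1 -> act (val b) v \in centr_pred i1.
Proof. by move=> /centrP aP; apply/centrP => p; rewrite -act_mulr aP act_mull. Qed.

Definition actV (b : B) (v : V) : V := Sub (act (val b) (val v)) (act_V b (valP v)).

(** Because 1 lies in M1 e2 M1. *)
Lemma act_faithful b b' : (forall m, act b m = act b' m) -> b = b'.
Proof.
move=> E; rewrite -[b]mulr1 -[b']mulr1 -(bc_one BC2) !mulr_sumr; apply: eq_bigr => j _.
by rewrite !mulrA -!act_push E.
Qed.

(** Right linearity realizes g by sum_j g(x'_j) e2 y'_j, and left linearity makes this
element commute with M, by faithfulness. *)
Lemma bimodule_act (g : M1 -> M1) : {morph g : u v / u + v} ->
  (forall m q, g (i1 m * q) = i1 m * g q) -> (forall m q, g (q * i1 m) = g q * i1 m) ->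
  exists b : B, forall q, act (val b) q = g q.
Proof.
move=> gD gl gr; pose c := \sum_j i2 (g (x' j)) * e2 * i2 (y' j).
have g0 : g 0 = 0 by apply: (addrI (g 0)); rewrite -gD !addr0.
have cE q : act c q = g q.
  rewrite -[in RHS](bc_dbr BC2 q) (big_morph g gD g0) /act !mulr_suml linear_sum /= scaler_sumr.
  apply: eq_bigr => j _; rewrite gr.
  rewrite -!mulrA [i2 (y' j) * _]mulrA -rmorphM [e2 * _]mulrA (bc_eqe BC2).
  rewrite !(bc_E'l BC2) (bc_E'e BC2) -!scalerAr mulr1 scalerA mulVf //.
  by rewrite scale1r.
have cP : c \in centr_pred (fun m => i2 (i1 m)).
  apply/centrP => m; apply: act_faithful => q.
  by rewrite !actM !act_i2 !cE gl.
by exists (Sub c cP).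
Qed.

Lemma d_e2_d : d * e2 * d = l *: d.
Proof.
apply: act_faithful => m; rewrite !actM -[l *: d]linearZ /= !act_i2.
have -> : act e2 (e1 * m) = i1 (E1 (e1 * m)).
  by rewrite /act (bc_eqe BC2) (bc_E'l BC2) (bc_E'e BC2) -scalerAr mulr1 scalerA mulVf // scale1r.
by rewrite (bc_pushr BC1) scalerAl.
Qed.

Lemma e2_d_e2 : e2 * d * e2 = l *: e2.
Proof.
by rewrite (bc_eqe BC2) (bc_E'e BC1) !linearZ /= !rmorph1 -scalerAl mul1r.
Qed.

(** From b |> e1 = 0 follows b e1 e2 = 0, then b e1 = 0 by e1 e2 e1 = lam e1, and b = 0
by applying EB, as EB(e1) = lam. *)
Lemma act_e1_inj (b : B) : act (val b) e1 = 0 -> b = 0.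
Proof.
move=> b0; have bd0 : val b * d = 0.
  have := act_push (val b) e1; rewrite b0 rmorph0 mul0r => /(congr1 (fun c => c * d)).
  rewrite mul0r -!mulrA [d * _]mulrA d_e2_d -scalerAr => /esym/eqP.
  by rewrite scaler_eq0 (negPf l0) => /eqP.
apply: val_inj; apply/eqP; rewrite /= -[_ == _]orFb -(negPf l0) -scaler_eq0; apply/eqP.
by rewrite -[sval b]mulr1 scalerAr -EB_d -EB_mull bd0 /EB big1 ?scaler0 // => j _; rewrite mulr0 mul0r.
Qed.

(** ** The pairing *)

Local Notation W := (i2 (val w)).
Local Notation Z := (i2 (val z)).

Lemma WZ : W * Z = 1.
Proof. by rewrite -!rmorphM wz !rmorph1. Qed.
Lemma ZW : Z * W = 1.
Proof. by rewrite -!rmorphM zw !rmorph1. Qed.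

Definition pair (a : A) (b : B) : k := l ^- 2 * tau (i2 (val a) * e2 * d * W * val b).
Definition pair' (a : A) (b : B) : k := l ^- 2 * tau (val b * d * e2 * W * i2 (val a)).

(** The counit of A, extended to M1. *)
Definition epsA (m : M1) : k := l^-1 * tau (i2 (m * e1 * val w)).

Lemma epsA_scalar : scalar epsA.
Proof.
move=> c u v; rewrite /epsA !mulrDl -!scalerAl linearP tauL mulrDr.
by rewrite mulrCA.
Qed.

Lemma pair_act a b : pair a b = epsA (act (val b) (val a)).
Proof.
rewrite /pair /epsA /act -!scalerAl linearZ /= tauZ mulrA -invfM -expr2; congr (_ * _).
by rewrite -[E2 _ * _ * _]mulrA -tauMr rmorphM -!mulrA [RHS]tauC !mulrA.
Qed.

Lemma tau_e2 p q : tau (i2 p * e2 * i2 q) = l * tau (i2 (p * q)).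
Proof. by rewrite -mulrA tauM (bc_E'r BC2) (bc_E'e BC2) -scalerAl mul1r -scalerAr linearZ /= tauZ. Qed.

Lemma pair_linl b : scalar (pair^~ b).
Proof.
by move=> c u v; rewrite /pair !linearP !mulrDl -!scalerAl tauL mulrDr mulrCA.
Qed.

Lemma pair_linr a : scalar (pair a).
Proof.
by move=> c u v; rewrite /pair linearP !mulrDr -!scalerAr tauL mulrDr mulrCA.
Qed.

Lemma pair'_linl b : scalar (pair'^~ b).
Proof.
by move=> c u v; rewrite /pair' !linearP !mulrDr -!scalerAr tauL mulrDr mulrCA.
Qed.

Lemma pair'_linr a : scalar (pair' a).
Proof.
by move=> c u v; rewrite /pair' linearP !mulrDl -!scalerAl tauL mulrDr mulrCA.
Qed.

Definition EBs c (cP : c \in inC) : B := Sub (EB c) (EB_B cP).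

Lemma val_EBs c (cP : c \in inC) : val (EBs cP) = EB c. Proof. by []. Qed.
Lemma val_VB v : val (VB v) = i2 (val v). Proof. by []. Qed.

Lemma inC_beta (t : A) : d * (e2 * i2 (val t)) \in inC.
Proof. by rewrite !rpredM ?inC_d ?inC_e2 ?inC_A. Qed.
Lemma inC_beta' (t : A) : i2 (val t) * Z * e2 * d \in inC.
Proof. by rewrite !rpredM ?inC_d ?inC_e2 ?inC_A ?inC_V. Qed.

(** The element of B that represents the functional T(t -) on A.  It comes from solving
e2 e1 w b = lam e2 t for b with the help of EB. *)
Definition beta (t : A) : B := l^-1 *: (VB z * EBs (inC_beta t)).
Definition beta' (t : A) : B := l^-1 *: EBs (inC_beta' t).

Let l2K a : l ^- 2 * (l * (l * a)) = a.
Proof. by rewrite [l * (l * a)]mulrA -expr2 mulrA mulVf ?expf_neq0 // mul1r. Qed.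

Lemma val_beta t : val (beta t) = l^-1 *: (Z * EB (d * (e2 * i2 (val t)))).
Proof. by []. Qed.
Lemma val_beta' t : val (beta' t) = l^-1 *: EB (i2 (val t) * Z * e2 * d).
Proof. by []. Qed.

Lemma pair_beta a t : pair a (beta t) = tauA (t * a).
Proof.
have Wb : W * val (beta t) = l^-1 *: EB (d * (e2 * i2 (val t))).
  by rewrite val_beta -scalerAr [W * _]mulrA WZ mul1r.
have dWb : d * (W * val (beta t)) = d * (e2 * i2 (val t)).
  rewrite Wb -scalerAr EB_pushr ?rpredM ?inC_e2 ?inC_A // scalerA mulVf ?scale1r //.
rewrite /pair -!mulrA dWb !mulrA -[_ * e2 * d]mulrA -[_ * (e2 * d) * e2]mulrA e2_d_e2.
by rewrite -scalerAr -scalerAl tauZ tau_e2 l2K /tauA rmorphM tauC -!rmorphM.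
Qed.

Lemma pair'_beta' a t : pair' a (beta' t) = tauA (t * a).
Proof.
have bd : val (beta' t) * d = i2 (val t) * Z * e2 * d.
  rewrite val_beta' -scalerAl EB_pushl ?rpredM ?inC_e2 ?inC_A ?inC_V //.
  by rewrite scalerA mulVf ?scale1r.
rewrite /pair' bd -!mulrA [d * (e2 * _)]mulrA [e2 * (d * e2 * _)]mulrA [e2 * (d * e2)]mulrA.
rewrite e2_d_e2 -scalerAl -!scalerAr tauZ [i2 (val t) * _]mulrA -!rmorphM.
rewrite [i2 _ * (e2 * _)]mulrA tau_e2 l2K -mulrA [val z * _]mulrA.
by rewrite -[val z * val w]rmorphM zw rmorph1 mul1r /tauA rmorphM.
Qed.

Lemma tau_A_inj c : c \in inC -> (forall a : A, tau (i2 (val a) * c) = 0) -> E2 c = 0.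
Proof.
move=> cP c0; apply: A_nondeg => [|a]; first exact: E2_A.
by rewrite -tauMr tauC.
Qed.

(** Vanishing of <a, b> for all a gives E2(e2 e1 w b) = 0, hence e2 e1 w b = 0; now e2,
e1 and w are removed one after the other. *)
Lemma pair_inj b b' : (forall a, pair a b = pair a b') -> b = b'.
Proof.
move=> E; apply/eqP; rewrite -subr_eq0; apply/eqP; set b0 := b - b'.
have {E} pb0 a : pair a b0 = 0.
  by rewrite /b0 addrC -scaleN1r (pair_linr a) mulN1r E addNr.
have c0 : E2 (e2 * d * W * val b0) = 0.
  apply: tau_A_inj => [|a]; first by rewrite !rpredM ?inC_e2 ?inC_d ?inC_V ?inC_B.
  have /eqP := pb0 a; rewrite /pair mulf_eq0 invr_eq0 expf_eq0 (negPf l0) /= => /eqP <-.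
  by rewrite !mulrA.
have dWb0 : d * (W * val b0) = 0.
  have /eqP := bc_pushr BC2 (d * W * val b0).
  rewrite !mulrA c0 rmorph0 mulr0 eq_sym scaler_eq0 (negPf l0) /= => /eqP cc0.
  have : d * (e2 * d * W * val b0) = 0 by rewrite cc0 mulr0.
  rewrite !mulrA d_e2_d -!scalerAl => /eqP; rewrite scaler_eq0 (negPf l0) /= => /eqP.
  by rewrite -mulrA.
have : EB (d * (W * val b0)) = 0 by rewrite dWb0 (lin0 EB_linear).
rewrite mulrA EB_mulr (EB_mulr (VB w)) EB_d -scalerAl mul1r -scalerAl => /eqP.
rewrite scaler_eq0 (negPf l0) /= => /eqP Wb0.
by apply: val_inj; rewrite -[val b0]mul1r -ZW -mulrA Wb0 mulr0 linear0.
Qed.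

Lemma pair'_inj b b' : (forall a, pair' a b = pair' a b') -> b = b'.
Proof.
move=> E; apply/eqP; rewrite -subr_eq0; apply/eqP; set b0 := b - b'.
have {E} pb0 a : pair' a b0 = 0.
  by rewrite /b0 addrC -scaleN1r (pair'_linr a) mulN1r E addNr.
apply: act_e1_inj; rewrite /act.
have c0 : E2 (val b0 * d * e2 * W) = 0.
  apply: tau_A_inj => [|a]; first by rewrite !rpredM ?inC_e2 ?inC_d ?inC_V ?inC_B.
  have /eqP := pb0 a; rewrite /pair' mulf_eq0 invr_eq0 expf_eq0 (negPf l0) /= => /eqP <-.
  by rewrite tauC.
by rewrite -[val b0 * d * e2]mulr1 -WZ mulrA (bc_E'r BC2) c0 mul0r scaler0.
Qed.

Definition rAB : seq (A * B) := [seq (q.1, beta q.2) | q <- rA].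

Lemma pair_perfect : perfect pair rAB.
Proof.
have pX a : \sum_(q <- rAB) pair a q.2 *: q.1 = a.
  rewrite big_map -[RHS](rA_frobenius a); apply: eq_bigr => q _ /=.
  by rewrite pair_beta.
split=> //; [exact: pair_linl | exact: pair_linr |] => b.
apply: pair_inj => a; rewrite (scal_sum (pair_linr a)) -[in RHS](pX a) (scal_sum (pair_linl b)).
by apply: eq_bigr => q _; rewrite (scalZ (pair_linr a)) (scalZ (pair_linl b)) mulrC.
Qed.

Let i2M p q : i2 (p * q) = i2 p * i2 q. Proof. exact: rmorphM. Qed.
Let i2Z c p : i2 (c *: p) = c *: i2 p. Proof. exact: linearZ. Qed.
Let vAM (a b : A) : val (a * b) = val a * val b. Proof. by []. Qed.
Let vBM (a b : B) : val (a * b) = val a * val b. Proof. by []. Qed.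
Let vVM (a b : V) : val (a * b) = val a * val b. Proof. by []. Qed.

(** ** Bimodule endomorphisms of M1 *)

Lemma phi1_ex (v : V) : exists b : B, forall q, act (val b) q = q * val v.
Proof.
apply: bimodule_act => [p q|m q|m q]; first by rewrite mulrDl.
  by rewrite mulrA.
by rewrite -mulrA -V_comm mulrA.
Qed.

(** The anti-isomorphism of V onto the centralizer of M1 in M2. *)
Definition phi1 (v : V) : B := sval (cid (phi1_ex v)).
Lemma act_phi1 v q : act (val (phi1 v)) q = q * val v.
Proof. by rewrite /phi1; case: cid => b /= ->. Qed.

Lemma rho_ex (b s : B) : exists c : B, forall q, act (val c) q = E2 (val b * i2 q * val s) * val z.
Proof.
apply: bimodule_act => [p q|m q|m q].
- by rewrite linearD mulrDr mulrDl linearD mulrDl.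
- by rewrite rmorphM mulrA B_comm -!mulrA (bc_E'l BC2) !mulrA.
by rewrite rmorphM -!mulrA -B_comm !mulrA (bc_E'r BC2) -!mulrA V_comm.
Qed.

(** The first leg of the comultiplication of b that belongs to the second leg t, when s
and t are dual basis elements of B. *)
Definition rho (b s : B) : B := sval (cid (rho_ex b s)).
Lemma act_rho b s q : act (val (rho b s)) q = E2 (val b * i2 q * val s) * val z.
Proof. by rewrite /rho; case: cid => c /= ->. Qed.

Lemma actB_linear m : linear (fun b : B => act (val b) m).
Proof. by move=> c a b; rewrite linearP act_linearl. Qed.

Lemma actB_inj (b b' : B) : (forall m, act (val b) m = act (val b') m) -> b = b'.
Proof. by move=> E; apply: val_inj; apply: act_faithful. Qed.

(** ** Formulas with the separability element *)

Definition EV c (cP : c \in inC) : V := Sub (E2 (EB c)) (E2_V (EBs cP)).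

(** T(f2 c) only depends on the expectation of c in V, on which f1 T(f2 -) is
multiplication by z. *)
Lemma sep_tau c (cP : c \in inC) :
  sweedler (fun f1 f2 => tau (i2 (val f2) * c) *: f1) f = EV cP * z.
Proof.
rewrite zE -(sep_traceE fP tauV_scalar); apply: eq_sweedler => a b.
have -> : tauV (b * EV cP) = tau (i2 (val b * E2 (EB c))) by [].
by rewrite -tauM -val_VB tau_B_EB.
Qed.

Lemma E2_i2 q : E2 (i2 q) = q.
Proof. by rewrite -[i2 q]mulr1 (bc_E'l BC2) (bc_E'1 BC2) mulr1. Qed.

Lemma EB_i2 m : i2 (E2 (EB (i2 m))) = EB (i2 m).
Proof.
have -> : EB (i2 m) = i2 (l *: \sum_j i1 (x j) * m * i1 (y j)).
  rewrite linearZ rmorph_sum; congr (_ *: _); apply: eq_bigr => j _.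
  by rewrite !rmorphM.
by rewrite E2_i2.
Qed.

(** The sum over f turns eps(f2 a) into the element EB(a e1) of V, up to normalization,
and EB(a e1) e1 = lam a e1. *)
Lemma epsA_sep m a : a \in centr_pred (fun n => i1 (i0 n)) ->
  sweedler (fun f1 f2 => epsA (m * val f1) * epsA (val f2 * a)) f = epsA (m * a).
Proof.
move=> aP; pose a' : A := Sub a aP.
have cP : i2 (a * e1 * val w) \in inC.
  by apply: (inC_A (a' * eA * VA w)).
have epsL : scalar (fun v : V => epsA (m * val v)).
  by move=> c u v; rewrite linearP mulrDr -scalerAr epsA_scalar.
transitivity (epsA (m * val (l^-1 *: (EV cP * z)))).
  rewrite -sep_tau [in RHS](sweedler_lin (h := *:%R l^-1)); last first.
    by move=> c u v; rewrite scalerDr !scalerA mulrC.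
  rewrite (sweedler_scal _ _ epsL); apply: eq_sweedler => u v.
  by rewrite scalerA (scalZ epsL) mulrC /epsA -rmorphM !mulrA.
have -> : val (l^-1 *: (EV cP * z)) = l^-1 *: (E2 (EB (i2 (a * e1 * val w))) * val z) by [].
have iX : i2 (E2 (EB (i2 (a * e1 * val w)))) = EB (i2 a * d) * W.
  by rewrite EB_i2 !i2M (EB_mulr (VB w)).
move: iX; set X := E2 _ => iX.
rewrite -scalerAr (scalZ epsA_scalar) /epsA !i2M iX.
rewrite -!mulrA [W * (Z * _)]mulrA WZ mul1r.
rewrite [EB _ * _]mulrA EB_pushl ?(inC_A a') // -scalerAl -scalerAr tauZ.
by rewrite [l^-1 * (l * _)]mulrA mulVf // mul1r !mulrA.
Qed.

Lemma pair_phi1 a b v : pair a (phi1 v * b) = epsA (act (val b) (val a) * val v).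
Proof. by rewrite pair_act vBM actM act_phi1. Qed.

Lemma pair_VB a b v : pair a (VB v * b) = epsA (val v * act (val b) (val a)).
Proof. by rewrite pair_act vBM actM actVB. Qed.

(** ** Existence of the structure *)

(** S is the transition between the two pairings, both of which are perfect. *)
Lemma antipode_exists : exists2 S : {linear B -> B}, bijective S &
  forall a b, pair a b = pair' a (S b).
Proof.
pose S b := \sum_(q <- rA) pair q.1 b *: beta' q.2.
pose S' b := \sum_(q <- rAB) pair' q.1 b *: q.2.
have SL : linear S.
  move=> c u v; rewrite scaler_sumr -big_split; apply: eq_bigr => i _.
  by rewrite pair_linr scalerDl -scalerA.
have SP a b : pair a b = pair' a (S b).
  rewrite (scal_sum (pair'_linr a)) -[in LHS](rA_frobenius a) (scal_sum (pair_linl b)).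
  apply: eq_bigr => q _.
  by rewrite (scalZ (pair'_linr a)) (scalZ (pair_linl b)) pair'_beta' mulrC.
have S'P a b : pair a (S' b) = pair' a b.
  rewrite (scal_sum (pair_linr a)) -[in RHS](perfX pair_perfect a) (scal_sum (pair'_linl b)).
  apply: eq_bigr => q _.
  by rewrite (scalZ (pair_linr a)) (scalZ (pair'_linl b)) mulrC.
have [T TE] := linear_bundle SL; exists T => [|a b]; last by rewrite TE.
exists S' => b; rewrite TE.
  by apply: pair_inj => a; rewrite S'P -SP.
by apply: pair'_inj => a; rewrite -SP S'P.
Qed.

Lemma duality_exists : exists (DB : {linear B -> (B ⊗ B)%type}) (SB : {linear B -> B})
    (DA : {linear A -> (A ⊗ A)%type}) (SA : {linear A -> A}),
  [/\ forall a1 a2 b, sweedler (fun b1 b2 => pair a1 b1 * pair a2 b2) (DB b) = pair (a1 * a2) b,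
      bijective SB,
      forall a b, pair a b = pair' a (SB b),
      forall a b1 b2, sweedler (fun a1 a2 => pair a1 b1 * pair a2 b2) (DA a) = pair a (b1 * b2)
    & forall a b, pair (SA a) b = pair a (SB b)].
Proof.
have [DB DBP] := transpose_mul pair_perfect.
have [DA DAP] := transpose_mul (perfect_flip pair_perfect).
have [SB SB_bij SBP] := antipode_exists.
have [SA SAP] := transpose_endo pair_perfect (@linearP _ _ _ _ SB).
by exists DB, SB, DA, SA.
Qed.

(** ** The comultiplication of B *)

Variable DB : B -> B ⊗ B.
Hypothesis DBP : forall a1 a2 b,
  sweedler (fun b1 b2 => pair a1 b1 * pair a2 b2) (DB b) = pair (a1 * a2) b.

Let ipair := fun (b : B) (a : A) => pair a b.
Let ipair_perfect : perfect ipair [seq (q.2, q.1) | q <- rAB] := perfect_flip pair_perfect.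

(** Paired with a and a', the sum over the dual bases contracts to T(b a EB(a' e2 e1) e1 w),
and e1 absorbs the expectation. *)
Lemma comul_formula b : DB b = \sum_(q <- rB) rho b q.1 ⊗ q.2.
Proof.
apply: (test2_ext ipair_perfect) => a a'.
rewrite /test2 DBP sweedler_sum_pure; last exact: (test2_bilin ipair_perfect).
have cP : i2 (val a') * e2 * d * W \in inC by rewrite !rpredM ?inC_A ?inC_e2 ?inC_d ?inC_V.
pose c' := EBs cP.
transitivity (l^-1 * (l ^- 2 * tau (val b * i2 (val a) * val c' * Z * d * W))).
  rewrite val_EBs (EB_mulr (VB w)) val_VB -!mulrA [W * (Z * _)]mulrA WZ mul1r.
  have dP : i2 (val a') * e2 \in inC by rewrite rpredM ?inC_A ?inC_e2.
  rewrite [i2 (val a') * (e2 * d)]mulrA [EB _ * _]mulrA EB_pushl // -scalerAl -!scalerAr tauZ.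
  rewrite mulrCA [l^-1 * (l * _)]mulrA mulVf // mul1r /pair vAM i2M.
  by rewrite [tau (val b * _)]tauC !mulrA.
have -> : val c' = \sum_(q <- rB) tauB (q.2 * c') *: val q.1.
  by rewrite -{1}(rB_frobenius c') raddf_sum; apply: eq_bigr => q _.
rewrite mulr_sumr !mulr_suml tauS !mulr_sumr.
apply: eq_bigr => q _; rewrite /ipair pair_act act_rho /epsA -!scalerAr -!scalerAl tauZ.
have -> : tauB (q.2 * c') = tau (i2 (val a') * e2 * d * W * val q.2).
  by rewrite /tauB vBM val_EBs tau_B_EB // tauC.
rewrite -[E2 _ * _ * _ * _]mulrA -[E2 _ * _ * _]mulrA -tauMr !i2M !mulrA /pair.
by rewrite -!mulrA; congr (_ * _); rewrite mulrA mulrC.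
Qed.

Lemma sweedler_comul (P : zmodType) (g : B -> B -> P) b : bilin g ->
  sweedler g (DB b) = \sum_(q <- rB) g (rho b q.1) q.2.
Proof. by move=> gP; rewrite comul_formula sweedler_sum_pure. Qed.

Lemma act_bilin m m' : bilin (fun b1 b2 : B => act (val b1) m * act (val b2) m').
Proof.
apply: bilin_of_linear => q c a b.
  by rewrite (actB_linear m) mulrDl scalerAl.
by rewrite (actB_linear m') mulrDr scalerAr.
Qed.

(** The module algebra property: rB_expand contracts the sum over the dual bases. *)
Lemma act_comul b m m' :
  sweedler (fun b1 b2 => act (val b1) m * act (val b2) m') (DB b) = act (val b) (m * m').
Proof.
rewrite (sweedler_comul _ (act_bilin m m')).
under eq_bigr do rewrite act_rho /act -scalerAr.
rewrite -scaler_sumr; congr (_ *: _).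
under eq_bigr do rewrite -(bc_E'l BC2).
rewrite -linear_sum; congr (E2 _) => /=.
rewrite i2M !mulrA -[in RHS](rB_expand (val b * i2 m)) !mulr_suml.
by apply: eq_bigr => q _; rewrite !mulrA.
Qed.

(** ** The antipode of B *)

Variable SB : B -> B.
Hypothesis SBL : linear SB.
Hypothesis SBP : forall a b, pair a b = pair' a (SB b).

(** The right-hand side is an M-M-bimodule map in m, hence the action of some S' in B;
comparing the two pairings at e1 gives S' = S(b). *)
Lemma act_SB b m :
  act (val (SB b)) m = l^-1 *: E2 (e2 * i2 (m * val w) * val b) * val z.
Proof.
have [q p|q p|q p|S' S'P] :=
  @bimodule_act (fun m => l^-1 *: E2 (e2 * i2 (m * val w) * val b) * val z).
- by rewrite !mulrDl linearD mulrDr mulrDl linearD scalerDr mulrDl.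
- rewrite -[i1 q * p * _]mulrA i2M [e2 * _]mulrA (bc_comm BC2) -!mulrA (bc_E'l BC2).
  by rewrite -!scalerAl -!scalerAr -!mulrA.
- rewrite -[p * _ * _]mulrA -V_comm [p * _]mulrA i2M -!mulrA -B_comm !mulrA (bc_E'r BC2).
  by rewrite -!scalerAl -!mulrA V_comm.
suff -> : SB b = S' by rewrite S'P.
apply: pair'_inj => a; rewrite -SBP /pair /pair'; congr (_ * _).
have E : E2 (val S' * d * e2) = E2 (e2 * i2 (e1 * val w) * val b) * val z.
  have := S'P e1; rewrite /act -scalerAl => /(congr1 (fun m => l *: m)).
  by rewrite !scalerA mulfV // !scale1r.
have zwa : val z * (val w * val a) = val a by rewrite mulrA -[val z * _]vVM zw mul1r.
rewrite -[_ * W * i2 _]mulrA -i2M tauMr E -[E2 _ * _ * _]mulrA zwa -tauMr i2M -!mulrA.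
by rewrite tauC -!mulrA.
Qed.

(** Up to w, the antipode is the adjoint of the action for the trace. *)
Lemma tau_SB b p q :
  tau (i2 (act (val (SB b)) p * q)) = tau (i2 (act (val b) (val z * q) * p * val w)).
Proof.
rewrite act_SB /act -!scalerAl !i2Z !tauZ; congr (_ * _).
rewrite -[E2 _ * _ * q]mulrA -tauMr -[E2 _ * p * _]mulrA -tauMr.
by rewrite -!mulrA tauC -!mulrA tauC -!mulrA.
Qed.

(** ** The weak Hopf algebra B *)

Lemma A_nondeg_eq p q : p \in centr_pred (fun n => i1 (i0 n)) ->
    q \in centr_pred (fun n => i1 (i0 n)) ->
  (forall a : A, tau (i2 (p * val a)) = tau (i2 (q * val a))) -> p = q.
Proof.
move=> pP qP E; apply/eqP; rewrite -subr_eq0; apply/eqP.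
apply: A_nondeg => [|a]; first by rewrite rpredB.
rewrite mulrBl raddfB -scaleN1r addrC tauL E mulN1r addNr //.
Qed.

(** An element of B is determined by its action on e1, and the result by its traces
against A. *)
Lemma B_test (b b' : B) :
  (forall a : A, tau (i2 (act (val b) e1 * val a)) = tau (i2 (act (val b') e1 * val a))) -> b = b'.
Proof.
move=> E; apply/eqP; rewrite -subr_eq0; apply/eqP; apply: act_e1_inj.
rewrite -scaleN1r addrC (actB_linear e1) scaleN1r addrC; apply/eqP; rewrite subr_eq0; apply/eqP.
by apply: A_nondeg_eq; rewrite ?act_A ?e1_A.
Qed.

Let tau_mul_scalar q : scalar (fun m => tau (i2 (m * q))).
Proof. by move=> c u v; rewrite mulrDl -scalerAl linearP tauL. Qed.

Let act_sum (g : B -> B -> B) (t : B ⊗ B) m :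
  act (val (sweedler g t)) m = sweedler (fun b1 b2 => act (val (g b1 b2)) m) t.
Proof. exact: (sweedler_lin _ _ (actB_linear m)). Qed.

Let val_sum_M1 (g : B -> B -> M1) (t : B ⊗ B) q :
  tau (i2 (sweedler g t * q)) = sweedler (fun b1 b2 => tau (i2 (g b1 b2 * q))) t.
Proof. exact: (sweedler_scal _ _ (tau_mul_scalar q)). Qed.

(** The target counital map of B; its values lie in V. *)
Definition counitV (b : B) : V := actV b 1.
(** The source counital map of B, pulled back to V along phi1. *)
Definition counitW (b : B) : V := Sub (E2 (val (l^-1 *: (eB * VB w * b)))) (E2_V _) * z.

(** The adjoint property of the antipode, followed by the module algebra property. *)
Lemma comul_act_SB b p q :
  sweedler (fun b1 b2 => tau (i2 (act (val (SB b1)) (act (val b2) p) * q))) (DB b) =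
  tau (i2 (act (val b) (val z * q * p) * val w)).
Proof.
under eq_sweedler do rewrite tau_SB.
by rewrite -act_comul val_sum_M1.
Qed.

Lemma antipode_right b : sweedler (fun b1 b2 => SB b1 * b2) (DB b) = phi1 (counitW b).
Proof.
apply: B_test => a; rewrite act_sum val_sum_M1.
under eq_sweedler do rewrite vBM actM.
rewrite comul_act_SB act_phi1.
have -> : val (counitW b) = l^-1 *: E2 (e2 * W * val b) * val z.
  by rewrite vVM /=; congr (_ * _); rewrite linearZ.
rewrite /act -!scalerAl -!scalerAr -!scalerAl !i2Z !tauZ; congr (_ * _).
rewrite -tauMr -[e1 * _ * _]mulrA [i2 (e1 * _)]i2M [tau (d * _)]tauC -i2M -!mulrA -tauMr.
by rewrite -!mulrA [RHS]tauC -!mulrA [RHS]tauC -!mulrA.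
Qed.

(** The comultiplication formula gives a sum over the dual bases (s, t) in which t
precedes s; after a flip of the dual bases rB_expand contracts it. *)
Lemma antipode_left b : sweedler (fun b1 b2 => b1 * SB b2) (DB b) = VB (counitV b).
Proof.
apply: actB_inj => m; rewrite act_sum actVB.
under eq_sweedler do rewrite vBM actM.
pose g (b1 b2 : B) := act (val b1) (act (val (SB b2)) m).
have gP : bilin g.
  apply: bilin_of_linear => q c a a'; rewrite /g; first by rewrite (actB_linear (act _ m)).
  by rewrite SBL (actB_linear m) act_linearr.
rewrite (sweedler_comul _ gP).
pose h (s t : B) := E2 (val b * i2 (act (val (SB t)) m) * val s) * val z.
have hP : bilin h.
  apply: bilin_of_linear => q c a a'; rewrite /h.
    by rewrite linearP mulrDr -scalerAr linearP mulrDl scalerAl.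
  by rewrite SBL (actB_linear m) linearP mulrDr mulrDl -scalerAr -scalerAl linearP mulrDl scalerAl.
transitivity (\sum_(q <- rB) h q.1 q.2); first by apply: eq_bigr => q _; rewrite /g act_rho.
(* the flip puts the dual basis elements in the order that rB_expand needs *)
rewrite -(frobenius_flip tauB_trace rB_frobenius hP) /h -mulr_suml -linear_sum /=.
have -> : \sum_(q <- rB) val b * i2 (act (val (SB q.1)) m) * val q.2 =
    l^-1 *: (val b * (e2 * i2 (m * val w))).
  rewrite -[X in val b * X](rB_expand (e2 * i2 (m * val w))) mulr_sumr scaler_sumr.
  apply: eq_bigr => q _; rewrite act_SB -scalerAl i2Z.
  by rewrite -scalerAr -scalerAl !mulrA.
rewrite linearZ mulrA (bc_E'r BC2) -scalerAl -[_ * (m * _) * _]mulrA -[m * _ * _]mulrA.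
by rewrite -[val w * val z]vVM wz rmorph1 mulr1 /act rmorph1 mulr1 scalerAl.
Qed.

(** On V the form eps(v -) is T(v w -), for which f1 and f2 are dual bases. *)
Lemma sep_epsA (v : V) : sweedler (fun f1 f2 => epsA (val v * val f1) *: f2) f = v.
Proof.
have cP : i2 (e1 * val w * val v) \in inC by exact: (inC_A (eA * VA w * VA v)).
have bil : bilin (fun f1 f2 : V => tau (i2 (val f2) * i2 (e1 * val w * val v)) *: f1).
  apply: (@bilin_scaler k V V (fun f2 => tau (i2 (val f2) * i2 (e1 * val w * val v)))).
  by move=> c a b; rewrite !linearP mulrDl -scalerAl tauL.
transitivity (l^-1 *: (EV cP * z)).
  rewrite -sep_tau -(sep_flip fP bil) [RHS](sweedler_lin (h := *:%R l^-1)); last first.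
    by move=> c a b; rewrite scalerDr !scalerA mulrC.
  apply: eq_sweedler => a b; rewrite scalerA /epsA -[i2 (val a) * _]i2M.
  rewrite -!mulrA [i2 (val v * _)]i2M tauC -i2M -!mulrA. reflexivity.
apply: val_inj.
have -> : val (l^-1 *: (EV cP * z)) = l^-1 *: (E2 (EB (i2 (e1 * val w * val v))) * val z) by [].
rewrite !i2M (EB_mulr (VB v)) (EB_mulr (VB w)) EB_d -!scalerAl mul1r -!i2M linearZ E2_i2.
rewrite -scalerAl scalerA mulVf // scale1r -[val w * val v]vVM -w_central vVM -mulrA.
by rewrite -[val w * val z]vVM wz rmorph1 mulr1.
Qed.

(** This is the identity epsA_sep read through the pairing. *)
Lemma comul_one : DB 1 = sweedler (fun f1 f2 => phi1 f1 ⊗ VB f2) f.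
Proof.
apply: (test2_ext ipair_perfect) => a a'.
transitivity (pair (a * a') 1); first exact: DBP.
rewrite (sweedler_scal _ _ (test2_scalar ipair_perfect a a')).
rewrite pair_act act1 vAM -epsA_sep; last exact: (valP a').
apply: eq_sweedler => f1 f2; rewrite (test2_pure ipair_perfect) /ipair.
by rewrite -[phi1 f1]mulr1 -[VB f2]mulr1 pair_phi1 pair_VB !act1.
Qed.

Lemma phi1_linear : linear phi1.
Proof.
move=> c u v; apply: actB_inj => m.
by rewrite (actB_linear m) !act_phi1 linearP mulrDr -scalerAr.
Qed.

Lemma VB_linear : linear VB.
Proof. by move=> c u v; apply: val_inj; rewrite linearP /= !linearP. Qed.

Lemma sweedler_comul_one (P : zmodType) (g : B -> B -> P) : bilin g ->
  sweedler g (DB 1) = sweedler (fun f1 f2 => g (phi1 f1) (VB f2)) f.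
Proof.
by move=> gP; rewrite comul_one (sweedler_sweedler_pure _ _ _ gP).
Qed.

Local Notation D := (HopfData *%R 1 DB (pair 1) SB).
Variables (DA : A -> A ⊗ A) (SA : A -> A).
Hypothesis DAP : forall a b1 b2,
  sweedler (fun a1 a2 => pair a1 b1 * pair a2 b2) (DA a) = pair a (b1 * b2).
Hypothesis SAP : forall a b, pair (SA a) b = pair a (SB b).
Local Notation D' := (HopfData *%R 1 DA (fun a => pair a 1) SA).

Lemma algA : is_algebra D'.
Proof.
split=> [g c u v|g c u v||g|g] /=.
- by rewrite mulrDr scalerAr.
- by rewrite mulrDl scalerAl.
- exact: mulrA.
- exact: mul1r.
- exact: mulr1.
Qed.

Lemma AB_hopf_pairing : hopf_pairing pair D' D.
Proof.
split=> //=.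
- by move=> a a' b; rewrite -DBP.
- by move=> a b b'; rewrite -DAP.
Qed.

Lemma coalgB : is_coalgebra D.
Proof.
apply: (dual_coalgebra ipair_perfect (DY := D')); last exact: algA.
split=> [b b' a|a|b a a'|b|b a] //=.
- exact/esym/DAP.
- exact/esym/DBP.
- exact/esym/SAP.
Qed.

Lemma algB : is_algebra D.
Proof.
split=> [g c u v|g c u v||g|g] /=.
- by rewrite mulrDr scalerAr.
- by rewrite mulrDl scalerAl.
- exact: mulrA.
- exact: mul1r.
- exact: mulr1.
Qed.

Lemma pair1 b : pair 1 b = epsA (act (val b) 1).
Proof. by rewrite pair_act rmorph1. Qed.

(** Both sides pair with a and a' to eps(g |> ((h_(1) |> a) (h_(2) |> a'))), by the module
algebra property. *)
Lemma B_comulM g h : DB (g * h) = tmul *%R *%R (DB g) (DB h).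
Proof.
apply: (test2_ext ipair_perfect) => a a'.
transitivity (pair (a * a') (g * h)); first exact: DBP.
rewrite /test2 (sweedler_tmul _ _ _ _ (test2_bilin ipair_perfect a a')).
rewrite exchange_sweedler pair_act vBM actM vAM -act_comul.
have eL : scalar (fun m => epsA (act (val g) m)).
  by move=> c u v; rewrite act_linearr epsA_scalar.
rewrite (sweedler_scal _ _ eL); apply: eq_sweedler => h1 h2.
rewrite -[act (val h1) _ * _]/(val (actA h1 a * actA h2 a')) -pair_act -DBP.
by apply: eq_sweedler => g1 g2; rewrite /ipair !pair_act !vBM !actM.
Qed.

(** Right multiplication of the argument by v is the action of phi1(v). *)
Lemma contract_right g v : sweedler (fun g1 g2 => pair (VA v) g2 *: g1) (DB g) = g * phi1 v.
Proof.
apply: pair_inj => a; rewrite (sweedler_scal _ _ (pair_linr a)).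
transitivity (pair (a * VA v) g).
  rewrite -DBP; apply: eq_sweedler => g1 g2.
  by rewrite (scalZ (pair_linr a)) mulrC.
by rewrite !pair_act vBM actM act_phi1.
Qed.

(** Left multiplication of the argument by v is the action of v. *)
Lemma contract_left g v : sweedler (fun g1 g2 => pair (VA v) g1 *: g2) (DB g) = g * VB v.
Proof.
apply: pair_inj => a; rewrite (sweedler_scal _ _ (pair_linr a)).
transitivity (pair (VA v * a) g).
  rewrite -DBP; apply: eq_sweedler => g1 g2.
  by rewrite (scalZ (pair_linr a)).
by rewrite !pair_act vBM actM actVB.
Qed.

Lemma pair1_act g h : pair 1 (g * h) = pair (VA (actV h 1)) g.
Proof. by rewrite !pair_act vBM actM rmorph1. Qed.

Let pair1_mull h : scalar (fun g => pair 1 (h * g)).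
Proof. by move=> c u v; rewrite mulrDr -scalerAr pair_linr. Qed.

(** With v = j |> 1, which lies in V, one has <1, g_(2) j> = <v, g_(2)>, and
g_(1) <v, g_(2)> = g phi1(v). *)
Lemma B_counitM h g j : pair 1 (h * g * j) =
  sweedler (fun g1 g2 => pair 1 (h * g1) * pair 1 (g2 * j)) (DB g).
Proof.
transitivity (pair 1 (h * (g * phi1 (actV j 1)))).
  by rewrite mulrA !pair1 !vBM !actM act_phi1 mul1r.
rewrite -contract_right (sweedler_scal _ _ (pair1_mull h)); apply: eq_sweedler => g1 g2.
by rewrite (scalZ (pair1_mull h)) [pair 1 (g2 * j)]pair1_act mulrC.
Qed.

Lemma B_counitM' h g j : pair 1 (h * g * j) =
  sweedler (fun g1 g2 => pair 1 (h * g2) * pair 1 (g1 * j)) (DB g).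
Proof.
transitivity (pair 1 (h * (g * VB (actV j 1)))).
  by rewrite mulrA !pair1 !vBM !actM actVB mulr1.
rewrite -contract_left (sweedler_scal _ _ (pair1_mull h)); apply: eq_sweedler => g1 g2.
by rewrite (scalZ (pair1_mull h)) [pair 1 (g1 * j)]pair1_act mulrC.
Qed.

Let comul1_lhs a1 a2 a3 :
  test3 ipair a1 a2 a3 (tmap DB id (DB 1)) = epsA (val a1 * val a2 * val a3).
Proof.
rewrite /test3 (sweedler_tmap _ _ _ (test3_bilin ipair_perfect a1 a2 a3)).
transitivity (pair (a1 * a2 * a3) 1).
  rewrite -DBP; apply: eq_sweedler => b1 b2; congr (_ * _); exact: DBP.
by rewrite pair_act act1.
Qed.

(** The product m of the middle factors is either of the two orders; both act alike since
left and right multiplications of M1 commute. *)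
Let comul1_rhs (m : B -> B -> B) a1 a2 a3 :
    (forall b, linear (m b)) -> (forall b, linear (m^~ b)) ->
    (forall f1 f2, pair a2 (m (VB f2) (phi1 f1)) = epsA (val f2 * val a2 * val f1)) ->
  test3 ipair a1 a2 a3
    (sweedler (fun a b => sweedler (fun c d => (a ⊗ m b c) ⊗ d) (DB 1)) (DB 1)) =
  epsA (val a1 * val a2 * val a3).
Proof.
move=> mr ml mE; have t3L := test3_scalar ipair_perfect a1 a2 a3.
rewrite (sweedler_scal _ _ t3L).
transitivity (sweedler (fun a b => ipair a a1 *
    sweedler (fun c d => ipair (m b c) a2 * ipair d a3) (DB 1)) (DB 1)).
  apply: eq_sweedler => a b; rewrite (sweedler_scal _ _ t3L) mulr_sweedler.
  by apply: eq_sweedler => c d; rewrite (test3_pure ipair_perfect) -[LHS]mulrA.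
have pL u : scalar (ipair^~ u) := perfl ipair_perfect u.
rewrite sweedler_comul_one; last first.
  apply: bilin_mul; first exact: pL.
  apply: (@sweedler_param_linear k B B B k^o) => u v c b b'.
  by rewrite ml pL mulrDl -[_ * _ * _]mulrA.
rewrite -[val a1 * _ * _]mulrA -epsA_sep; last first.
  exact: (valP (a2 * a3)).
apply: eq_sweedler => f1 f2; congr (_ * _).
  by rewrite /ipair -[phi1 f1]mulr1 pair_phi1 act1.
rewrite sweedler_comul_one; last first.
  apply: bilin_mul; last exact: pL.
  by move=> c u v; rewrite mr pL.
rewrite [val f2 * _]mulrA -epsA_sep; last exact: (valP a3).
apply: eq_sweedler => g1 g2; rewrite /ipair mE; congr (_ * _).
by rewrite -[VB g2]mulr1 pair_VB act1.
Qed.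

Lemma B_comul1 : tmap DB id (DB 1) = hmul3 D (comul1_one D) (one_comul1 D).
Proof.
apply: (test3_ext ipair_perfect) => a1 a2 a3; rewrite comul1_lhs (hmul3_l algB) /=.
apply/esym; apply: comul1_rhs => [b c u v|b c u v|f1 f2] /=.
- by rewrite mulrDr scalerAr.
- by rewrite mulrDl scalerAl.
by rewrite pair_VB act_phi1 mulrA.
Qed.

Lemma B_comul1' : tmap DB id (DB 1) = hmul3 D (one_comul1 D) (comul1_one D).
Proof.
apply: (test3_ext ipair_perfect) => a1 a2 a3; rewrite comul1_lhs (hmul3_r algB) /=.
apply/esym; apply: (@comul1_rhs (fun b c => c * b)) => [b c u v|b c u v|f1 f2] /=.
- by rewrite mulrDl scalerAl.
- by rewrite mulrDr scalerAr.
by rewrite pair_phi1 actVB.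
Qed.

Lemma B_antipode_l h :
  sweedler (fun h1 h2 => h1 * SB h2) (DB h) =
  sweedler (fun a b => pair 1 a *: b) (tmul *%R *%R (DB 1) (h ⊗ 1)).
Proof.
have bil : bilin (fun a b : B => pair 1 a *: b) by exact/bilin_scale/pair_linr.
rewrite antipode_left (sweedler_tmul_one algB _ _ bil) /= sweedler_comul_one; last first.
  apply: bilin_scale => c u v; rewrite mulrDl -scalerAl; exact: pair_linr.
rewrite -[counitV h]sep_epsA (sweedler_lin _ _ VB_linear); apply: eq_sweedler => f1 f2.
by rewrite (linZ VB_linear) pair_phi1 rmorph1.
Qed.

Lemma B_antipode_r h :
  sweedler (fun h1 h2 => SB h1 * h2) (DB h) =
  sweedler (fun a b => pair 1 b *: a) (tmul *%R *%R (1 ⊗ h) (DB 1)).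
Proof.
have cP : e2 * d * W * val h \in inC by rewrite !rpredM ?inC_e2 ?inC_d ?inC_V ?inC_B.
rewrite antipode_right (sweedler_one_tmul algB) /=; first last.
- by move=> y0 c u v; rewrite pair_linr scalerDl scalerA.
- by move=> x0 c u v; rewrite scalerDr !scalerA mulrC.
rewrite sweedler_comul_one; last first.
  by apply: bilin_scaler => c u v; rewrite mulrDr -scalerAr; exact: pair_linr.
have -> : counitW h = sweedler (fun f1 f2 => pair 1 (h * VB f2) *: f1) f.
  transitivity (l ^- 2 *: (EV cP * z)); last first.
    rewrite -sep_tau (sweedler_lin (h := *:%R (l ^- 2))); last first.
      by move=> c a b; rewrite scalerDr !scalerA mulrC.
    apply: eq_sweedler => f1 f2; rewrite scalerA; congr (_ *: _).
    have -> : pair 1 (h * VB f2) = pair (VA f2) h.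
      by rewrite !pair_act vBM actM actVB mulr1.
    by rewrite /pair !mulrA.
  rewrite /counitW [RHS]scalerAl; congr (_ * _); apply: val_inj.
  transitivity (l^-1 *: E2 (e2 * W * val h)); first by rewrite /= linearZ.
  have -> : val (l ^- 2 *: EV cP) = l ^- 2 *: E2 (EB (e2 * d * W * val h)) by [].
  rewrite (EB_mulr h) (EB_mulr (VB w)) (EB_mull eB) EB_d -scalerAr mulr1 -!scalerAl linearZ.
  have l3 : l ^- 2 * l = l^-1 by rewrite exprS expr1 invfM -mulrA mulVf ?mulr1.
  by rewrite scalerA l3.
rewrite (sweedler_lin _ _ phi1_linear); apply: eq_sweedler => f1 f2.
by rewrite (linZ phi1_linear).
Qed.

(** By coassociativity and antipode_left the left-hand side is S(h_(1)) (h_(2) |> 1), which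
the adjoint property and the module algebra property reduce to S(h). *)
Lemma B_antipode h :
  sweedler (fun h12 h3 => sweedler (fun h1 h2 => SB h1 * h2 * SB h3) h12)
    (tmap DB id (DB h)) = SB h.
Proof.
pose triple (t : (B ⊗ B) ⊗ B) := sweedler (fun h12 h3 =>
  sweedler (fun h1 h2 => SB h1 * h2 * SB h3) h12) t.
have lin1 (u v : B) : linear (fun b : B => SB b * u * v).
  by move=> c a b; rewrite SBL !mulrDl -!scalerAl.
have lin2 (u v : B) : linear (fun b : B => u * b * v).
  by move=> c a b; rewrite mulrDr mulrDl -scalerAr -scalerAl.
have lin12 c : linear (fun t : B ⊗ B => sweedler (fun h1 h2 => SB h1 * h2 * SB c) t).
  by apply: sweedler_linear => u; [exact: lin1|exact: lin2].
have lin3 (t : B ⊗ B) : linear (fun c => sweedler (fun h1 h2 => SB h1 * h2 * SB c) t).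
  by apply: sweedler_param_linear => p q c a b; rewrite SBL mulrDr -scalerAr.
have triple_linear : linear triple by exact: sweedler_linear.
have triple_pure a b c : triple ((a ⊗ b) ⊗ c) = SB a * b * SB c.
  rewrite /triple sweedler_pure; last exact: bilin_of_linear.
  by rewrite sweedler_pure //; apply: bilin_of_linear => u; [exact: lin1|exact: lin2].
have coassoc : tmap DB id (DB h) = sweedler (fun h1 h2 =>
    sweedler (fun h3 h4 => (h1 ⊗ h3) ⊗ h4) (DB h2)) (DB h).
  by have [_ _ co _ _] := coalgB; exact: co.
transitivity (triple (tmap DB id (DB h))); first by [].
rewrite coassoc (sweedler_lin _ _ triple_linear).
transitivity (sweedler (fun h1 h2 => SB h1 * VB (counitV h2)) (DB h)).
  apply: eq_sweedler => h1 h2; rewrite (sweedler_lin _ _ triple_linear) -antipode_left.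
  by rewrite mulr_sweedler; apply: eq_sweedler => h3 h4; rewrite triple_pure mulrA.
apply: B_test => a; rewrite act_sum val_sum_M1.
under eq_sweedler do rewrite vBM actM actVB tau_SB.
rewrite tau_SB -[val z * val a]mulr1 -act_comul.
rewrite -[sweedler _ _ * e1 * _]mulrA val_sum_M1.
by apply: eq_sweedler => h1 h2; rewrite mulr1 !mulrA.
Qed.

Theorem B_weak_hopf : is_weak_hopf D.
Proof.
split=> //=.
- exact: algB.
- exact: coalgB.
- exact: B_comulM.
- exact: B_counitM.
- exact: B_counitM'.
- exact: B_comul1.
- exact: B_comul1'.
- exact: B_antipode_l.
- exact: B_antipode_r.
- exact: B_antipode.
Qed.

(** ** The weak Hopf algebra A *)

Lemma A_weak_hopf : is_weak_hopf D'.
Proof. exact: (dual_weak_hopf pair_perfect AB_hopf_pairing algA B_weak_hopf). Qed.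

Lemma A_iso_dual : weak_hopf_isomorphic D' (dual_hopf D).
Proof. exact: (dual_iso pair_perfect AB_hopf_pairing). Qed.

Lemma B_finite_dim : finite_dim B.
Proof. exact: (perfect_finite_dim pair_perfect). Qed.

Theorem tower_weak_hopf :
  [/\ finite_dim B, is_weak_hopf D, is_weak_hopf D' & weak_hopf_isomorphic D' (dual_hopf D)].
Proof.
by split; [exact: B_finite_dim | exact: B_weak_hopf | exact: A_weak_hopf | exact: A_iso_dual].
Qed.

(** The separability element of A is lam a_j f1 (x) f2 b_j, with f the one of U. *)
Lemma A_semisimple (fU : U ⊗ U) : symmetric_separability fU -> semisimple A.
Proof.
move=> fUP; pose EU (a : A) : U := Sub (E1 (val a)) (E1_U a).
have UAL : linear UA by move=> c u v; apply: val_inj; rewrite /= !linearP.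
have UAM : {morph UA : u v / u * v} by move=> u v; apply: val_inj; rewrite /= rmorphM.
pose r1 := tower_casimir UA aj bj fU.
have abl h : \sum_j UA (EU (h * aj j)) * bj j = h.
  by apply: val_inj; rewrite -[RHS](proj1 (abP (val h))) raddf_sum.
have abr h : \sum_j aj j * UA (EU (bj j * h)) = h.
  by apply: val_inj; rewrite -[RHS](proj2 (abP (val h))) raddf_sum.
have index : \sum_j aj j * bj j = l^-1 *: 1.
  apply: val_inj; rewrite raddf_sum linearZ /= -(bc_index BC2).
  under eq_bigr do rewrite -[sval (bj _)](bc_dbl BC2) mulr_sumr.
  rewrite exchange_big; apply: eq_bigr => s _ /=.
  rewrite -[x' s in RHS](proj2 (abP (x' s))) mulr_suml; apply: eq_bigr => j _.
  by rewrite mulrA.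
apply: (@separable_semisimple k A tauA rA [seq (l *: q.1, q.2) | q <- r1]).
- exact: tauA_scalar.
- exact: rA_frobenius.
- move=> g h gP; rewrite !big_map /=.
  have gP' : bilin (fun u v => g (l *: u) v).
    by apply: (bilin_comp gP) => c u v //; rewrite scalerDr !scalerA mulrC.
  rewrite -(tower_casimir_comm abl abr UAL UAM fUP h gP').
  by apply: eq_bigr => q _; rewrite scalerAr.
rewrite big_map /=; under eq_bigr do rewrite -scalerAl.
rewrite -scaler_sumr (tower_casimir_mul _ _ UAL UAM fUP).
have UA1 : UA 1 = 1 by apply: val_inj; rewrite /= rmorph1.
under eq_bigr do rewrite UA1 mul1r.
by rewrite index scalerA mulfV ?scale1r.
Qed.

End Tower.

(** * The theorem *)

Theorem corollary3p21 (k : fieldType) (F : strongly_separable k) (T : {scalar base F})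
  (markov : symmetric_markov T)
  (symmetric_product :
     \sum_j dbr F j * dbl F j = (lam F)^-1 *: 1 \/
     forall u : U F, T0 T (val u) = T1 T (phi u))
  (U_separable : kanzaki_separable (U F))
  (U_nondegenerate : nondegenerate_trace (fun u : U F => T0 T (val u)))
  (depth2 : depth_two F) :
  (exists f w DB SB DA SA, duality_structure T f w DB SB DA SA) /\
  (forall f w DB SB DA SA, duality_structure T f w DB SB DA SA ->
     [/\ finite_dim (B F), is_weak_hopf (B_hopf T w DB SB),
         is_weak_hopf (A_hopf T w DA SA), semisimple (A F)
       & weak_hopf_isomorphic (A_hopf T w DA SA) (dual_hopf (B_hopf T w DB SB))]).
Proof.
have BC1 : basic_construction (Defs.incl F) (cexp F) (Defs.incl (F1 F)) (cexp (F1 F)) (e1 F) (lam F)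
  (dbl F) (dbr F) := jones_basic_construction F.
have BC2 : basic_construction (Defs.incl (F1 F)) (cexp (F1 F)) (Defs.incl (F2 F)) (cexp (F2 F)) (e2 F)
  (lam F) (dbl (F1 F)) (dbr (F1 F)) := jones_basic_construction (F1 F).
pose i1 := Defs.incl (F1 F); pose i2 := Defs.incl (F2 F).
pose E1 := cexp (F1 F); pose E2 := cexp (F2 F).
pose tau := T2 T.
have TL : scalar T by exact: linearP.
have tauL : scalar tau by move=> c u v; rewrite /tau /T2 /T1 /T0 !linearP.
have T0C := markov_T0 markov.
have tauC : is_trace tau.
  apply: (@jones_trace k (F1 F) (T0 T)).
  - by move=> c u v; rewrite /T0 !linearP.
  - exact: T0C.
  - by apply: jones_trace => //; exact: markov_T markov.
have E1i q : E1 (i1 q) = q by rewrite -[i1 q]mulr1 (bc_E'l BC1) (bc_E'1 BC1) mulr1.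
have E2i q : E2 (i2 q) = q by rewrite -[i2 q]mulr1 (bc_E'l BC2) (bc_E'1 BC2) mulr1.
have tauE2 c : tau (i2 (E2 c)) = tau c by rewrite /tau /T2 E2i.
have tauE1 q : tau (i2 (i1 (E1 q))) = tau (i2 q) by rewrite /tau /T2 /T1 !E2i E1i.
have tau0 m : tau (i2 (i1 m)) = T0 T m by rewrite /tau /T2 /T1 E2i E1i.
have T0L : scalar (T0 T) by move=> c u v; rewrite /T0 !linearP.
have tau_index (u : U F) : tau (i2 (i1 (\sum_j dbl F j * val u * dbr F j))) =
    (lam F)^-1 * tau (i2 (i1 (val u))).
  rewrite !tau0; case: symmetric_product => [idx|TU].
    rewrite (scal_sum T0L) -(scalZ T0L) -[val u in RHS]mul1r scalerAl -idx mulr_suml.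
    rewrite (scal_sum T0L); apply: eq_bigr => j _.
    by rewrite T0C mulrA.
  rewrite TU /T1 /phi linear_sum /= -(scalZ T0L) -/(T0 T) scaler_sumr.
  congr (T0 T _); apply: eq_bigr => j _.
  by rewrite jones_cexpE scalerA mulVf ?(lam_neq0 F) // scale1r.
have [fU fUP] := U_separable.
have [U_trace U_nondeg] := U_nondegenerate.
have TUL : scalar (fun u : U F => T0 T (val u)) by move=> c u v; rewrite linearP T0L.
have [wU [zwU wzU]] := sep_trace_inv fUP TUL U_trace U_nondeg.
have rUP := sep_frobenius fUP TUL U_trace zwU.
have rUP' : frobenius (fun u : U F => tau (i2 (i1 (val u)))) [seq (q.1, q.2 * wU) | q <- repr fU].
  by move=> u; rewrite -[RHS]rUP; apply: eq_bigr => q _; rewrite tau0.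
have [[na [aj [bj abP]]] [nb [uj [vj uvP]]]] := depth2.
split.
  pose h := antiV BC1.
  have hL : linear h := antiV_linear BC1.
  have fP : symmetric_separability (tmap h h fU).
    apply: anti_sep => //; [exact: antiV1 | exact: antiV_mul | exact: antiV_surj].
  have tau_h u : tau (i2 (val (h u))) = T0 T (val u).
    have Eh : E1 (val (h u)) = lam F *: \sum_s dbl F s * val u * dbr F s.
      rewrite /= /anti linear_sum /= scaler_sumr; apply: eq_bigr => s _.
      rewrite mulrA -rmorphM (bc_E'r BC1) (bc_E'l BC1) (bc_E'e BC1).
      by rewrite -scalerAr mulr1 [RHS]scalerAl.
    transitivity (T0 T (E1 (val (h u)))); first by rewrite /tau /T2 E2i.
    have := tau_index u; rewrite Eh (scalZ T0L) !tau0 => ->.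
    by rewrite mulrA mulfV ?(lam_neq0 F) // mul1r.
  have zE : V_trace T (tmap h h fU) = h (sep_trace fU (fun u : U F => T0 T (val u))).
    have bil : bilin (fun a b : V F => tau (i2 (val b)) *: a).
      by apply: bilin_scaler => c u v; rewrite !linearP tauL.
    rewrite [LHS](sweedler_tmap _ _ _ bil) (sweedler_lin _ _ hL).
    by apply: eq_sweedler => a b; rewrite tau_h (linZ hL).
  have wz : h wU * V_trace T (tmap h h fU) = 1.
    by rewrite zE (antiV_mul BC1) zwU; exact: (antiV1 BC1).
  have zw : V_trace T (tmap h h fU) * h wU = 1.
    by rewrite zE (antiV_mul BC1) wzU; exact: (antiV1 BC1).
  have [DB [SB [DA [SA [DBP SB_bij SBP DAP SAP]]]]] :=
    duality_exists BC1 BC2 tauL tauC tauE2 tauE1 abP rUP' wz zw.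
  exists (tmap h h fU), (h wU), DB, SB, DA, SA; split=> //.
(* This is tower_weak_hopf for the tower at hand, up to unfolding definitions. *)
have bridge : forall (f : V F ⊗ V F) (w z : V F), symmetric_separability f ->
    w * z = 1 -> z * w = 1 -> z = V_trace T f ->
  forall DB : B F -> B F ⊗ B F,
    (forall a1 a2 b, sweedler (fun b1 b2 => pairing T w a1 b1 * pairing T w a2 b2) (DB b) =
      pairing T w (a1 * a2) b) ->
  forall SB : B F -> B F, linear SB -> (forall a b, pairing T w a b = pairing' T w a (SB b)) ->
  forall (DA : A F -> A F ⊗ A F) (SA : A F -> A F),
    (forall a b1 b2, sweedler (fun a1 a2 => pairing T w a1 b1 * pairing T w a2 b2) (DA a) =
      pairing T w a (b1 * b2)) ->
    (forall a b, pairing T w (SA a) b = pairing T w a (SB b)) ->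
  [/\ finite_dim (B F), is_weak_hopf (B_hopf T w DB SB), is_weak_hopf (A_hopf T w DA SA)
    & weak_hopf_isomorphic (A_hopf T w DA SA) (dual_hopf (B_hopf T w DB SB))].
  exact_no_check (tower_weak_hopf BC1 BC2 tauL tauC tauE2 tauE1 tau_index abP uvP rUP').
move=> f w DB SB DA SA [fP [wz zw] DBP SB_bij SBP DAP SAP].
have [Bfin BH AH iso] := bridge f w _ fP wz zw erefl DB DBP SB (@linearP _ _ _ _ SB) SBP DA SA DAP SAP.
split=> //.
exact: (A_semisimple BC1 BC2 tauL tauE1 abP rUP' fUP).
Qed.
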